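(* Suppose $\kappa$ is $\Pi^1_\xi$-indescribable where $\xi<\kappa^+$. Then for all $\zeta<\xi$ we have $\Pi^1_\zeta(\kappa)\subsetneq\Pi^1_\xi(\kappa)$.
   Context: Canonical functions. For every regular cardinal $\kappa$ and every ordinal $\xi$ with $\kappa\le\xi<\kappa^+$ fix a bijection $b_{\kappa,\xi}:\kappa\to\xi$, with $b_{\kappa,\kappa}=\mathrm{id}_\kappa$. For $\xi<\kappa^+$ and $\alpha<\kappa$ let $F^\kappa_\xi(\alpha)=\xi$ if $\xi<\kappa$, and $F^\kappa_\xi(\alpha)=b_{\kappa,\xi}[\alpha]$ if $\kappa\le\xi<\kappa^+$. Let $f^\kappa_\xi(\alpha)=\mathrm{ot}(F^\kappa_\xi(\alpha))$ and let $\pi^\kappa_{\xi,\alpha}:F^\kappa_\xi(\alpha)\to f^\kappa_\xi(\alpha)$ be the transitive collapse. Formulas. A formula is $\Pi^1_0$ (equivalently $\Sigma^1_0$) over $V_\kappa$ if it is a first-order formula of set theory (only first-order quantifiers) in which free variables and parameters of two types may occur: first-order ones (ranging over, resp. being, elements of $V_\kappa$) and second-order ones (ranging over, resp. being, subsets of $V_\kappa$). It is $\Pi^1_{\xi+1}$ over $V_\kappa$ if it has the form $\forall X_{k_1}\cdots\forall X_{k_m}\psi$ with $\psi$ a $\Sigma^1_\xi$ formula over $V_\kappa$, and $\Sigma^1_{\xi+1}$ if it has the form $\exists X_{k_1}\cdots\exists X_{k_m}\psi$ with $\psi$ a $\Pi^1_\xi$ formula over $V_\kappa$ ($m\in\omega$;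 second-order quantifiers). For $\xi$ a limit, a formula with finitely many second-order free variables and finitely many second-order parameters is $\Pi^1_\xi$ over $V_\kappa$ if it has the form $\bigwedge_{\zeta<\xi}\varphi_\zeta$ with each $\varphi_\zeta$ being $\Pi^1_\zeta$ over $V_\kappa$, and $\Sigma^1_\xi$ if it has the form $\bigvee_{\zeta<\xi}\varphi_\zeta$ with each $\varphi_\zeta$ being $\Sigma^1_\zeta$ over $V_\kappa$. Restriction. For $\varphi$ a $\Pi^1_\xi$ or $\Sigma^1_\xi$ formula over $V_\kappa$, $\xi<\kappa^+$, and $\alpha<\kappa$ regular, $\varphi|^\kappa_\alpha$ is defined by recursion on $\xi$. If $\xi<\kappa$, replace each second-order parameter $A_i$ by $A_i\cap V_\alpha$. If $\xi=\zeta+1\geq\kappa$, the restriction of $\forall\vec X\psi$ is $\forall\vec X(\psi|^\kappa_\alpha)$ and that of $\exists\vec X\psi$ is $\exists\vec X(\psi|^\kappa_\alpha)$. If $\xi\ge\kappa$ is a limit and $\varphi=\bigwedge_{\zeta<\xi}\psi_\zeta$, then $\varphi|^\kappa_\alpha=\bigwedge_{\zeta<f^\kappa_\xi(\alpha)}\psi_{(\pi^\kappa_{\xi,\alpha})^{-1}(\zeta)}|^\kappa_\alpha$, provided $\psi_{(\pi^\kappa_{\xi,\alpha})^{-1}(\zeta)}|^\kappa_\alpha$ is a $\Pi^1_\zeta$ formula over $V_\alpha$ for every $\zeta<f^\kappa_\xi(\alpha)$; otherwise undefined. Similarly for $\Sigma^1_\xi$ with $\bigvee$. Indescribability. For a cardinal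 $\kappa$ and $\xi<\kappa^+$, a set $S\subseteq\kappa$ is $\Pi^1_\xi$-indescribable (in $\kappa$) if for every $\Pi^1_\xi$ sentence $\varphi$ over $V_\kappa$ (parameters allowed), if $V_\kappa\models\varphi$ then there is some $\alpha\in S$ with $V_\alpha\models\varphi|^\kappa_\alpha$ (which includes that $\varphi|^\kappa_\alpha$ is defined and is a formula over $V_\alpha$). The cardinal $\kappa$ is $\Pi^1_\xi$-indescribable if $S=\kappa$ is. $\Pi^1_\xi(\kappa)=\{X\subseteq\kappa: X\text{ is not }\Pi^1_\xi\text{-indescribable in }\kappa\}$. *)

(* Defs.v *)
From Stdlib Require Import List Classical ClassicalEpsilon.
From Stdlib Require Import FunctionalExtensionality PropExtensionality.
From Stdlib Require Import ProofIrrelevance.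
Import ListNotations.

Set Implicit Arguments.
Unset Strict Implicit.
Unset Printing Implicit Defensive.

(** * The background set theory

    Universes of sets satisfying ZFC.  Separation and replacement are stated for
    arbitrary predicates and functions on the universe.  Consequently every
    function [M -> M] restricted to a set is (the action of) a set-theoretic
    function, and set-theoretic functions are represented below by functions
    [M -> M], of which only the values on the intended domain matter. *)

Record zfc : Type := Zfc {
  carrier :> Type;
  mem : carrier -> carrier -> Prop;
  empty : carrier;
  pair : carrier -> carrier -> carrier;
  bigcup : carrier -> carrier;
  power : carrier -> carrier;
  sep : carrier -> (carrier -> Prop) -> carrier;
  img : (carrier -> carrier) -> carrier -> carrier;
  extensionality : forall x y, (forall z, mem z x <-> mem z y) -> x = y;
  foundation : well_founded mem;
  mem_empty : forall z, ~ mem z empty;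
  mem_pair : forall x y z, mem z (pair x y) <-> z = x \/ z = y;
  mem_bigcup : forall x z, mem z (bigcup x) <-> exists y, mem y x /\ mem z y;
  mem_power : forall x z, mem z (power x) <-> forall y, mem y z -> mem y x;
  mem_sep : forall x P z, mem z (sep x P) <-> mem z x /\ P z;
  mem_img : forall f x z, mem z (img f x) <-> exists y, mem y x /\ z = f y;
  infinity : exists w, mem empty w /\
    forall x, mem x w -> mem (bigcup (pair x (pair x x))) w;
  choice : forall A,
    (forall x, mem x A -> exists y, mem y x) ->
    (forall x y z, mem x A -> mem y A -> mem z x -> mem z y -> x = y) ->
    exists C, forall x, mem x A -> exists! z, mem z x /\ mem z C
}.

Arguments empty {_}.

Notation "x ∈ y" := (mem x y) (at level 70, no associativity).
Notation "x ⊆ y" := (forall z, z ∈ x -> z ∈ y)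
  (at level 70, no associativity).

Section SetTheory.
Context {M : zfc}.
Implicit Types x y α β γ δ ζ η ξ κ μ ν A X S : M.

(** The object satisfying [P], for [P] satisfied by exactly one object. *)
Definition the (P : M -> Prop) : M := epsilon (inhabits empty) P.

(** ** Ordinals and cardinals *)

Definition transitive x : Prop := forall y, y ∈ x -> y ⊆ x.

Definition ordinal α : Prop :=
  transitive α /\ forall β, β ∈ α -> transitive β.

Definition succ α : M := bigcup (pair α (pair α α)).

Definition limit α : Prop :=
  ordinal α /\ (exists β, β ∈ α) /\ forall β, β ∈ α -> succ β ∈ α.

Definition bij_on (f : M -> M) x y : Prop :=
  (forall u, u ∈ x -> f u ∈ y) /\
  (forall u v, u ∈ x -> v ∈ x -> f u = f v -> u = v) /\
  (forall w, w ∈ y -> exists u, u ∈ x /\ f u = w).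

Definition cardinal κ : Prop :=
  ordinal κ /\ forall β, β ∈ κ -> ~ exists f, bij_on f β κ.

(** An infinite cardinal with no cofinal function from a smaller ordinal;
    an infinite cardinal is a cardinal that is a limit ordinal. *)
Definition regular κ : Prop :=
  cardinal κ /\ limit κ /\
  forall β f, β ∈ κ -> (forall γ, γ ∈ β -> f γ ∈ κ) ->
    exists δ, δ ∈ κ /\ forall γ, γ ∈ β -> f γ ∈ δ.

(** [κ^+], the least cardinal above [κ]. *)
Definition cardsucc κ : M :=
  the (fun μ => cardinal μ /\ κ ∈ μ /\
                forall ν, cardinal ν -> κ ∈ ν -> μ ⊆ ν).

(** [inV x α] says [x ∈ V_α], where [V_α] is the union of the power sets of
    the [V_β] for [β < α]. *)
Inductive inV : M -> M -> Prop :=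
| inV_intro x α β : β ∈ α -> (forall y, y ∈ x -> inV y β) -> inV x α.

Definition subV A α : Prop := forall x, x ∈ A -> inV x α.

(** The transitive collapse of [X], characterised by its recursion equation
    on [X]. *)
Definition collapse X : M -> M :=
  epsilon (inhabits (fun x => x))
    (fun g => forall x, x ∈ X -> g x = img g (sep X (fun y => y ∈ x))).

Definition ot X : M := img (collapse X) X.

(** ** Canonical functions *)

Definition canonical_bijections (b : M -> M -> M -> M) : Prop :=
  forall κ, regular κ ->
    (forall ξ, ξ ∈ cardsucc κ -> κ ⊆ ξ -> bij_on (b κ ξ) κ ξ) /\
    (forall β, β ∈ κ -> b κ κ β = β).

Section Canonical.
Variable b : M -> M -> M -> M.

Definition canF κ ξ α : M :=
  if excluded_middle_informative (ξ ∈ κ) then ξ else img (b κ ξ) α.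

Definition canf κ ξ α : M := ot (canF κ ξ α).

Definition canpi κ ξ α : M -> M := collapse (canF κ ξ α).

Definition canpi_inv κ ξ α ζ : M :=
  the (fun η => η ∈ canF κ ξ α /\ canpi κ ξ α η = ζ).

End Canonical.

(** ** Formulas *)

(** First-order variables and second-order variables are numbered separately;
    parameters are elements of the universe. *)
Inductive term : Type := Var (n : nat) | Par (a : M).

Inductive fo : Type :=
| Eq (s t : term)
| In (s t : term)
| Ap (s T : term)   (* [s] first-order, [T] second-order: s ∈ T *)
| Neg (p : fo)
| And (p q : fo)
| All (n : nat) (p : fo).

(** [Conj ξ ψ] is the conjunction of the [ψ ζ] for [ζ < ξ]; the values of [ψ]
    outside [ξ] are irrelevant. *)
Inductive form : Type :=
| Fo (p : fo)
| All2 (n : nat) (p : form)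
| Ex2 (n : nat) (p : form)
| Conj (ξ : M) (ψ : M -> form)
| Disj (ξ : M) (ψ : M -> form).

Definition all2s (ks : list nat) (p : form) : form := fold_right All2 p ks.
Definition ex2s (ks : list nat) (p : form) : form := fold_right Ex2 p ks.

Fixpoint fo_free1 (n : nat) (p : fo) : Prop :=
  match p with
  | Eq s t | In s t => s = Var n \/ t = Var n
  | Ap s _ => s = Var n
  | Neg p => fo_free1 n p
  | And p q => fo_free1 n p \/ fo_free1 n q
  | All m p => m <> n /\ fo_free1 n p
  end.

Fixpoint fo_free2 (n : nat) (p : fo) : Prop :=
  match p with
  | Eq _ _ | In _ _ => False
  | Ap _ T => T = Var n
  | Neg p => fo_free2 n p
  | And p q => fo_free2 n p \/ fo_free2 n q
  | All _ p => fo_free2 n p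
  end.

Fixpoint fo_par1 (a : M) (p : fo) : Prop :=
  match p with
  | Eq s t | In s t => s = Par a \/ t = Par a
  | Ap s _ => s = Par a
  | Neg p => fo_par1 a p
  | And p q => fo_par1 a p \/ fo_par1 a q
  | All _ p => fo_par1 a p
  end.

Fixpoint fo_par2 (A : M) (p : fo) : Prop :=
  match p with
  | Eq _ _ | In _ _ => False
  | Ap _ T => T = Par A
  | Neg p => fo_par2 A p
  | And p q => fo_par2 A p \/ fo_par2 A q
  | All _ p => fo_par2 A p
  end.

Fixpoint free1 (n : nat) (p : form) : Prop :=
  match p with
  | Fo p => fo_free1 n p
  | All2 _ p | Ex2 _ p => free1 n p
  | Conj ξ ψ | Disj ξ ψ => exists ζ, ζ ∈ ξ /\ free1 n (ψ ζ)
  end.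

Fixpoint free2 (n : nat) (p : form) : Prop :=
  match p with
  | Fo p => fo_free2 n p
  | All2 m p | Ex2 m p => m <> n /\ free2 n p
  | Conj ξ ψ | Disj ξ ψ => exists ζ, ζ ∈ ξ /\ free2 n (ψ ζ)
  end.

Fixpoint par2 (A : M) (p : form) : Prop :=
  match p with
  | Fo p => fo_par2 A p
  | All2 _ p | Ex2 _ p => par2 A p
  | Conj ξ ψ | Disj ξ ψ => exists ζ, ζ ∈ ξ /\ par2 A (ψ ζ)
  end.

Definition sentence (p : form) : Prop :=
  (forall n, ~ free1 n p) /\ (forall n, ~ free2 n p).

Definition finitary2 (p : form) : Prop :=
  (exists l : list nat, forall n, free2 n p -> List.In n l) /\
  (exists l : list M, forall A, par2 A p -> List.In A l).

Definition fo_over κ (p : fo) : Prop :=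
  (forall a, fo_par1 a p -> inV a κ) /\ (forall A, fo_par2 A p -> subV A κ).

(** [Pi1 κ ξ p]: [p] is a Π^1_ξ formula over V_κ; [Sigma1 κ ξ p]: [p] is
    Σ^1_ξ over V_κ.  Blocks of quantifiers may be empty. *)
Inductive Pi1 κ : M -> form -> Prop :=
| Pi1_0 p : fo_over κ p -> Pi1 κ empty (Fo p)
| Pi1_succ ξ ks p : ordinal ξ -> Sigma1 κ ξ p -> Pi1 κ (succ ξ) (all2s ks p)
| Pi1_limit ξ ψ : limit ξ -> (forall ζ, ζ ∈ ξ -> Pi1 κ ζ (ψ ζ)) ->
    finitary2 (Conj ξ ψ) -> Pi1 κ ξ (Conj ξ ψ)
with Sigma1 κ : M -> form -> Prop :=
| Sigma1_0 p : fo_over κ p -> Sigma1 κ empty (Fo p)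
| Sigma1_succ ξ ks p : ordinal ξ -> Pi1 κ ξ p -> Sigma1 κ (succ ξ) (ex2s ks p)
| Sigma1_limit ξ ψ : limit ξ -> (forall ζ, ζ ∈ ξ -> Sigma1 κ ζ (ψ ζ)) ->
    finitary2 (Disj ξ ψ) -> Sigma1 κ ξ (Disj ξ ψ).

(** ** Satisfaction in V_κ *)

Definition upd (e : nat -> M) (n : nat) (a : M) : nat -> M :=
  fun m => if PeanoNat.Nat.eq_dec m n then a else e m.

Definition val (e : nat -> M) (t : term) : M :=
  match t with Var n => e n | Par a => a end.

Fixpoint fo_sat κ (e1 e2 : nat -> M) (p : fo) : Prop :=
  match p with
  | Eq s t => val e1 s = val e1 t
  | In s t => val e1 s ∈ val e1 t
  | Ap s T => val e1 s ∈ val e2 T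
  | Neg p => ~ fo_sat κ e1 e2 p
  | And p q => fo_sat κ e1 e2 p /\ fo_sat κ e1 e2 q
  | All n p => forall a, inV a κ -> fo_sat κ (upd e1 n a) e2 p
  end.

Fixpoint sat κ (e1 e2 : nat -> M) (p : form) : Prop :=
  match p with
  | Fo p => fo_sat κ e1 e2 p
  | All2 n p => forall A, subV A κ -> sat κ e1 (upd e2 n A) p
  | Ex2 n p => exists A, subV A κ /\ sat κ e1 (upd e2 n A) p
  | Conj ξ ψ => forall ζ, ζ ∈ ξ -> sat κ e1 e2 (ψ ζ)
  | Disj ξ ψ => exists ζ, ζ ∈ ξ /\ sat κ e1 e2 (ψ ζ)
  end.

(** Used for sentences only, whose truth does not depend on the assignments. *)
Definition models κ (p : form) : Prop := forall e1 e2, sat κ e1 e2 p.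

(** ** Restriction *)

Fixpoint fo_restr α (p : fo) : fo :=
  match p with
  | Eq s t => Eq s t
  | In s t => In s t
  | Ap s (Var n) => Ap s (Var n)
  | Ap s (Par A) => Ap s (Par (sep A (fun x => inV x α)))
  | Neg p => Neg (fo_restr α p)
  | And p q => And (fo_restr α p) (fo_restr α q)
  | All n p => All n (fo_restr α p)
  end.

Section Indescribability.
Variable b : M -> M -> M -> M.

(** The recursion on the level of a formula is carried out along the formula.
    This is the same: a Π^1_ξ or Σ^1_ξ formula is first-order, or a
    conjunction or disjunction indexed by a limit [λ], preceded by finitely
    many second-order quantifiers, with [ξ] respectively finite or [λ + n];
    for infinite [κ] one has [ξ < κ] exactly when it is first-order or
    [λ < κ].  Below level [κ] only the second-order parameters change.
    [restr] is a total function; [restr_defined] tells when its value is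
    meaningful. *)
Fixpoint restr κ α (p : form) : form :=
  match p with
  | Fo p => Fo (fo_restr α p)
  | All2 n p => All2 n (restr κ α p)
  | Ex2 n p => Ex2 n (restr κ α p)
  | Conj ξ ψ =>
      if excluded_middle_informative (ξ ∈ κ)
      then Conj ξ (fun ζ => restr κ α (ψ ζ))
      else Conj (canf b κ ξ α)
                (fun ζ => restr κ α (ψ (canpi_inv b κ ξ α ζ)))
  | Disj ξ ψ =>
      if excluded_middle_informative (ξ ∈ κ)
      then Disj ξ (fun ζ => restr κ α (ψ ζ))
      else Disj (canf b κ ξ α)
                (fun ζ => restr κ α (ψ (canpi_inv b κ ξ α ζ)))
  end.

(** At limits [ξ ≥ κ] the restriction uses F^κ_ξ, which exists only for
    regular [κ]. *)
Fixpoint restr_defined κ α (p : form) : Prop :=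
  match p with
  | Fo _ => True
  | All2 _ p | Ex2 _ p => restr_defined κ α p
  | Conj ξ ψ =>
      ~ ξ ∈ κ -> regular κ /\
      forall ζ, ζ ∈ canf b κ ξ α ->
        restr_defined κ α (ψ (canpi_inv b κ ξ α ζ)) /\
        Pi1 α ζ (restr κ α (ψ (canpi_inv b κ ξ α ζ)))
  | Disj ξ ψ =>
      ~ ξ ∈ κ -> regular κ /\
      forall ζ, ζ ∈ canf b κ ξ α ->
        restr_defined κ α (ψ (canpi_inv b κ ξ α ζ)) /\
        Sigma1 α ζ (restr κ α (ψ (canpi_inv b κ ξ α ζ)))
  end.

(** The set [S ⊆ κ] is Π^1_ξ-indescribable in [κ]. *)
Definition indescribable_in κ ξ S : Prop :=
  forall p, Pi1 κ ξ p -> sentence p -> models κ p ->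
    exists α, α ∈ S /\ regular α /\ restr_defined κ α p /\
      (exists η, Pi1 α η (restr κ α p)) /\ models α (restr κ α p).

Definition indescribable κ ξ : Prop := indescribable_in κ ξ κ.

(** The ideal Π^1_ξ(κ). *)
Definition Pi1_ideal κ ξ : M :=
  sep (power κ) (fun X => ~ indescribable_in κ ξ X).

End Indescribability.
End SetTheory.

(** ** Existence of a universe

    [zfc] is inhabited: the well-founded trees, modulo extensional equality,
    form such a universe. *)

Module Trees.

Inductive tree : Type := node (A : Type) (f : A -> tree).

Definition leaf : tree := @node False (fun i => match i with end).

Fixpoint teq (x y : tree) : Prop :=
  match x, y with
  | node f, node g =>
      (forall i, exists j, teq (f i) (g j)) /\
      (forall j, exists i, teq (f i) (g j))
  end.

Definition tmem (x y : tree) : Prop :=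
  match y with node g => exists j, teq x (g j) end.

Lemma teq_refl x : teq x x.
Proof. induction x as [A f IH]; simpl; split; intros i; exists i; apply IH. Qed.

Lemma teq_sym x y : teq x y -> teq y x.
Proof.
revert y; induction x as [A f IH]; intros [B g] [H1 H2]; simpl; split.
- intros j; destruct (H2 j) as [i Hi]; exists i; auto.
- intros i; destruct (H1 i) as [j Hj]; exists j; auto.
Qed.

Lemma teq_trans x y z : teq x y -> teq y z -> teq x z.
Proof.
revert y z; induction x as [A f IH]; intros [B g] [C h] [H1 H2] [K1 K2].
simpl; split.
- intros i; destruct (H1 i) as [j Hj]; destruct (K1 j) as [k Hk].
  exists k; eauto.
- intros k; destruct (K2 k) as [j Hj]; destruct (H2 j) as [i Hi].
  exists i; eauto.
Qed.

Lemma tmem_teq x y z : tmem x y -> teq y z -> tmem x z.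
Proof.
destruct y as [A f], z as [B g]; intros [i Hi] [H _].
destruct (H i) as [j Hj]; exists j; eapply teq_trans; eauto.
Qed.

Lemma teq_tmem x y z : teq x y -> tmem y z -> tmem x z.
Proof.
destruct z as [A f]; intros H [i Hi]; exists i; eapply teq_trans; eauto.
Qed.

Lemma teq_ext x y : (forall z, tmem z x <-> tmem z y) -> teq x y.
Proof.
destruct x as [A f], y as [B g]; intros H; simpl; split.
- intros i; destruct (proj1 (H (f i))) as [j Hj]; [|now exists j].
  exists i; apply teq_refl.
- intros j; destruct (proj2 (H (g j))) as [i Hi].
  + exists j; apply teq_refl.
  + exists i; now apply teq_sym.
Qed.

Definition rep (x : tree) : tree := epsilon (inhabits leaf) (teq x).

Lemma rep_teq x : teq x (rep x).
Proof. unfold rep; apply epsilon_spec; exists x; apply teq_refl. Qed.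

Lemma rep_eq x y : teq x y -> rep x = rep y.
Proof.
intros H; unfold rep; f_equal; apply functional_extensionality; intros z.
apply propositional_extensionality; split; intros K.
- eapply teq_trans; [apply teq_sym|]; eassumption.
- eapply teq_trans; eassumption.
Qed.

Definition V : Type := {x : tree | rep x = x}.

Definition tr (x : V) : tree := proj1_sig x.

Lemma rep_rep x : rep (rep x) = rep x.
Proof. apply rep_eq, teq_sym, rep_teq. Qed.

Definition cls (x : tree) : V := exist (fun x => rep x = x) (rep x) (rep_rep x).

Lemma tr_cls x : teq x (tr (cls x)).
Proof. apply rep_teq. Qed.

Lemma V_eq (x y : V) : teq (tr x) (tr y) -> x = y.
Proof.
destruct x as [x Hx], y as [y Hy]; simpl; intros H.
assert (E : x = y) by (rewrite <- Hx, <- Hy; now apply rep_eq).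
subst y; f_equal; apply proof_irrelevance.
Qed.

Definition vmem (x y : V) : Prop := tmem (tr x) (tr y).

(** The set of the [f i]. *)
Definition fam (A : Type) (f : A -> V) : V := cls (node (fun i => tr (f i))).

Lemma vmem_fam A (f : A -> V) z : vmem z (fam f) <-> exists i, z = f i.
Proof.
unfold vmem, fam; split.
- intros H.
  destruct (tmem_teq H (teq_sym (tr_cls (node (fun i => tr (f i)))))) as [i Hi].
  exists i; now apply V_eq.
- intros [i ->]; eapply tmem_teq; [|apply tr_cls].
  exists i; apply teq_refl.
Qed.

(** Every element of [V] is such a family, indexed by its branches. *)
Definition idx (x : V) : Type := match tr x with @node A _ => A end.
Definition elt (x : V) : idx x -> V :=
  match tr x as t return match t with @node A _ => A end -> V with
  | node f => fun i => cls (f i)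
  end.

Lemma vmem_elt x z : vmem z x <-> exists i : idx x, z = elt i.
Proof.
unfold vmem, elt, idx; destruct (tr x) as [A f]; split; intros [i Hi]; exists i.
- apply V_eq; eapply teq_trans; [exact Hi|apply tr_cls].
- subst z; apply teq_sym, tr_cls.
Qed.

Lemma vext (x y : V) : (forall z, vmem z x <-> vmem z y) -> x = y.
Proof.
intros H; apply V_eq, teq_ext; intros t.
assert (K : forall w : V, tmem t (tr w) <-> vmem (cls t) w).
{ intros w; split; apply teq_tmem; [apply teq_sym|]; apply tr_cls. }
now rewrite !K.
Qed.

Lemma vwf : well_founded vmem.
Proof.
assert (K : forall t (x : V), teq (tr x) t -> Acc vmem x).
{ induction t as [A f IH]; intros x Hx; constructor; intros y Hy.
  destruct (tmem_teq Hy Hx) as [i Hi]; eapply IH; exact Hi. }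
intros x; exact (K _ x (teq_refl _)).
Qed.

Definition vempty : V := fam (fun i : False => match i with end).
Definition vpair (x y : V) : V := fam (fun i : bool => if i then x else y).
Definition vbigcup (x : V) : V :=
  fam (fun p : {i : idx x & idx (elt i)} => elt (projT2 p)).
Definition vsep (x : V) (P : V -> Prop) : V :=
  fam (fun p : {i : idx x | P (elt i)} => elt (proj1_sig p)).
Definition vpower (x : V) : V :=
  fam (fun Q : idx x -> Prop =>
         fam (fun p : {i : idx x | Q i} => elt (proj1_sig p))).
Definition vimg (f : V -> V) (x : V) : V := fam (fun i : idx x => f (elt i)).
Definition vsucc (x : V) : V := vbigcup (vpair x (vpair x x)).
Fixpoint vnat (n : nat) : V :=
  match n with 0 => vempty | S n => vsucc (vnat n) end.

Definition universe : zfc.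
Proof.
refine (@Zfc V vmem vempty vpair vbigcup vpower vsep vimg
          vext vwf _ _ _ _ _ _ _ _).
- intros z H; apply vmem_fam in H; now destruct H.
- intros x y z; unfold vpair; rewrite vmem_fam; split.
  + intros [[|] ->]; auto.
  + intros [-> | ->]; [now exists true | now exists false].
- intros x z; unfold vbigcup; rewrite vmem_fam; split.
  + intros [[i j] ->]; exists (elt i); simpl.
    split; apply vmem_elt; eauto.
  + intros [y [Hy Hz]]; apply vmem_elt in Hy; destruct Hy as [i ->].
    apply vmem_elt in Hz; destruct Hz as [j ->].
    now exists (existT (fun i => idx (elt i)) i j).
- intros x z; unfold vpower; rewrite vmem_fam; split.
  + intros [Q ->] y Hy; apply vmem_fam in Hy; destruct Hy as [p ->].
    apply vmem_elt; eauto.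
  + intros H; exists (fun i => vmem (elt i) z); apply vext; intros y.
    rewrite vmem_fam; split.
    * intros Hy; destruct (proj1 (vmem_elt _ _) (H y Hy)) as [i E]; subst y.
      now exists (exist (fun i => vmem (elt i) z) i Hy).
    * intros [[i Hi] ->]; exact Hi.
- intros x P z; unfold vsep; rewrite vmem_fam; split.
  + intros [[i Hi] ->]; simpl; split; [apply vmem_elt; eauto|exact Hi].
  + intros [Hz HP]; apply vmem_elt in Hz; destruct Hz as [i ->].
    now exists (exist (fun i => P (elt i)) i HP).
- intros f x z; unfold vimg; rewrite vmem_fam; split.
  + intros [i ->]; exists (elt i); split; [apply vmem_elt; eauto|reflexivity].
  + intros [y [Hy ->]]; apply vmem_elt in Hy; destruct Hy as [i ->]; eauto.
- exists (fam vnat); split.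
  + apply vmem_fam; now exists 0.
  + intros x Hx; apply vmem_fam in Hx; destruct Hx as [n ->].
    apply vmem_fam; now exists (S n).
- intros A Hne Hdis.
  set (c := fun x : V => epsilon (inhabits vempty) (fun y => vmem y x)).
  assert (Hc : forall x, vmem x A -> vmem (c x) x)
    by (intros x Hx; unfold c; apply epsilon_spec; auto).
  exists (fam (fun i : idx A => c (elt i))); intros x Hx; exists (c x); split.
  + split; [auto|]; apply vmem_fam.
    destruct (proj1 (vmem_elt _ _) Hx) as [i ->]; eauto.
  + intros z [Hz Hz']; apply vmem_fam in Hz'; destruct Hz' as [i ->].
    assert (Hi : vmem (elt i) A) by (apply vmem_elt; eauto).
    f_equal; eapply Hdis; eauto.
Defined.

End Trees.

(* Main.v *)
(** Write [G α ξ] for the set of the [η < ξ] whose code (the ordinal [η] itself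
    if [ξ < κ], its preimage under the bijection [b κ ξ] otherwise) lies in [α].
    For all [α] such that [V_α] is closed under a suitable function on [V_κ], a
    property that a first-order formula can force, [G α ξ] is F^κ_ξ(α) and the
    restriction of a formula to [α] is defined and says the same as the formula
    with each conjunction or disjunction over [ξ] taken over [G α ξ] only.  So
    indescribability becomes a reflection property that mentions no restriction
    and no transitive collapse.

    Inclusion: a Π^1_ζ formula is equivalent to a Π^1_(ζ+1) formula.  For [ζ] a
    limit, [⋀_(ν<ζ) ψ_ν] is rewritten as: for all [X], either [X] contains no code
    of an ordinal below [ζ], or for some [ν < ζ] the code of [ν] is in [X] and [ψ_ν].

    Strictness: there is a universal Π^1_ζ formula [W(A)], built from first-order
    truth predicates along the tree of subformulas.  Let [T] be the set of the
    regular [α < κ] such that, for some [A ⊆ V_α] and some function [B] on [V_α],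
    [W(A)] holds in [V_α] but in no [V_α'] with [α' < α] regular and [V_α'] closed
    under [B].  The least regular [α] at which a given true Π^1_ζ sentence holds
    (with [V_α] closed under the relevant function) is in [T], so [T] is
    Π^1_ζ-indescribable.  That all pairs [A], [B] reflect is a true Π^1_(ζ+1)
    sentence which fails at each point of [T], so [T] is not
    Π^1_(ζ+1)-indescribable. *)

From Stdlib Require Import List Classical ClassicalEpsilon FunctionalExtensionality.
From Stdlib Require Import Lia PeanoNat.
Import ListNotations.
Require Import Defs.

(** Closure points of a single function do the work of a club filter. The graph of the function is a
    legitimate second-order parameter, so a Π^1_ξ sentence can carry the demand as an extra
    conjunct. As the hierarchy is syntactic, that conjunct has to be attached to the first-order
    leaves, not to the root. Regularity of κ is not assumed, whereas canonical functions are given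
    for regular κ only. It is extracted from indescribability, before anything is known about
    F^κ_ξ(α). The data of a formula describe it correctly at closure points only. This is why
    non-reflection concerns pairs: [A] carries the formula, [B] a function that certifies the
    smaller points. Truth in V_α' for α' < κ relates elements of V_κ, so it enters the Π^1_(ζ+1)
    sentence as a parameter and need not be defined inside V_α. At level 0 a coded formula needs a
    truth predicate, itself a second-order object. In the sentence it is quantified universally next
    to [A] and [B], at no cost in complexity. Elsewhere it joins the nearest block of quantifiers,
    which shifts the finite levels by one below a limit. *)

Lemma choice_on (A B : Type) (b0 : B) (P : A -> Prop) (R : A -> B -> Prop) :
  (forall x, P x -> exists y, R x y) -> exists f : A -> B, forall x, P x -> R x (f x).
Proof.
intros H; exists (fun x => epsilon (inhabits b0) (R x)).
intros x Hx; apply epsilon_spec; auto.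
Qed.

(** * Membership, minimal elements and ordered pairs *)

Section Sets.
Context {M : zfc}.
Implicit Types x y z a α β γ δ ζ η ξ κ μ ν A X S : M.

Lemma ext_eq x y : (forall z, z ∈ x <-> z ∈ y) -> x = y.
Proof. apply extensionality. Qed.

Lemma mem_ind (P : M -> Prop) :
  (forall x, (forall y, y ∈ x -> P y) -> P x) -> forall x, P x.
Proof. intros H; exact (well_founded_ind (@foundation M) P H). Qed.

Lemma mem_irrefl x : ~ x ∈ x.
Proof. induction x as [x IH] using mem_ind; intros H; exact (IH x H H). Qed.

Lemma mem_asym x y : x ∈ y -> ~ y ∈ x.
Proof.
revert y; induction x as [x IH] using mem_ind; intros y H K.
exact (IH y K x K H).
Qed.

Lemma mem_minimal (P : M -> Prop) :
  (exists x, P x) -> exists x, P x /\ forall y, y ∈ x -> ~ P y.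
Proof.
intros [x Hx]; apply NNPP; intros N.
revert Hx; induction x as [x IH] using mem_ind; intros Hx; apply N; exists x; eauto.
Qed.

Lemma the_spec (P : M -> Prop) : (exists x, P x) -> P (the P).
Proof. intros H; unfold the; now apply epsilon_spec. Qed.

Lemma pair_inj a b c d :
  pair a b = pair c d -> (a = c /\ b = d) \/ (a = d /\ b = c :> M).
Proof.
intros E.
assert (H : forall z, z = a \/ z = b <-> z = c \/ z = d)
  by (intros z; rewrite <- !mem_pair; now rewrite E).
destruct (proj1 (H a) (or_introl eq_refl)) as [->| ->];
destruct (proj1 (H b) (or_intror eq_refl)) as [->| ->]; auto;
[destruct (proj2 (H d) (or_intror eq_refl)); subst|
 destruct (proj2 (H c) (or_introl eq_refl)); subst]; auto.
Qed.

Definition op x y : M := pair (pair x x) (pair x y).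

Lemma op_inj x y x' y' : op x y = op x' y' -> x = x' /\ y = y'.
Proof.
intros E; destruct (pair_inj _ _ _ _ E) as [[H K]|[H K]];
destruct (pair_inj _ _ _ _ H) as [[]|[]], (pair_inj _ _ _ _ K) as [[]|[]];
subst; auto.
Qed.

Lemma op_not_empty x y : op x y <> empty.
Proof.
intros E; apply (@mem_empty M (pair x x)); rewrite <- E.
apply mem_pair; auto.
Qed.

(** * Ordinals *)

Lemma ordinal_mem α β : ordinal α -> β ∈ α -> ordinal β.
Proof.
intros [T H] Hβ; split; [auto|].
intros γ Hγ; apply H; exact (T β Hβ γ Hγ).
Qed.

Lemma ordinal_trans α β γ : ordinal α -> β ∈ α -> γ ∈ β -> γ ∈ α.
Proof. intros [T _] H K; exact (T β H γ K). Qed.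

Lemma ordinal_trich α β : ordinal α -> ordinal β -> α ∈ β \/ α = β \/ β ∈ α.
Proof.
revert β; induction α as [α IHα] using mem_ind; intros β.
induction β as [β IHβ] using mem_ind; intros Hα Hβ.
destruct (classic (exists γ, γ ∈ α /\ ~ γ ∈ β)) as [[γ [Hγ N]]|N].
- destruct (IHα γ Hγ β (ordinal_mem _ _ Hα Hγ) Hβ) as [H|[<-|H]];
    [tauto|auto|right; right; exact (ordinal_trans _ _ _ Hα Hγ H)].
- destruct (classic (exists γ, γ ∈ β /\ ~ γ ∈ α)) as [[γ [Hγ N']]|N'].
  + destruct (IHβ γ Hγ Hα (ordinal_mem _ _ Hβ Hγ)) as [H|[->|H]];
      [left; exact (ordinal_trans _ _ _ Hβ Hγ H)|auto|tauto].
  + right; left; apply ext_eq; intros z; split; intros H; apply NNPP; intros K; eauto.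
Qed.

Lemma ordinal_sub_or_mem α β : ordinal α -> ordinal β -> (α ⊆ β) \/ β ∈ α.
Proof.
intros Hα Hβ; destruct (ordinal_trich α β Hα Hβ) as [H|[->|H]]; auto.
left; intros z; exact (ordinal_trans _ _ _ Hβ H).
Qed.

Lemma ordinal_sub_mem α β γ : ordinal α -> ordinal β -> ordinal γ ->
  α ⊆ β -> β ∈ γ -> α ∈ γ.
Proof.
intros Hα Hβ Hγ H K; destruct (ordinal_trich α γ Hα Hγ) as [L|[E|L]]; auto.
- subst; destruct (mem_irrefl _ (H _ K)).
- destruct (mem_asym _ _ K (H _ L)).
Qed.

Lemma mem_succ α β : β ∈ succ α <-> β = α \/ β ∈ α.
Proof.
unfold succ; rewrite mem_bigcup; split.
- intros [y [Hy Hb]]; apply mem_pair in Hy; destruct Hy as [-> | ->]; auto.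
  apply mem_pair in Hb; tauto.
- intros [-> | H]; [exists (pair α α)|exists α]; rewrite !mem_pair; auto.
Qed.

Lemma mem_succ_self α : α ∈ succ α.
Proof. apply mem_succ; auto. Qed.

Lemma ordinal_empty : @ordinal M empty.
Proof. split; intros y H; destruct (mem_empty H). Qed.

Lemma ordinal_succ α : ordinal α -> ordinal (succ α).
Proof.
intros [T H]; split.
- intros y Hy z Hz; apply mem_succ in Hy; apply mem_succ; right.
  destruct Hy as [->|Hy]; [auto|exact (T y Hy z Hz)].
- intros y Hy; apply mem_succ in Hy; destruct Hy as [->|Hy]; auto.
Qed.

Lemma ordinal_of_transitive x :
  transitive x -> (forall y, y ∈ x -> ordinal y) -> ordinal x.
Proof. intros T H; split; [auto|]; intros y Hy; apply H, Hy. Qed.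

Lemma succ_inj α β : succ α = succ β -> α = β.
Proof.
intros E; assert (H : α ∈ succ β) by (rewrite <- E; apply mem_succ_self).
assert (K : β ∈ succ α) by (rewrite E; apply mem_succ_self).
apply mem_succ in H, K; destruct H as [|H], K as [|K]; auto.
destruct (mem_asym _ _ H K).
Qed.

Lemma succ_not_empty α : succ α <> empty.
Proof.
intros E; apply (@mem_empty M α); rewrite <- E; apply mem_succ_self.
Qed.

Lemma limit_not_succ α : ~ limit (succ α).
Proof.
intros [_ [_ H]]; exact (mem_irrefl _ (H α (mem_succ_self α))).
Qed.

Lemma limit_not_empty : ~ @limit M empty.
Proof. intros [_ [[β H] _]]; destruct (mem_empty H). Qed.

Lemma ordinal_succ_mem α β : ordinal α -> β ∈ α -> succ β = α \/ succ β ∈ α.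
Proof.
intros Hα H; destruct (ordinal_trich (succ β) α) as [K|[K|K]]; auto.
- apply ordinal_succ; eauto 3 using ordinal_mem.
- apply mem_succ in K; destruct K as [->|K];
    [destruct (mem_irrefl _ H)|destruct (mem_asym _ _ H K)].
Qed.

Lemma ordinal_cases α : ordinal α ->
  α = empty \/ (exists β, ordinal β /\ α = succ β) \/ limit α.
Proof.
intros Hα; destruct (classic (exists β, β ∈ α /\ succ β = α)) as [[β [H E]]|N].
- right; left; exists β; split; [eauto 3 using ordinal_mem|auto].
- destruct (classic (exists β, β ∈ α)) as [H|H].
  + right; right; split; [auto|split; [auto|]].
    intros β Hβ; destruct (ordinal_succ_mem α β Hα Hβ); auto.
    destruct N; eauto.
  + left; apply ext_eq; intros z; split; intros K; [destruct H; eauto|].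
    destruct (mem_empty K).
Qed.

Lemma empty_mem α : ordinal α -> (exists β, β ∈ α) -> empty ∈ α.
Proof.
intros Hα [β Hβ]; destruct (ordinal_trich empty α ordinal_empty Hα) as [H|[<-|H]];
  auto; [destruct (mem_empty Hβ)|destruct (mem_empty H)].
Qed.

Lemma bigcup_succ α : ordinal α -> bigcup (succ α) = α.
Proof.
intros [T _]; apply ext_eq; intros z; rewrite mem_bigcup; split.
- intros [y [Hy Hz]]; apply mem_succ in Hy; destruct Hy as [->|Hy];
    [auto|exact (T y Hy z Hz)].
- intros H; exists α; split; [apply mem_succ_self|auto].
Qed.

Fixpoint num (n : nat) : M :=
  match n with 0 => empty | Datatypes.S n => succ (num n) end.

Lemma ordinal_num n : ordinal (num n).
Proof. induction n; [apply ordinal_empty|now apply ordinal_succ]. Qed.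

Lemma num_inj n m : num n = num m -> n = m.
Proof.
revert m; induction n; intros [|m] E; auto; simpl in E.
- destruct (succ_not_empty _ (eq_sym E)).
- destruct (succ_not_empty _ E).
- f_equal; apply IHn, succ_inj, E.
Qed.

Lemma num_limit α n : limit α -> num n ∈ α.
Proof.
intros [Hα [H K]]; induction n; [now apply empty_mem|now apply K].
Qed.

(** * The cumulative hierarchy *)

Lemma inV_unfold x α :
  inV x α <-> exists β, β ∈ α /\ forall y, y ∈ x -> inV y β.
Proof.
split; [intros [x' α' β H K]; eauto|intros [β [H K]]; econstructor; eauto].
Qed.

Lemma inV_mono x α β : transitive α -> β ∈ α -> inV x β -> inV x α.
Proof.
intros T H K; apply inV_unfold in K; destruct K as [γ [Hγ K]].
apply inV_unfold; exists γ; split; [exact (T β H γ Hγ)|auto].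
Qed.

Lemma inV_trans x y α : transitive α -> y ∈ x -> inV x α -> inV y α.
Proof.
intros T H K; apply inV_unfold in K; destruct K as [γ [Hγ K]].
eapply inV_mono; eauto.
Qed.

Lemma inV_ordinal α β : ordinal α -> ordinal β -> (inV β α <-> β ∈ α).
Proof.
intros Hα Hβ; split.
- revert β Hβ; induction α as [α IH] using mem_ind; intros β Hβ K.
  apply inV_unfold in K; destruct K as [γ [Hγ K]].
  apply (ordinal_sub_mem β γ α); auto; [eauto 3 using ordinal_mem|].
  intros δ Hδ; apply IH; [exact Hγ|eauto 3 using ordinal_mem|eauto 3 using ordinal_mem|auto].
- revert α Hα; induction β as [β IH] using mem_ind; intros α Hα K.
  apply inV_unfold; exists β; split; auto.
  intros γ Hγ; apply IH; auto; eauto 3 using ordinal_mem.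
Qed.

Lemma Vset_exists α : exists v, forall x, x ∈ v <-> inV x α.
Proof.
induction α as [α IH] using mem_ind.
destruct (choice_on M M empty _ _ IH) as [f Hf].
exists (bigcup (img (fun β => power (f β)) α)); intros x.
rewrite mem_bigcup, inV_unfold; split.
- intros [y [Hy Hx]]; apply mem_img in Hy; destruct Hy as [β [Hβ ->]].
  exists β; split; auto; intros z Hz; apply (Hf β Hβ); rewrite mem_power in Hx; auto.
- intros [β [Hβ H]]; exists (power (f β)); split; [apply mem_img; eauto|].
  apply mem_power; intros z Hz; apply (Hf β Hβ); auto.
Qed.

Definition Vset α : M := the (fun v => forall x, x ∈ v <-> inV x α).

Lemma mem_Vset α x : x ∈ Vset α <-> inV x α.
Proof. revert x; apply (the_spec _ (Vset_exists α)). Qed.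

Lemma subV_inV A α β : ordinal α -> β ∈ α -> subV A β -> inV A α.
Proof. intros H K L; apply inV_unfold; eauto. Qed.

Lemma subV_sep A α P : subV A α -> subV (sep A P) α.
Proof. intros H x Hx; apply mem_sep in Hx; apply H; tauto. Qed.

Lemma subV_empty α : subV empty α.
Proof. intros x Hx; destruct (mem_empty Hx). Qed.

Lemma inV_pair x y α : limit α -> inV x α -> inV y α -> inV (pair x y) α.
Proof.
intros [Hα [_ L]] Hx Hy; apply inV_unfold in Hx, Hy.
destruct Hx as [β [Hβ Hx]], Hy as [γ [Hγ Hy]].
assert (Oβ := ordinal_mem _ _ Hα Hβ); assert (Oγ := ordinal_mem _ _ Hα Hγ).
apply inV_unfold.
destruct (ordinal_trich β γ Oβ Oγ) as [H|[H|H]];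
[exists (succ γ)|exists (succ γ)|exists (succ β)]; (split; [auto|]);
intros z Hz; apply mem_pair in Hz; destruct Hz as [->| ->]; apply inV_unfold;
subst; eauto 6 using mem_succ_self; [exists β|exists γ]; split; auto;
apply mem_succ; auto.
Qed.

Lemma inV_op x y α : limit α -> inV x α -> inV y α -> inV (op x y) α.
Proof. intros H Hx Hy; unfold op; auto using inV_pair. Qed.

Lemma inV_op_inv x y α : transitive α -> inV (op x y) α -> inV x α /\ inV y α.
Proof.
intros T H; assert (K : inV (pair x y) α)
  by (apply (inV_trans (op x y)); auto; apply mem_pair; auto).
split; apply (inV_trans (pair x y)); auto; apply mem_pair; auto.
Qed.

Lemma inV_num n α : limit α -> inV (num n) α.
Proof.
intros H; apply inV_ordinal; [apply H|apply ordinal_num|now apply num_limit].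
Qed.

Lemma inV_empty α : limit α -> inV empty α.
Proof. exact (inV_num 0 α). Qed.

(** * The transitive collapse of a set of ordinals *)

(** [collapse] is an epsilon choice among the solutions of its recursion equation, so a solution
    must be exhibited. [Fix] yields one; the membership test turns the recursive call, available
    only below [x], into the total function that [img] expects. *)
Definition collapse_step X x (rec : forall y, y ∈ x -> M) : M :=
  img (fun y => match excluded_middle_informative (y ∈ x) with
                | left h => rec y h | right _ => empty end)
      (sep X (fun y => y ∈ x)).

Lemma collapse_eq X x : x ∈ X ->
  collapse X x = img (collapse X) (sep X (fun y => y ∈ x)).
Proof.
unfold collapse.
match goal with |- context [epsilon ?i ?P] => assert (E : exists g, P g) end.
{ exists (Fix (@foundation M) (fun _ => M : Type) (collapse_step X)).
  intros y Hy; rewrite Fix_eq.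
  - unfold collapse_step at 1; apply ext_eq; intros z; rewrite !mem_img.
    split; intros [u [Hu ->]]; exists u; (split; [auto|]);
    apply mem_sep in Hu; destruct Hu as [_ Hu];
    destruct (excluded_middle_informative (u ∈ y)); tauto.
  - intros u f g H; unfold collapse_step; f_equal; apply functional_extensionality.
    intros v; destruct (excluded_middle_informative (v ∈ u)); auto. }
match goal with |- context [epsilon ?i ?P] => generalize (epsilon_spec i P E) end.
intros H Hx; now apply H.
Qed.

Lemma mem_collapse X x z : x ∈ X ->
  (z ∈ collapse X x <-> exists y, y ∈ X /\ y ∈ x /\ z = collapse X y).
Proof.
intros Hx; rewrite (collapse_eq X x Hx), mem_img; split.
- intros [y [Hy ->]]; apply mem_sep in Hy; exists y; tauto.
- intros [y [H1 [H2 ->]]]; exists y; rewrite mem_sep; auto.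
Qed.

Lemma mem_ot X z : z ∈ ot X <-> exists y, y ∈ X /\ z = collapse X y.
Proof. unfold ot; now rewrite mem_img. Qed.

Section Collapse.
Variable X : M.
Hypothesis HX : forall x, x ∈ X -> ordinal x.

Lemma collapse_mem x y : x ∈ X -> y ∈ X ->
  (collapse X y ∈ collapse X x <-> y ∈ x).
Proof.
intros Hx Hy; assert (D : forall x y, x ∈ X -> y ∈ X -> y ∈ x ->
  collapse X y ∈ collapse X x) by (intros; apply mem_collapse; eauto).
split; [|auto].
intros H; destruct (ordinal_trich x y (HX _ Hx) (HX _ Hy)) as [K|[->|K]]; auto.
- destruct (mem_asym _ _ H); auto.
- destruct (mem_irrefl _ H).
Qed.

Lemma collapse_inj x y : x ∈ X -> y ∈ X -> collapse X x = collapse X y -> x = y.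
Proof.
intros Hx Hy E; destruct (ordinal_trich x y (HX _ Hx) (HX _ Hy)) as [K|[K|K]]; auto;
  exfalso; apply (collapse_mem) in K; auto; rewrite E in K; destruct (mem_irrefl _ K).
Qed.

Lemma transitive_collapse x : x ∈ X -> transitive (collapse X x).
Proof.
intros Hx y Hy z Hz; apply mem_collapse in Hy; auto.
destruct Hy as [u [Hu [Hux ->]]]; apply mem_collapse in Hz; auto.
destruct Hz as [v [Hv [Hvu ->]]]; apply collapse_mem; auto.
exact (ordinal_trans _ _ _ (HX _ Hx) Hux Hvu).
Qed.

Lemma ordinal_collapse x : x ∈ X -> ordinal (collapse X x).
Proof.
intros Hx; split; [now apply transitive_collapse|].
intros y Hy; apply mem_collapse in Hy; auto.
destruct Hy as [u [Hu [_ ->]]]; now apply transitive_collapse.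
Qed.

Lemma ordinal_ot : ordinal (ot X).
Proof.
apply ordinal_of_transitive.
- intros y Hy z Hz; apply mem_ot in Hy; destruct Hy as [u [Hu ->]].
  apply mem_collapse in Hz; auto; destruct Hz as [v [Hv [_ ->]]].
  apply mem_ot; eauto.
- intros y Hy; apply mem_ot in Hy; destruct Hy as [u [Hu ->]].
  now apply ordinal_collapse.
Qed.

(** The collapse of [z] depends only on the members of [X] below [z], and cutting [X] at [x] removes
    none of them when [z] lies below [x]. *)
Lemma collapse_initial Y x :
  (forall z, z ∈ Y <-> z ∈ X /\ z ∈ x) -> x ∈ X ->
  forall z, z ∈ Y -> collapse Y z = collapse X z.
Proof.
intros HY Hx z; induction z as [z IH] using mem_ind; intros Hz.
apply ext_eq; intros w.
rewrite !mem_collapse by (auto; now apply HY).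
assert (E : forall u, u ∈ z -> (u ∈ X <-> u ∈ Y)).
{ intros u Hu; rewrite HY; split; [|tauto]; split; auto.
  apply HY in Hz; exact (ordinal_trans _ _ _ (HX _ Hx) (proj2 Hz) Hu). }
split; intros [u [Hu [Hz' ->]]]; exists u; split; try tauto.
- now apply E.
- split; auto; apply IH; auto.
- now apply E.
- split; auto; symmetry; apply IH; auto; now apply E.
Qed.

(** For [X] a trace [G α ξ], this identifies the position of [η] in the trace with the order type of
    [G α η], that is, with the level which the restriction of the conjunct at [η] must have. *)
Lemma collapse_ot Y x :
  (forall z, z ∈ Y <-> z ∈ X /\ z ∈ x) -> x ∈ X -> collapse X x = ot Y.
Proof.
intros HY Hx; apply ext_eq; intros z; rewrite mem_ot, mem_collapse by auto.
split; intros [y Hy]; exists y; rewrite ?HY in *.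
- destruct Hy as [H1 [H2 ->]]; split; auto; symmetry.
  apply (collapse_initial Y x HY Hx); rewrite HY; auto.
- destruct Hy as [[H1 H2] ->]; repeat split; auto.
  apply (collapse_initial Y x HY Hx); rewrite HY; auto.
Qed.

End Collapse.

Lemma collapse_ordinal α β : ordinal α -> β ∈ α -> collapse α β = β.
Proof.
intros Hα; induction β as [β IH] using mem_ind; intros Hβ.
apply ext_eq; intros z; rewrite mem_collapse by auto; split.
- intros [y [H1 [H2 ->]]]; now rewrite IH.
- intros Hz; exists z; assert (z ∈ α) by (eapply ordinal_trans; eauto).
  rewrite IH; auto.
Qed.

Lemma ot_ordinal α : ordinal α -> ot α = α.
Proof.
intros Hα; apply ext_eq; intros z; rewrite mem_ot; split.
- intros [y [Hy ->]]; now rewrite collapse_ordinal.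
- intros Hz; exists z; now rewrite collapse_ordinal.
Qed.

(** * Successor cardinals *)

Definition injects α κ : Prop :=
  exists f, (forall γ, γ ∈ α -> f γ ∈ κ) /\
    forall γ δ, γ ∈ α -> δ ∈ α -> f γ = f δ -> γ = δ.

(** The well-order that [f] carries from [α] over to [κ], bounded by the Kuratowski pairs over [κ],
    which is [bigcup (pair κ κ)]. It is reflexive so that its domain can be read off: the strict
    order would not distinguish the ordinals 0 and 1. *)
Definition order_graph (f : M -> M) α κ : M :=
  sep (power (power (bigcup (pair κ κ)))) (fun z =>
    exists γ δ, γ ∈ α /\ δ ∈ α /\ γ ⊆ δ /\ z = op (f γ) (f δ)).

Lemma mem_order_graph (f : M -> M) α κ z : (forall γ, γ ∈ α -> f γ ∈ κ) ->
  (z ∈ order_graph f α κ <->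
   exists γ δ, γ ∈ α /\ δ ∈ α /\ γ ⊆ δ /\ z = op (f γ) (f δ)).
Proof.
intros Hf; unfold order_graph; rewrite mem_sep; split; [tauto|]; intros H; split; auto.
destruct H as [γ [δ [H1 [H2 [_ ->]]]]].
assert (K : forall u, u ∈ κ -> u ∈ bigcup (pair κ κ))
  by (intros u Hu; apply mem_bigcup; exists κ; rewrite mem_pair; auto).
apply mem_power; intros u Hu; apply mem_power; intros v Hv.
apply mem_pair in Hu; destruct Hu as [->| ->]; apply mem_pair in Hv;
destruct Hv as [->| ->]; auto.
Qed.

(** Isomorphic well-orders have the same order type: by induction on [γ], the two injections take
    the same value at each [γ] of [α]. *)
Lemma order_graph_inj (f g : M -> M) α β κ : ordinal α -> ordinal β ->
  (forall γ, γ ∈ α -> f γ ∈ κ) ->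
  (forall γ δ, γ ∈ α -> δ ∈ α -> f γ = f δ -> γ = δ) ->
  (forall γ, γ ∈ β -> g γ ∈ κ) ->
  (forall γ δ, γ ∈ β -> δ ∈ β -> g γ = g δ -> γ = δ) ->
  order_graph f α κ = order_graph g β κ -> α ⊆ β.
Proof.
intros Oα Oβ Hf If Hg Ig E.
assert (H : forall γ δ, γ ∈ α -> δ ∈ α -> γ ⊆ δ ->
  exists γ' δ', γ' ∈ β /\ δ' ∈ β /\ γ' ⊆ δ' /\ f γ = g γ' /\ f δ = g δ').
{ intros γ δ H1 H2 H3.
  assert (K : op (f γ) (f δ) ∈ order_graph g β κ)
    by (rewrite <- E; apply mem_order_graph; eauto 6).
  apply mem_order_graph in K; auto.
  destruct K as [γ' [δ' [K1 [K2 [K3 K4]]]]]; apply op_inj in K4.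
  exists γ', δ'; tauto. }
assert (K : forall γ δ, γ ∈ β -> δ ∈ β -> γ ⊆ δ ->
  exists γ' δ', γ' ∈ α /\ δ' ∈ α /\ γ' ⊆ δ' /\ g γ = f γ' /\ g δ = f δ').
{ intros γ δ H1 H2 H3.
  assert (K : op (g γ) (g δ) ∈ order_graph f α κ)
    by (rewrite E; apply mem_order_graph; eauto 6).
  apply mem_order_graph in K; auto.
  destruct K as [γ' [δ' [K1 [K2 [K3 K4]]]]]; apply op_inj in K4.
  exists γ', δ'; tauto. }
assert (L : forall γ, γ ∈ α -> γ ∈ β /\ f γ = g γ).
{ intros γ; induction γ as [γ IH] using mem_ind; intros Hγ.
  (* The reflexive pair at [γ] gives some [γ'] in [β] with the same value. Comparing predecessors in
     the common relation shows that [γ] and [γ'] have the same elements. *)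
  destruct (H γ γ Hγ Hγ (fun _ h => h)) as [γ' [_ [H1 [_ [_ [H2 _]]]]]].
  enough (γ = γ') by (subst; auto).
  apply ext_eq; intros δ; split; intros Hδ.
  - destruct (IH δ Hδ (ordinal_trans _ _ _ Oα Hγ Hδ)) as [I1 I2].
    destruct (H δ γ (ordinal_trans _ _ _ Oα Hγ Hδ) Hγ) as [u [v [J1 [J2 [J3 [J4 J5]]]]]].
    { intros z; apply (ordinal_trans _ _ _ (ordinal_mem _ _ Oα Hγ) Hδ). }
    assert (u = δ) by (apply Ig; auto; congruence).
    assert (v = γ') by (apply Ig; auto; congruence); subst u v.
    destruct (ordinal_trich δ γ') as [Q|[Q|Q]]; eauto using ordinal_mem.
    + subst δ; exfalso; assert (γ' = γ); [|subst; destruct (mem_irrefl _ Hδ)].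
      apply If; auto; [eapply ordinal_trans; eauto|congruence].
    + destruct (mem_irrefl _ (J3 _ Q)).
  - assert (Bδ : δ ∈ β) by (eapply ordinal_trans; eauto).
    destruct (K δ γ' Bδ H1) as [u [v [J1 [J2 [J3 [J4 J5]]]]]].
    { intros z; apply (ordinal_trans _ _ _ (ordinal_mem _ _ Oβ H1) Hδ). }
    assert (v = γ) by (apply If; auto; congruence); subst v.
    destruct (ordinal_trich u γ) as [Q|[Q|Q]]; eauto using ordinal_mem.
    + destruct (IH u Q J1) as [I1 I2].
      assert (u = δ) by (apply Ig; auto; congruence); now subst.
    + subst u; assert (δ = γ') by (apply Ig; auto; congruence).
      subst; destruct (mem_irrefl _ Hδ).
    + destruct (mem_irrefl _ (J3 _ Q)). }
intros γ Hγ; now apply L.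
Qed.

(** An ordinal that injects into [κ] can be decoded from the relation it induces on [κ]. All these
    relations lie in one power set, so replacement collects the ordinals. *)
Lemma hartogs κ : exists h, forall α, α ∈ h <-> ordinal α /\ injects α κ.
Proof.
set (dec := fun R => the (fun α => ordinal α /\ exists f,
  (forall γ, γ ∈ α -> f γ ∈ κ) /\
  (forall γ δ, γ ∈ α -> δ ∈ α -> f γ = f δ -> γ = δ) /\ R = order_graph f α κ)).
exists (sep (img dec (power (power (power (bigcup (pair κ κ))))))
         (fun α => ordinal α /\ injects α κ)).
intros α; rewrite mem_sep; split; [tauto|]; intros H; split; auto.
destruct H as [Oα [f [H1 H2]]]; apply mem_img; exists (order_graph f α κ); split.
- apply mem_power; intros z Hz; unfold order_graph in Hz; apply mem_sep in Hz; tauto.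
- set (P := fun α' => ordinal α' /\ exists f',
    (forall γ, γ ∈ α' -> f' γ ∈ κ) /\
    (forall γ δ, γ ∈ α' -> δ ∈ α' -> f' γ = f' δ -> γ = δ) /\
    order_graph f α κ = order_graph f' α' κ).
  assert (Q : P (dec (order_graph f α κ)))
    by (apply (the_spec P); exists α; split; [auto|exists f; auto]).
  destruct Q as [O [f' [K1 [K2 K3]]]].
  apply ext_eq; intros z; split.
  + eapply (order_graph_inj f f'); eauto.
  + eapply (order_graph_inj f' f); eauto.
Qed.

Lemma cardsucc_spec κ : cardinal κ ->
  cardinal (cardsucc κ) /\ κ ∈ cardsucc κ /\
  forall ν, cardinal ν -> κ ∈ ν -> cardsucc κ ⊆ ν.
Proof.
intros [Oκ Cκ]; unfold cardsucc.
apply (the_spec (fun μ => cardinal μ /\ κ ∈ μ /\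
   forall ν, cardinal ν -> κ ∈ ν -> μ ⊆ ν)).
destruct (hartogs κ) as [h Hh]; exists h.
assert (Oh : ordinal h).
{ apply ordinal_of_transitive; [|intros y Hy; now apply Hh].
  intros y Hy z Hz; apply Hh in Hy; apply Hh; destruct Hy as [Oy [f [H1 H2]]].
  split; [eauto 3 using ordinal_mem|].
  exists f; split; intros; [apply H1|apply H2]; eauto using ordinal_trans. }
assert (Nh : ~ h ∈ h) by apply mem_irrefl.
split; [split; [exact Oh|]|split].
(* A bijection from a smaller [β] onto [h] would inject [h] into [κ] by way of [β], and so make [h]
   an element of itself. *)
- intros β Hβ [f [H1 [H2 H3]]]; apply Nh, Hh; split; auto.
  assert (Hβ' := Hβ); apply Hh in Hβ'; destruct Hβ' as [Oβ [g [G1 G2]]].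
  destruct (choice_on M M empty (fun w => w ∈ h)
     (fun w u => u ∈ β /\ f u = w) H3) as [k Hk].
  exists (fun w => g (k w)); split.
  + intros γ Hγ; apply G1, (Hk γ Hγ).
  + intros γ δ Hγ Hδ E; apply G2 in E; [|apply (Hk γ Hγ)|apply (Hk δ Hδ)].
    destruct (Hk γ Hγ) as [_ <-], (Hk δ Hδ) as [_ <-]; congruence.
- apply Hh; split; auto; exists (fun x => x); auto.
- intros ν [Oν Cν] Hν z Hz; apply Hh in Hz; destruct Hz as [Oz [f [F1 F2]]].
  destruct (ordinal_sub_or_mem ν z Oν Oz) as [H|H]; auto; exfalso.
  (* [ν] injects into [κ]; its order type in [κ] is at most [κ < ν] *)
  set (X := img f ν).
  assert (IX : forall x, x ∈ X -> x ∈ κ).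
  { intros x Hx; apply mem_img in Hx; destruct Hx as [y [Hy ->]]; auto. }
  assert (OX : forall x, x ∈ X -> ordinal x) by (eauto using ordinal_mem).
  assert (Hle : forall x, x ∈ X -> collapse X x ⊆ x).
  { intros x; induction x as [x IH] using mem_ind; intros Hx u Hu.
    apply mem_collapse in Hu; auto; destruct Hu as [y [Y1 [Y2 ->]]].
    apply (ordinal_sub_mem _ y); auto; apply ordinal_collapse; auto. }
  assert (Hot : ot X ⊆ κ).
  { intros u Hu; apply mem_ot in Hu; destruct Hu as [y [Hy ->]].
    apply (ordinal_sub_mem _ y); auto; apply ordinal_collapse; auto. }
  assert (Oot : ordinal (ot X)) by (now apply ordinal_ot).
  assert (Lot : ot X ∈ ν) by (apply (ordinal_sub_mem _ κ); auto).
  destruct (choice_on M M empty (fun w => w ∈ ot X)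
     (fun w u => u ∈ ν /\ w = collapse X (f u))) as [k Hk].
  { intros w Hw; apply mem_ot in Hw; destruct Hw as [y [Hy ->]].
    apply mem_img in Hy; destruct Hy as [u [Hu ->]]; eauto. }
  apply (Cν (ot X) Lot); exists k; split; [|split].
  + intros u Hu; apply (Hk u Hu).
  + intros u v Hu Hv E; destruct (Hk u Hu) as [_ ->], (Hk v Hv) as [_ ->]; congruence.
  + intros w Hw; assert (Hfw : f w ∈ X) by (apply mem_img; eauto).
    exists (collapse X (f w)).
    assert (Q : collapse X (f w) ∈ ot X) by (apply mem_ot; eauto).
    split; auto; destruct (Hk _ Q) as [K1 K2].
    apply (collapse_inj X OX) in K2; [|exact Hfw|apply mem_img; eauto].
    symmetry; apply F2; auto.
Qed.

End Sets.

(** * Operations on formulas *)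

Section Syntax.
Context {M : zfc}.
Implicit Types (α β ζ η ξ κ a A : M) (p : @form M) (q χ : @fo M).

Fixpoint neg (p : @form M) : form :=
  match p with
  | Fo q => Fo (Neg q)
  | All2 n p => Ex2 n (neg p)
  | Ex2 n p => All2 n (neg p)
  | Conj ξ ψ => Disj ξ (fun ζ => neg (ψ ζ))
  | Disj ξ ψ => Conj ξ (fun ζ => neg (ψ ζ))
  end.

(** Conjunction at the root would not be a Π^1_ζ formula in the syntactic sense. Distributing [χ]
    over all first-order leaves preserves the level and the shape of [p]. *)
Fixpoint andfo (χ : @fo M) (p : form) : form :=
  match p with
  | Fo q => Fo (And q χ)
  | All2 n p => All2 n (andfo χ p)
  | Ex2 n p => Ex2 n (andfo χ p)
  | Conj ξ ψ => Conj ξ (fun ζ => andfo χ (ψ ζ))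
  | Disj ξ ψ => Disj ξ (fun ζ => andfo χ (ψ ζ))
  end.

Fixpoint fo_shift (q : @fo M) : fo :=
  match q with
  | Ap s (Var n) => Ap s (Var (S n))
  | Neg q => Neg (fo_shift q)
  | And q r => And (fo_shift q) (fo_shift r)
  | All n q => All n (fo_shift q)
  | q => q
  end.

(** Free and bound second-order variables move together, so nothing is captured and variable 0
    becomes available for the new quantifier of the level-raising construction. *)
Fixpoint shift (p : @form M) : form :=
  match p with
  | Fo q => Fo (fo_shift q)
  | All2 n p => All2 (S n) (shift p)
  | Ex2 n p => Ex2 (S n) (shift p)
  | Conj ξ ψ => Conj ξ (fun ζ => shift (ψ ζ))
  | Disj ξ ψ => Disj ξ (fun ζ => shift (ψ ζ))
  end.

Fixpoint fo_sub (σ : nat -> option M) (q : @fo M) : fo :=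
  match q with
  | Ap s (Var n) => Ap s (match σ n with Some A => Par A | None => Var n end)
  | Neg q => Neg (fo_sub σ q)
  | And q r => And (fo_sub σ q) (fo_sub σ r)
  | All n q => All n (fo_sub σ q)
  | q => q
  end.

Definition hide2 (σ : nat -> option M) n m : option M :=
  if Nat.eq_dec m n then None else σ m.

(** Parameters in place of free second-order variables: this makes a sentence, to which
    indescribability applies, out of an instance of the universal formula. *)
Fixpoint sub (σ : nat -> option M) (p : @form M) : form :=
  match p with
  | Fo q => Fo (fo_sub σ q)
  | All2 n p => All2 n (sub (hide2 σ n) p)
  | Ex2 n p => Ex2 n (sub (hide2 σ n) p)
  | Conj ξ ψ => Conj ξ (fun ζ => sub σ (ψ ζ))
  | Disj ξ ψ => Disj ξ (fun ζ => sub σ (ψ ζ))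
  end.

Fixpoint bound2 (n : nat) (p : @form M) : Prop :=
  match p with
  | Fo _ => False
  | All2 m p | Ex2 m p => m = n \/ bound2 n p
  | Conj ξ ψ | Disj ξ ψ => exists ζ, ζ ∈ ξ /\ bound2 n (ψ ζ)
  end.

Lemma neg_all2s ks p : neg (all2s ks p) = ex2s ks (neg p).
Proof. induction ks; simpl; congruence. Qed.

Lemma neg_ex2s ks p : neg (ex2s ks p) = all2s ks (neg p).
Proof. induction ks; simpl; congruence. Qed.

Lemma free1_neg n p : free1 n (neg p) <-> free1 n p.
Proof. induction p; simpl; try tauto; split; intros [z [Hz K]]; exists z; split; auto; now apply H. Qed.

Lemma free2_neg n p : free2 n (neg p) <-> free2 n p.
Proof. induction p; simpl; try tauto; split; intros [z [Hz K]]; exists z; split; auto; now apply H. Qed.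

Lemma par2_neg A p : par2 A (neg p) <-> par2 A p.
Proof. induction p; simpl; try tauto; split; intros [z [Hz K]]; exists z; split; auto; now apply H. Qed.

Lemma bound2_neg n p : bound2 n (neg p) <-> bound2 n p.
Proof. induction p; simpl; try tauto; split; intros [z [Hz K]]; exists z; split; auto; now apply H. Qed.

Lemma finitary2_neg p : finitary2 (neg p) <-> finitary2 p.
Proof.
unfold finitary2; split; intros [[l H] [l' K]]; split;
(exists l + exists l'); intros n Hn; first [apply H|apply K]; revert Hn;
rewrite ?free2_neg, ?par2_neg; auto.
Qed.

Lemma free1_all2s n ks p : free1 n (all2s ks p) <-> free1 n p.
Proof. induction ks; simpl; tauto. Qed.

Lemma free2_all2s n ks p : free2 n (all2s ks p) <-> ~ List.In n ks /\ free2 n p.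
Proof.
induction ks as [|k ks IH]; simpl; [tauto|].
change (fold_right All2 p ks) with (all2s ks p); rewrite IH; tauto.
Qed.

Lemma par2_all2s A ks p : par2 A (all2s ks p) <-> par2 A p.
Proof. induction ks; simpl; tauto. Qed.

Lemma bound2_all2s n ks p : bound2 n (all2s ks p) <-> List.In n ks \/ bound2 n p.
Proof.
induction ks as [|k ks IH]; simpl; [tauto|].
change (fold_right All2 p ks) with (all2s ks p); rewrite IH; tauto.
Qed.

Lemma free1_andfo n χ p : free1 n (andfo χ p) -> free1 n p \/ fo_free1 n χ.
Proof. induction p; simpl; try tauto; intros [ζ [H0 K]]; apply H in K; firstorder. Qed.

Lemma free2_andfo n χ p : free2 n (andfo χ p) -> free2 n p \/ fo_free2 n χ.
Proof. induction p; simpl; try tauto; intros [ζ [H0 K]]; apply H in K; firstorder. Qed.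

Lemma par2_andfo A χ p : par2 A (andfo χ p) -> par2 A p \/ fo_par2 A χ.
Proof. induction p; simpl; try tauto; intros [ζ [H0 K]]; apply H in K; firstorder. Qed.

Lemma fo_free2_shift n q : fo_free2 n (fo_shift q) -> exists m, n = S m /\ fo_free2 m q.
Proof.
induction q as [| |s [m|A]|q IH|q IH r IH'|m q IH]; simpl; auto; try tauto; try congruence.
- intros [= <-]; eauto.
- intros [H|H]; [apply IH in H|apply IH' in H]; firstorder.
Qed.

Lemma fo_free1_shift n q : fo_free1 n (fo_shift q) <-> fo_free1 n q.
Proof. induction q as [| |s [m|A]|q IH|q IH r IH'|m q IH]; simpl; tauto. Qed.

Lemma fo_par1_shift a q : fo_par1 a (fo_shift q) <-> fo_par1 a q.
Proof. induction q as [| |s [m|A]|q IH|q IH r IH'|m q IH]; simpl; tauto. Qed.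

Lemma fo_par2_shift a q : fo_par2 a (fo_shift q) -> fo_par2 a q.
Proof.
induction q as [| |s [m|A]|q IH|q IH r IH'|m q IH]; simpl; try tauto; congruence.
Qed.

Lemma free1_shift n p : free1 n (shift p) -> free1 n p.
Proof.
induction p; simpl; auto; try (intros [ζ [H0 K]]; firstorder).
apply fo_free1_shift.
Qed.

Lemma free2_shift n p : free2 n (shift p) -> exists m, n = S m /\ free2 m p.
Proof.
induction p; simpl; try (intros [ζ [H0 K]]; apply H in K; firstorder).
- apply fo_free2_shift.
- intros [H K]; apply IHp in K; destruct K as [m [-> K]]; exists m; firstorder.
- intros [H K]; apply IHp in K; destruct K as [m [-> K]]; exists m; firstorder.
Qed.

Lemma par2_shift A p : par2 A (shift p) -> par2 A p.
Proof.
induction p; simpl; auto; try (intros [ζ [H0 K]]; firstorder).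
apply fo_par2_shift.
Qed.

Lemma bound2_shift n p : bound2 n (shift p) -> exists m, n = S m.
Proof.
induction p; simpl; try tauto; try (intros [ζ [H0 K]]; firstorder).
- intros [<- | H]; eauto.
- intros [<- | H]; eauto.
Qed.

Lemma fo_free1_sub n σ q : fo_free1 n (fo_sub σ q) <-> fo_free1 n q.
Proof. induction q as [| |s [m|A]|q IH|q IH r IH'|m q IH]; simpl; tauto. Qed.

Lemma fo_par1_sub a σ q : fo_par1 a (fo_sub σ q) <-> fo_par1 a q.
Proof. induction q as [| |s [m|A]|q IH|q IH r IH'|m q IH]; simpl; tauto. Qed.

Lemma fo_free2_sub n σ q : fo_free2 n (fo_sub σ q) -> fo_free2 n q /\ σ n = None.
Proof.
induction q as [| |s [m|A]|q IH|q IH r IH'|m q IH]; simpl; try tauto; try congruence.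
destruct (σ m) eqn:E; try congruence.
intros [= ->]; auto.
Qed.

Lemma fo_par2_sub A σ q :
  fo_par2 A (fo_sub σ q) -> fo_par2 A q \/ exists n, σ n = Some A.
Proof.
induction q as [| |s [m|B]|q IH|q IH r IH'|m q IH]; simpl; try tauto.
destruct (σ m) eqn:E; try congruence.
intros [= ->]; eauto.
Qed.

Lemma hide2_None σ n m : hide2 σ n m = None -> m <> n -> σ m = None.
Proof. unfold hide2; destruct (Nat.eq_dec m n); tauto. Qed.

Lemma hide2_Some σ n m A : hide2 σ n m = Some A -> σ m = Some A.
Proof. unfold hide2; destruct (Nat.eq_dec m n); [discriminate|auto]. Qed.

Lemma free1_sub n σ p : free1 n (sub σ p) -> free1 n p.
Proof.
revert σ; induction p; simpl; intros σ; eauto; try (intros [ζ [H0 K]]; apply H in K; eauto).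
apply fo_free1_sub.
Qed.

Lemma free2_sub n σ p : free2 n (sub σ p) -> free2 n p /\ σ n = None.
Proof.
revert σ; induction p; simpl; intros σ; try (intros [ζ [H0 K]]; apply H in K; firstorder).
- apply fo_free2_sub.
- intros [H K]; apply IHp in K; destruct K as [K L]; apply hide2_None in L; auto.
- intros [H K]; apply IHp in K; destruct K as [K L]; apply hide2_None in L; auto.
Qed.

Lemma par2_sub A σ p : par2 A (sub σ p) -> par2 A p \/ exists n, σ n = Some A.
Proof.
revert σ; induction p; simpl; intros σ;
  try (intros [ζ [H0 K]]; apply H in K; destruct K; eauto; fail).
- apply fo_par2_sub.
- intros H; apply IHp in H; destruct H as [H|[m H]]; eauto using hide2_Some.
- intros H; apply IHp in H; destruct H as [H|[m H]]; eauto using hide2_Some.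
Qed.

Lemma fo_free2_finite (q : @fo M) : exists l, forall n, fo_free2 n q -> List.In n l.
Proof.
induction q as [| |s [m|A]|q [l H]|q [l H] r [l' H']|m q [l H]]; simpl;
try (exists nil; intros n; (tauto || discriminate)); eauto.
- exists [m]; intros n [= ->]; simpl; auto.
- exists (l ++ l'); intros n [K|K]; apply in_or_app; auto.
Qed.

Lemma fo_par2_finite (q : @fo M) : exists l, forall A, fo_par2 A q -> List.In A l.
Proof.
induction q as [| |s [m|A]|q [l H]|q [l H] r [l' H']|m q [l H]]; simpl;
try (exists nil; intros n; (tauto || discriminate)); eauto.
- exists [A]; intros n [= ->]; simpl; auto.
- exists (l ++ l'); intros n [K|K]; apply in_or_app; auto.
Qed.

Lemma finitary2_andfo χ p : finitary2 p -> finitary2 (andfo χ p).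
Proof.
intros [[l H] [l' K]]; destruct (fo_free2_finite χ) as [m Hm], (fo_par2_finite χ) as [m' Hm'].
split; [exists (l ++ m)|exists (l' ++ m')]; intros n Hn; apply in_or_app;
[apply free2_andfo in Hn|apply par2_andfo in Hn]; firstorder.
Qed.

Lemma finitary2_shift p : finitary2 p -> finitary2 (shift p).
Proof.
intros [[l H] [l' K]]; split; [exists (map S l)|exists l']; intros n Hn.
- apply free2_shift in Hn; destruct Hn as [m [-> Hm]]; apply in_map; auto.
- apply par2_shift in Hn; auto.
Qed.

Definition finite_range (σ : nat -> option M) : Prop :=
  exists l, forall n A, σ n = Some A -> List.In A l.

Lemma finitary2_sub σ p : finite_range σ -> finitary2 p -> finitary2 (sub σ p).
Proof.
intros [m Hm] [[l H] [l' K]]; split; [exists l|exists (l' ++ m)]; intros n Hn.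
- apply free2_sub in Hn; apply H; tauto.
- apply in_or_app; apply par2_sub in Hn; destruct Hn as [Hn|[k Hn]]; eauto.
Qed.

(* Levels of formulas under the syntactic operations *)
Scheme Pi1_mut := Minimality for Pi1 Sort Prop
with Sigma1_mut := Minimality for Sigma1 Sort Prop.
Combined Scheme Pi1_Sigma1_ind from Pi1_mut, Sigma1_mut.

Lemma Pi1_Sigma1_neg κ :
  (forall ζ p, Pi1 κ ζ p -> Sigma1 κ ζ (neg p)) /\
  (forall ζ p, Sigma1 κ ζ p -> Pi1 κ ζ (neg p)).
Proof.
apply (Pi1_Sigma1_ind M κ (fun ζ p => Sigma1 κ ζ (neg p)) (fun ζ p => Pi1 κ ζ (neg p)));
intros; rewrite ?neg_all2s, ?neg_ex2s; try (constructor; auto; fail).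
- simpl; constructor; auto; exact (proj2 (finitary2_neg (Conj ξ ψ)) H2).
- simpl; constructor; auto; exact (proj2 (finitary2_neg (Disj ξ ψ)) H2).
Qed.

Lemma neg_eq_all2s ks p r : neg p = all2s ks r -> exists p', p = ex2s ks p' /\ r = neg p'.
Proof.
revert p; induction ks as [|k ks IH]; simpl; intros p E; [eauto|].
destruct p; try discriminate; simpl in E; injection E as -> E.
destruct (IH _ E) as [p' [-> ->]]; eauto.
Qed.

Lemma neg_eq_ex2s ks p r : neg p = ex2s ks r -> exists p', p = all2s ks p' /\ r = neg p'.
Proof.
revert p; induction ks as [|k ks IH]; simpl; intros p E; [eauto|].
destruct p; try discriminate; simpl in E; injection E as -> E.
destruct (IH _ E) as [p' [-> ->]]; eauto.
Qed.

Lemma Pi1_Sigma1_neg_inv κ :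
  (forall ζ r, Pi1 κ ζ r -> forall p, neg p = r -> Sigma1 κ ζ p) /\
  (forall ζ r, Sigma1 κ ζ r -> forall p, neg p = r -> Pi1 κ ζ p).
Proof.
apply (Pi1_Sigma1_ind M κ (fun ζ r => forall p, neg p = r -> Sigma1 κ ζ p)
        (fun ζ r => forall p, neg p = r -> Pi1 κ ζ p)).
- intros q H p E; destruct p; try discriminate; injection E as <-; now constructor.
- intros ξ ks r Oξ _ IH p E; apply neg_eq_all2s in E; destruct E as [p' [-> ->]].
  constructor; auto.
- intros ξ ψ L _ IH F p E; destruct p; try discriminate; injection E as -> <-.
  constructor; auto; exact (proj1 (finitary2_neg (Disj ξ ψ0)) F).
- intros q H p E; destruct p; try discriminate; injection E as <-; now constructor.
- intros ξ ks r Oξ _ IH p E; apply neg_eq_ex2s in E; destruct E as [p' [-> ->]].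
  constructor; auto.
- intros ξ ψ L _ IH F p E; destruct p; try discriminate; injection E as -> <-.
  constructor; auto; exact (proj1 (finitary2_neg (Conj ξ ψ0)) F).
Qed.

Lemma Pi1_neg κ ζ p : Pi1 κ ζ (neg p) <-> Sigma1 κ ζ p.
Proof.
split; [|apply Pi1_Sigma1_neg].
intros H; exact (proj1 (Pi1_Sigma1_neg_inv κ) ζ _ H p eq_refl).
Qed.

Lemma Sigma1_neg κ ζ p : Sigma1 κ ζ (neg p) <-> Pi1 κ ζ p.
Proof.
split; [|apply Pi1_Sigma1_neg].
intros H; exact (proj2 (Pi1_Sigma1_neg_inv κ) ζ _ H p eq_refl).
Qed.

(** Induction along the Π side alone. The Σ formula below a block of universal quantifiers is
    reached through its dual, which is Π of the same level, so later proofs need no mutual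
    statement. *)
Lemma Pi1_levels κ (P : M -> form -> Prop) :
  (forall q, fo_over κ q -> P empty (Fo q)) ->
  (forall ζ ks p, ordinal ζ -> Pi1 κ ζ (neg p) -> P ζ (neg p) ->
     P (succ ζ) (all2s ks p)) ->
  (forall ζ ψ, limit ζ -> (forall η, η ∈ ζ -> Pi1 κ η (ψ η)) ->
     (forall η, η ∈ ζ -> P η (ψ η)) -> finitary2 (Conj ζ ψ) -> P ζ (Conj ζ ψ)) ->
  forall ζ p, Pi1 κ ζ p -> P ζ p.
Proof.
intros H0 HS HL ζ; induction ζ as [ζ IH] using mem_ind; intros p Hp.
destruct Hp as [q Hq|ζ ks q O Hq|ζ ψ L Hψ F]; auto.
apply Pi1_neg in Hq; apply HS; auto; apply IH; auto using mem_succ_self.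
Qed.

Lemma andfo_all2s χ ks p : andfo χ (all2s ks p) = all2s ks (andfo χ p).
Proof. induction ks; simpl; congruence. Qed.

Lemma andfo_ex2s χ ks p : andfo χ (ex2s ks p) = ex2s ks (andfo χ p).
Proof. induction ks; simpl; congruence. Qed.

Lemma shift_all2s ks p : shift (all2s ks p) = all2s (map S ks) (shift p).
Proof. induction ks; simpl; congruence. Qed.

Lemma shift_ex2s ks p : shift (ex2s ks p) = ex2s (map S ks) (shift p).
Proof. induction ks; simpl; congruence. Qed.

Lemma sub_all2s σ ks p : sub σ (all2s ks p) = all2s ks (sub (fold_left hide2 ks σ) p).
Proof. revert σ; induction ks as [|k ks IH]; simpl; intros σ; f_equal; apply IH. Qed.

Lemma sub_ex2s σ ks p : sub σ (ex2s ks p) = ex2s ks (sub (fold_left hide2 ks σ) p).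
Proof. revert σ; induction ks as [|k ks IH]; simpl; intros σ; f_equal; apply IH. Qed.

Lemma Pi1_Sigma1_andfo κ χ : fo_over κ χ ->
  (forall ζ p, Pi1 κ ζ p -> Pi1 κ ζ (andfo χ p)) /\
  (forall ζ p, Sigma1 κ ζ p -> Sigma1 κ ζ (andfo χ p)).
Proof.
intros Hχ.
apply (Pi1_Sigma1_ind M κ (fun ζ p => Pi1 κ ζ (andfo χ p))
         (fun ζ p => Sigma1 κ ζ (andfo χ p)));
intros; rewrite ?andfo_all2s, ?andfo_ex2s;
try (simpl; constructor; auto; fail);
try (simpl; constructor; destruct Hχ, H; split; intros a [K|K]; auto; fail).
- simpl; constructor; auto; exact (finitary2_andfo χ _ H2).
- simpl; constructor; auto; exact (finitary2_andfo χ _ H2).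
Qed.

Lemma Pi1_Sigma1_shift κ :
  (forall ζ p, Pi1 κ ζ p -> Pi1 κ ζ (shift p)) /\
  (forall ζ p, Sigma1 κ ζ p -> Sigma1 κ ζ (shift p)).
Proof.
assert (Q : forall q, fo_over κ q -> fo_over κ (fo_shift q)).
{ intros q [H K]; split; intros a Ha; [apply H|apply K];
  revert Ha; [apply fo_par1_shift|apply fo_par2_shift]. }
apply (Pi1_Sigma1_ind M κ (fun ζ p => Pi1 κ ζ (shift p))
         (fun ζ p => Sigma1 κ ζ (shift p)));
intros; rewrite ?shift_all2s, ?shift_ex2s; try (simpl; constructor; auto; fail).
- simpl; constructor; auto; exact (finitary2_shift _ H2).
- simpl; constructor; auto; exact (finitary2_shift _ H2).
Qed.

Lemma hide2_good κ ks σ :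
  finite_range σ /\ (forall n A, σ n = Some A -> subV A κ) ->
  finite_range (fold_left hide2 ks σ) /\
  (forall n A, fold_left hide2 ks σ n = Some A -> subV A κ).
Proof.
revert σ; induction ks as [|k ks IH]; simpl; auto; intros σ [[l H] K].
apply IH; split; [exists l|]; intros n A E; apply hide2_Some in E; eauto.
Qed.

Lemma Pi1_Sigma1_sub κ :
  (forall ζ p, Pi1 κ ζ p -> forall σ, finite_range σ /\
     (forall n A, σ n = Some A -> subV A κ) -> Pi1 κ ζ (sub σ p)) /\
  (forall ζ p, Sigma1 κ ζ p -> forall σ, finite_range σ /\
     (forall n A, σ n = Some A -> subV A κ) -> Sigma1 κ ζ (sub σ p)).
Proof.
assert (Q : forall q σ, (forall n A, σ n = Some A -> subV A κ) ->
   fo_over κ q -> fo_over κ (fo_sub σ q)).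
{ intros q σ Hσ [H K]; split; intros a Ha; [apply H; revert Ha; apply fo_par1_sub|].
  apply fo_par2_sub in Ha; destruct Ha as [Ha|[n Ha]]; eauto. }
apply (Pi1_Sigma1_ind M κ
  (fun ζ p => forall σ, finite_range σ /\
     (forall n A, σ n = Some A -> subV A κ) -> Pi1 κ ζ (sub σ p))
  (fun ζ p => forall σ, finite_range σ /\
     (forall n A, σ n = Some A -> subV A κ) -> Sigma1 κ ζ (sub σ p)));
intros; rewrite ?sub_all2s, ?sub_ex2s;
try (simpl; constructor; auto using hide2_good; fail).
- simpl; constructor; apply Q; tauto.
- simpl; constructor; auto; exact (finitary2_sub _ _ (proj1 H3) H2).
- simpl; constructor; apply Q; tauto.
- simpl; constructor; auto; exact (finitary2_sub _ _ (proj1 H3) H2).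
Qed.

(** A first-order formula is both Π and Σ, so an empty block can be inserted innermost and the
    formula itself has the next level. A conjunction at a limit level is not Σ of that level, so
    this trick stops at the finite levels. *)
Lemma Pi1_Sigma1_num κ n :
  (forall p, Pi1 κ (num n) p -> Pi1 κ (num (S n)) p) /\
  (forall p, Sigma1 κ (num n) p -> Sigma1 κ (num (S n)) p).
Proof.
induction n as [|n [IHP IHS]]; split; intros p Hp; simpl in *.
- inversion Hp as [q Hq E|ξ ks q O Hq E|ξ ψ L]; subst.
  + apply (Pi1_succ nil ordinal_empty (Sigma1_0 Hq)).
  + destruct (succ_not_empty _ E).
  + destruct (limit_not_empty L).
- inversion Hp as [q Hq E|ξ ks q O Hq E|ξ ψ L]; subst.
  + apply (Sigma1_succ nil ordinal_empty (Pi1_0 Hq)).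
  + destruct (succ_not_empty _ E).
  + destruct (limit_not_empty L).
- inversion Hp as [q Hq E|ξ ks q O Hq E|ξ ψ L]; subst.
  + destruct (succ_not_empty _ (eq_sym E)).
  + apply succ_inj in E; subst; constructor; auto using ordinal_succ, ordinal_num.
  + destruct (limit_not_succ _ L).
- inversion Hp as [q Hq E|ξ ks q O Hq E|ξ ψ L]; subst.
  + destruct (succ_not_empty _ (eq_sym E)).
  + apply succ_inj in E; subst; constructor; auto using ordinal_succ, ordinal_num.
  + destruct (limit_not_succ _ L).
Qed.

End Syntax.

(** * First-order semantics *)

Section FirstOrder.
Context {M : zfc}.
Implicit Types (α β ζ η ξ κ a A : M) (p : @form M) (q r χ : @fo M) (s t T : @term M).
Implicit Types (e : nat -> M).

Definition fsat α e1 e2 q : Prop := fo_sat α e1 e2 (fo_restr α q).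

Lemma upd_eq e1 n a : upd e1 n a n = a.
Proof. unfold upd; destruct (Nat.eq_dec n n); tauto. Qed.

Lemma upd_neq e1 n m a : m <> n -> upd e1 n a m = e1 m.
Proof. unfold upd; destruct (Nat.eq_dec m n); tauto. Qed.

Lemma upd_agree (Q : nat -> Prop) e e' n a :
  (forall m, n <> m /\ Q m -> e m = e' m) -> forall m, Q m -> upd e n a m = upd e' n a m.
Proof. intros H m Hm; unfold upd; destruct (Nat.eq_dec m n); auto. Qed.

Lemma upd_shift e n a : (fun m => upd e (S n) a (S m)) = upd (fun m => e (S m)) n a.
Proof.
apply functional_extensionality; intros m; unfold upd.
destruct (Nat.eq_dec m n), (Nat.eq_dec (S m) (S n)); auto; lia.
Qed.

Lemma val_agree e1 e1' t : (forall n, t = Var n -> e1 n = e1' n) -> val e1 t = val e1' t.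
Proof. destruct t; simpl; auto. Qed.

Lemma fsat_agree α q : forall e1 e2 e1' e2',
  (forall n, fo_free1 n q -> e1 n = e1' n) -> (forall n, fo_free2 n q -> e2 n = e2' n) ->
  (fsat α e1 e2 q <-> fsat α e1' e2' q).
Proof.
unfold fsat; induction q as [s t|s t|s [m|A]|q IH|q IH r IH'|m q IH];
simpl; intros e1 e2 e1' e2' H K.
- rewrite (val_agree e1 e1' s), (val_agree e1 e1' t); firstorder.
- rewrite (val_agree e1 e1' s), (val_agree e1 e1' t); firstorder.
- rewrite (val_agree e1 e1' s), (K m); firstorder.
- rewrite (val_agree e1 e1' s); firstorder.
- rewrite (IH e1 e2 e1' e2'); auto; tauto.
- rewrite (IH e1 e2 e1' e2'), (IH' e1 e2 e1' e2'); auto; tauto.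
- assert (E : forall a, fo_sat α (upd e1 m a) e2 (fo_restr α q) <->
                fo_sat α (upd e1' m a) e2' (fo_restr α q)).
  { intros a; apply IH; auto; now apply upd_agree. }
  split; intros L a Ha; apply E; auto.
Qed.

Lemma fsat_shift α q : forall e1 e2,
  fsat α e1 e2 (fo_shift q) <-> fsat α e1 (fun n => e2 (S n)) q.
Proof.
unfold fsat; induction q as [s t|s t|s [m|A]|q IH|q IH r IH'|m q IH];
simpl; intros e1 e2; try tauto.
- now rewrite IH.
- now rewrite IH, IH'.
- split; intros H a Ha; apply IH; auto.
Qed.

Definition with_params α (σ : nat -> option M) e2 n : M :=
  match σ n with Some A => sep A (fun x => inV x α) | None => e2 n end.

Lemma fsat_sub α σ q : forall e1 e2,
  fsat α e1 e2 (fo_sub σ q) <-> fsat α e1 (with_params α σ e2) q.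
Proof.
unfold fsat; induction q as [s t|s t|s [m|A]|q IH|q IH r IH'|m q IH];
simpl; intros e1 e2; try tauto.
- unfold with_params; destruct (σ m); simpl; tauto.
- now rewrite IH.
- now rewrite IH, IH'.
- split; intros H a Ha; apply IH; auto.
Qed.

Lemma fo_restr_self κ q : fo_over κ q -> fo_restr κ q = q.
Proof.
intros [_ H]; induction q as [s t|s t|s [m|A]|q IH|q IH r IH'|m q IH]; simpl in *; auto.
- do 2 f_equal; apply ext_eq; intros z; rewrite mem_sep.
  split; [tauto|]; intros Hz; split; auto; exact (H A eq_refl z Hz).
- f_equal; auto.
- f_equal; auto.
- f_equal; auto.
Qed.

Definition Or q r : fo := Neg (And (Neg q) (Neg r)).
Definition Imp q r : fo := Neg (And q (Neg r)).
Definition Iff q r : fo := And (Imp q r) (Imp r q).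
Definition Exi n q : fo := Neg (All n (Neg q)).
Definition Top : @fo M := All 0 (Eq (Var 0) (Var 0)).

Lemma fsat_Neg α e1 e2 q : fsat α e1 e2 (Neg q) <-> ~ fsat α e1 e2 q.
Proof. reflexivity. Qed.

Lemma fsat_And α e1 e2 q r : fsat α e1 e2 (And q r) <-> fsat α e1 e2 q /\ fsat α e1 e2 r.
Proof. reflexivity. Qed.

Lemma fsat_Or α e1 e2 q r : fsat α e1 e2 (Or q r) <-> fsat α e1 e2 q \/ fsat α e1 e2 r.
Proof. unfold fsat; simpl; tauto. Qed.

Lemma fsat_Imp α e1 e2 q r : fsat α e1 e2 (Imp q r) <-> (fsat α e1 e2 q -> fsat α e1 e2 r).
Proof. unfold fsat; simpl; tauto. Qed.

Lemma fsat_Iff α e1 e2 q r : fsat α e1 e2 (Iff q r) <-> (fsat α e1 e2 q <-> fsat α e1 e2 r).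
Proof. unfold fsat; simpl; tauto. Qed.

Lemma fsat_All α e1 e2 n q :
  fsat α e1 e2 (All n q) <-> forall a, inV a α -> fsat α (upd e1 n a) e2 q.
Proof. reflexivity. Qed.

Lemma fsat_Exi α e1 e2 n q :
  fsat α e1 e2 (Exi n q) <-> exists a, inV a α /\ fsat α (upd e1 n a) e2 q.
Proof.
unfold fsat; simpl; split; [|firstorder].
intros H; apply NNPP; intros K; apply H; intros a Ha L; apply K; eauto.
Qed.

Lemma fsat_Eq α e1 e2 s t : fsat α e1 e2 (Eq s t) <-> val e1 s = val e1 t.
Proof. reflexivity. Qed.

Lemma fsat_In α e1 e2 s t : fsat α e1 e2 (In s t) <-> val e1 s ∈ val e1 t.
Proof. reflexivity. Qed.

Lemma fsat_Ap α e1 e2 s T : inV (val e1 s) α ->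
  (fsat α e1 e2 (Ap s T) <-> val e1 s ∈ val e2 T).
Proof.
intros H; unfold fsat; destruct T as [m|A]; simpl; [tauto|].
rewrite mem_sep; tauto.
Qed.

Lemma fsat_Top α e1 e2 : fsat α e1 e2 Top.
Proof. intros a _; reflexivity. Qed.

(** The bound variables 7, 8, 9 are reserved for pairing. *)
Definition low t : Prop := match t with Var n => n < 7 | Par _ => True end.

Definition is_pair (w x y : @term M) : fo :=
  All 9 (Iff (In (Var 9) w) (Or (Eq (Var 9) x) (Eq (Var 9) y))).
Definition is_op (z x y : @term M) : fo :=
  All 8 (Iff (In (Var 8) z) (Or (is_pair (Var 8) x x) (is_pair (Var 8) x y))).
Definition rel (R x y : @term M) : fo :=
  Exi 7 (And (is_op (Var 7) x y) (Ap (Var 7) R)).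

Lemma val_upd e1 n a t : t <> Var n -> val (upd e1 n a) t = val e1 t.
Proof. destruct t; simpl; auto; intros H; apply upd_neq; congruence. Qed.

Lemma low_neq t n : low t -> 7 <= n -> t <> Var n.
Proof. intros H K ->; simpl in H; lia. Qed.

Lemma fsat_is_pair α e1 e2 w x y : ordinal α ->
  w <> Var 9 -> x <> Var 9 -> y <> Var 9 ->
  inV (val e1 w) α -> inV (val e1 x) α -> inV (val e1 y) α ->
  (fsat α e1 e2 (is_pair w x y) <-> val e1 w = pair (val e1 x) (val e1 y)).
Proof.
intros [T _] Nw Nx Ny Hw Hx Hy; unfold is_pair; rewrite fsat_All.
assert (E : forall a, fsat α (upd e1 9 a) e2 (Iff (In (Var 9) w) (Or (Eq (Var 9) x) (Eq (Var 9) y)))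
   <-> (a ∈ val e1 w <-> a = val e1 x \/ a = val e1 y)).
{ intros a; rewrite fsat_Iff, fsat_Or, fsat_In, !fsat_Eq.
  rewrite (val_upd e1 9 a w Nw), (val_upd e1 9 a x Nx), (val_upd e1 9 a y Ny).
  simpl; rewrite upd_eq; tauto. }
split.
- intros H; apply ext_eq; intros z; rewrite mem_pair; split; intros Hz.
  + assert (Q : inV z α) by exact (inV_trans _ _ α T Hz Hw).
    now apply (proj1 (E z) (H z Q)).
  + assert (Q : inV z α) by (destruct Hz as [->| ->]; auto).
    now apply (proj1 (E z) (H z Q)).
- intros H a _; apply E; rewrite H; apply mem_pair.
Qed.

Lemma fsat_is_op α e1 e2 z x y : limit α ->
  z <> Var 8 -> x <> Var 8 -> x <> Var 9 -> y <> Var 8 -> y <> Var 9 ->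
  inV (val e1 z) α -> inV (val e1 x) α -> inV (val e1 y) α ->
  (fsat α e1 e2 (is_op z x y) <-> val e1 z = op (val e1 x) (val e1 y)).
Proof.
intros L Nz Nx Nx' Ny Ny' Hz Hx Hy; unfold is_op; rewrite fsat_All.
assert (O : ordinal α) by apply L.
assert (E : forall a, inV a α ->
  (fsat α (upd e1 8 a) e2 (Iff (In (Var 8) z) (Or (is_pair (Var 8) x x) (is_pair (Var 8) x y)))
   <-> (a ∈ val e1 z <-> a = pair (val e1 x) (val e1 x) \/ a = pair (val e1 x) (val e1 y)))).
{ intros a Ha.
  assert (V : val (upd e1 8 a) (Var 8) = a) by (simpl; apply upd_eq).
  rewrite fsat_Iff, fsat_Or, fsat_In, !fsat_is_pair; auto; try discriminate;
  rewrite ?V, ?(val_upd e1 8 a z Nz), ?(val_upd e1 8 a x Nx), ?(val_upd e1 8 a y Ny); auto.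
  tauto. }
split.
- intros H; apply ext_eq; intros u; unfold op; rewrite mem_pair; split; intros Hu.
  + assert (Q : inV u α) by exact (inV_trans _ _ α (proj1 O) Hu Hz).
    now apply (proj1 (E u Q) (H u Q)).
  + assert (Q : inV u α) by (destruct Hu as [->| ->]; auto using inV_pair).
    now apply (proj1 (E u Q) (H u Q)).
- intros H a Ha; apply E; auto; rewrite H; apply mem_pair.
Qed.

Lemma fsat_rel α e1 e2 R x y : limit α -> low x -> low y ->
  inV (val e1 x) α -> inV (val e1 y) α ->
  (fsat α e1 e2 (rel R x y) <-> op (val e1 x) (val e1 y) ∈ val e2 R).
Proof.
intros L Lx Ly Hx Hy; unfold rel; rewrite fsat_Exi.
assert (E : forall a, inV a α -> (fsat α (upd e1 7 a) e2 (And (is_op (Var 7) x y) (Ap (Var 7) R))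
  <-> a = op (val e1 x) (val e1 y) /\ a ∈ val e2 R)).
{ intros a Ha.
  assert (V : val (upd e1 7 a) (Var 7) = a) by (simpl; apply upd_eq).
  assert (V' : forall t, low t -> val (upd e1 7 a) t = val e1 t)
    by (intros t Ht; apply val_upd, low_neq; auto).
  rewrite fsat_And, fsat_is_op, fsat_Ap; rewrite ?V, ?V'; auto; try tauto;
  try discriminate; apply low_neq; auto; lia. }
split.
- intros [a [Ha H]]; apply E in H; auto; destruct H as [-> H]; auto.
- intros H; exists (op (val e1 x) (val e1 y)).
  assert (Q : inV (op (val e1 x) (val e1 y)) α) by auto using inV_op.
  split; auto; apply E; auto.
Qed.

Lemma free1_is_op n z x y :
  fo_free1 n (is_op z x y) -> z = Var n \/ x = Var n \/ y = Var n.
Proof. unfold is_op, is_pair, Or, Iff, Imp; simpl; intuition congruence. Qed.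

Lemma free1_rel n R x y : fo_free1 n (rel R x y) -> x = Var n \/ y = Var n.
Proof.
unfold rel, Exi; simpl; intros [N [H|H]]; [apply free1_is_op in H|]; intuition congruence.
Qed.

Lemma free2_is_op n z x y : ~ fo_free2 n (is_op z x y).
Proof. unfold is_op, is_pair, Or, Iff, Imp; simpl; tauto. Qed.

Lemma free2_rel n R x y : fo_free2 n (rel R x y) -> R = Var n.
Proof. unfold rel, is_op, is_pair, Or, Iff, Imp, Exi; simpl; tauto. Qed.

Lemma par1_is_op a z x y :
  fo_par1 a (is_op z x y) -> z = Par a \/ x = Par a \/ y = Par a.
Proof. unfold is_op, is_pair, Or, Iff, Imp; simpl; intuition congruence. Qed.

Lemma par1_rel a R x y : fo_par1 a (rel R x y) -> x = Par a \/ y = Par a.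
Proof.
unfold rel, Exi; simpl; intros [H|H]; [apply par1_is_op in H|]; intuition congruence.
Qed.

Lemma par2_is_op a z x y : ~ fo_par2 a (is_op z x y).
Proof. unfold is_op, is_pair, Or, Iff, Imp; simpl; tauto. Qed.

Lemma par2_rel a R x y : fo_par2 a (rel R x y) -> R = Par a.
Proof. unfold rel, is_op, is_pair, Or, Iff, Imp, Exi; simpl; tauto. Qed.

(** For [T] the graph of a function, truth in V_α says that V_α is closed under it. This is the
    first-order formula through which closure is forced. *)
Definition total T : fo := All 0 (Exi 1 (rel T (Var 0) (Var 1))).

Lemma fsat_total α e1 e2 T : limit α ->
  (fsat α e1 e2 (total T) <->
   forall x, inV x α -> exists y, inV y α /\ op x y ∈ val e2 T).
Proof.
intros L; unfold total; rewrite fsat_All.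
enough (E : forall x y, inV x α -> inV y α ->
  (fsat α (upd (upd e1 0 x) 1 y) e2 (rel T (Var 0) (Var 1)) <-> op x y ∈ val e2 T)).
{ split; intros H x Hx; specialize (H x Hx).
  - apply fsat_Exi in H; destruct H as [y [Hy H]]; exists y; split; auto; now apply (E x y).
  - destruct H as [y [Hy H]]; apply fsat_Exi; exists y; split; auto; now apply E. }
intros x y Hx Hy; rewrite fsat_rel; simpl; auto; lia || tauto.
Qed.

Definition graph (g : M -> M) κ : M :=
  sep (Vset κ) (fun z => exists x, z = op x (g x)).

Definition closed_under (g : M -> M) α : Prop := forall x, inV x α -> inV (g x) α.

Lemma mem_graph g κ x y : limit κ -> closed_under g κ -> inV x κ ->
  (op x y ∈ graph g κ <-> y = g x).
Proof.
intros L C Hx; unfold graph; rewrite mem_sep, mem_Vset; split.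
- intros [_ [x' E]]; apply op_inj in E; destruct E; congruence.
- intros ->; split; [apply inV_op; auto|eauto].
Qed.

(** The graph is single-valued on V_κ, so the witness that V_α provides for [x] can only be
    [g x]. *)
Lemma fsat_total_graph α κ e1 e2 g : limit α -> limit κ -> closed_under g κ ->
  (forall x, inV x α -> inV x κ) ->
  (fsat α e1 e2 (total (Par (graph g κ))) <-> closed_under g α).
Proof.
intros L L' C S; rewrite fsat_total by auto; split; intros H x Hx.
- destruct (H x Hx) as [y [Hy K]]; simpl in K.
  apply mem_graph in K; auto; now subst.
- exists (g x); split; auto; simpl; apply mem_graph; auto.
Qed.

Lemma free1_total n T : ~ fo_free1 n (total T).
Proof.
unfold total, Exi; simpl; intros [N [N' H]]; apply free1_rel in H; intuition congruence.
Qed.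

Lemma free2_total n T : fo_free2 n (total T) -> T = Var n.
Proof. apply free2_rel. Qed.

Lemma par1_total n T : ~ fo_par1 n (total T).
Proof. intros H; apply par1_rel in H; intuition congruence. Qed.

Lemma par2_total n T : fo_par2 n (total T) -> T = Par n.
Proof. apply par2_rel. Qed.

Lemma fo_over_total_graph g κ : fo_over κ (total (Par (graph g κ))).
Proof.
split; intros a Ha; [destruct (par1_total _ _ Ha)|].
apply par2_total in Ha; injection Ha as <-.
apply subV_sep; intros x; apply mem_Vset.
Qed.

End FirstOrder.

(** * Evaluation without transitive collapses *)

Section Evaluation.
Context {M : zfc}.
Implicit Types (α β ζ η ξ a A : M) (p : @form M) (q r χ : @fo M) (s t T : @term M).
Implicit Types (e : nat -> M) (n : nat).
Variables (b : M -> M -> M -> M) (κ : M).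

Definition idx ξ η : M :=
  if excluded_middle_informative (ξ ∈ κ) then η
  else the (fun β => β ∈ κ /\ b κ ξ β = η).

(** For [α < κ] above [ξ] if [ξ < κ], this is F^κ_ξ(α); and [G κ ξ = ξ]. *)
Definition G α ξ : M := sep ξ (fun η => idx ξ η ∈ α).

Lemma mem_G α ξ η : η ∈ G α ξ <-> η ∈ ξ /\ idx ξ η ∈ α.
Proof. exact (mem_sep ξ (fun η => idx ξ η ∈ α) η). Qed.

Fixpoint eval α (e1 e2 : nat -> M) p : Prop :=
  match p with
  | Fo q => fsat α e1 e2 q
  | All2 n p => forall A, subV A α -> eval α e1 (upd e2 n A) p
  | Ex2 n p => exists A, subV A α /\ eval α e1 (upd e2 n A) p
  | Conj ξ ψ => forall η, η ∈ G α ξ -> eval α e1 e2 (ψ η)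
  | Disj ξ ψ => exists η, η ∈ G α ξ /\ eval α e1 e2 (ψ η)
  end.

(** Coherence of the traces at [α]. The trace of each [η] in [G α ζ] is an initial segment of that
    of [ζ], so collapsing commutes with passing to subformulas. Closure under successor and
    predecessor and the presence of 0 make order types of traces respect successor and limit levels.
    Levels below [κ] must lie below [α], as they are not collapsed. *)
Definition coh α ζ : Prop :=
  (ζ ∈ κ -> ζ ∈ α) /\
  (forall η, η ∈ G α ζ -> (η ∈ κ -> η ∈ α) /\
     (forall μ, μ ∈ G α η <-> μ ∈ G α ζ /\ μ ∈ η) /\
     (succ η ∈ ζ -> succ η ∈ G α ζ)) /\
  (forall η, succ η ∈ G α ζ -> η ∈ G α ζ) /\
  (forall η, ζ = succ η -> η ∈ G α ζ) /\
  (empty ∈ ζ -> empty ∈ G α ζ).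

Lemma coh_sub α ζ η : ordinal ζ -> coh α ζ -> η ∈ G α ζ -> coh α η.
Proof.
intros O [H1 [H2 [H3 [H4 H5]]]] Hη.
destruct (H2 η Hη) as [K1 [K2 K3]].
assert (Hη' := proj1 (proj1 (mem_G _ _ _) Hη)).
split; [auto|split; [|split; [|split]]].
- intros μ Hμ; apply K2 in Hμ; destruct Hμ as [Hμ L].
  destruct (H2 μ Hμ) as [L1 [L2 L3]]; split; [auto|split].
  + intros ν; rewrite L2, K2; split; [|tauto].
    intros [Q1 Q2]; repeat split; auto.
    exact (ordinal_trans _ _ _ (ordinal_mem _ _ O Hη') L Q2).
  + intros Q; apply K2; split; auto; apply L3; exact (ordinal_trans _ _ _ O Hη' Q).
- intros μ Hμ; apply K2 in Hμ; apply K2; destruct Hμ as [Hμ L]; split; auto.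
  exact (ordinal_trans _ _ _ (ordinal_mem _ _ O Hη') L (mem_succ_self μ)).
- intros μ ->; apply K2; split; auto using mem_succ_self.
- intros Q; apply K2; split; auto; apply H5.
  exact (ordinal_trans _ _ _ O Hη' Q).
Qed.

(** Coherence is demanded only at the connectives that [eval] visits at [α]; conjuncts outside the
    trace are unconstrained. *)
Fixpoint ok α p : Prop :=
  match p with
  | Fo _ => True
  | All2 _ p | Ex2 _ p => ok α p
  | Conj ξ ψ | Disj ξ ψ =>
      limit ξ /\ ξ ∈ cardsucc κ /\ coh α ξ /\ forall η, η ∈ G α ξ -> ok α (ψ η)
  end.

Lemma ok_neg α p : ok α (neg p) <-> ok α p.
Proof.
induction p; simpl; try tauto; split; intros [H1 [H2 [H3 H4]]];
do 3 (split; [assumption|]); intros; apply H; auto.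
Qed.

Lemma ok_all2s α ks p : ok α (all2s ks p) <-> ok α p.
Proof. induction ks; simpl; tauto. Qed.

Ltac satisfaction_neg :=
  intros p; induction p as [q|n p IH|n p IH|ξ ψ IH|ξ ψ IH]; simpl; intros e1 e2;
  [ reflexivity
  | split; [intros [A [HA H]] K; apply IH in H; auto|];
    intros H; apply NNPP; intros K; apply H; intros A HA;
    apply NNPP; intros L; apply K; exists A; split; auto; now apply IH
  | split; [intros H [A [HA K]]; apply (IH e1 (upd e2 n A)); auto|];
    intros H A HA; apply IH; eauto
  | split; [intros [η [Hη H]] K; apply IH in H; auto|];
    intros H; apply NNPP; intros K; apply H; intros η Hη;
    apply NNPP; intros L; apply K; exists η; split; auto; now apply IH
  | split; [intros H [η [Hη K]]; apply (IH η e1 e2); auto|];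
    intros H η Hη; apply IH; eauto ].

Lemma sat_neg α : forall p e1 e2, sat α e1 e2 (neg p) <-> ~ sat α e1 e2 p.
Proof. satisfaction_neg. Qed.

Lemma eval_neg α : forall p e1 e2, eval α e1 e2 (neg p) <-> ~ eval α e1 e2 p.
Proof. satisfaction_neg. Qed.

Lemma eval_agree α p : forall e1 e2 e1' e2',
  (forall n, free1 n p -> e1 n = e1' n) -> (forall n, free2 n p -> e2 n = e2' n) ->
  (eval α e1 e2 p <-> eval α e1' e2' p).
Proof.
induction p as [q|n p IH|n p IH|ξ ψ IH|ξ ψ IH]; simpl; intros e1 e2 e1' e2' H K.
- now apply fsat_agree.
- assert (E : forall A, eval α e1 (upd e2 n A) p <-> eval α e1' (upd e2' n A) p).
  { intros A; apply IH; auto; now apply upd_agree. }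
  split; intros L A HA; apply E; auto.
- assert (E : forall A, eval α e1 (upd e2 n A) p <-> eval α e1' (upd e2' n A) p).
  { intros A; apply IH; auto; now apply upd_agree. }
  split; intros [A [HA L]]; exists A; split; auto; apply E; auto.
- split; intros L η Hη; assert (Hη' := proj1 (proj1 (mem_G _ _ _) Hη));
  (apply (IH η e1 e2 e1' e2'); [| |now apply L]); eauto.
- split; intros [η [Hη L]]; assert (Hη' := proj1 (proj1 (mem_G _ _ _) Hη));
  exists η; (split; [auto|]); (apply (IH η e1 e2 e1' e2'); [| |now apply L]); eauto.
Qed.

Lemma eval_sentence α p e1 e2 e1' e2' : sentence p ->
  (eval α e1 e2 p <-> eval α e1' e2' p).
Proof.
intros [H K]; apply eval_agree; intros n Hn; [destruct (H n Hn)|destruct (K n Hn)].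
Qed.

Lemma eval_shift α p : forall e1 e2,
  eval α e1 e2 (shift p) <-> eval α e1 (fun n => e2 (S n)) p.
Proof.
induction p as [q|n p IH|n p IH|ξ ψ IH|ξ ψ IH]; simpl; intros e1 e2.
- apply fsat_shift.
- split; intros H A HA; specialize (H A HA); apply IH in H || apply IH;
  now rewrite upd_shift in *.
- split; intros [A [HA H]]; exists A; (split; [auto|]); apply IH in H || apply IH;
  now rewrite upd_shift in *.
- split; intros H η Hη; apply IH; auto.
- split; intros [η [Hη H]]; exists η; (split; [auto|]); apply IH; auto.
Qed.

Lemma eval_sub α p : forall σ e1 e2,
  eval α e1 e2 (sub σ p) <-> eval α e1 (with_params α σ e2) p.
Proof.
assert (U : forall σ e2 n (A : M),
  with_params α (hide2 σ n) (upd e2 n A) = upd (with_params α σ e2) n A).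
{ intros σ e2 n A; apply functional_extensionality; intros m.
  unfold with_params, hide2, upd; destruct (Nat.eq_dec m n); auto. }
induction p as [q|n p IH|n p IH|ξ ψ IH|ξ ψ IH]; simpl; intros σ e1 e2.
- apply fsat_sub.
- split; intros H A HA; specialize (H A HA); [apply IH in H|apply IH];
  now rewrite U in *.
- split; intros [A [HA H]]; exists A; (split; [auto|]); [apply IH in H|apply IH];
  now rewrite U in *.
- split; intros H η Hη; apply IH; auto.
- split; intros [η [Hη H]]; exists η; (split; [auto|]); apply IH; auto.
Qed.

(** The leaf-wise conjunct can be pulled out because no quantifier binds a variable of [χ] and no
    range is empty: the empty set instantiates a set quantifier, and [ok] puts index 0 into each
    trace. *)
Lemma eval_andfo α χ p : ok α p -> (forall n, bound2 n p -> ~ fo_free2 n χ) ->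
  forall e1 e2, eval α e1 e2 (andfo χ p) <-> eval α e1 e2 p /\ fsat α e1 e2 χ.
Proof.
assert (U : forall n, ~ fo_free2 n χ -> forall e1 e2 A,
  fsat α e1 (upd e2 n A) χ <-> fsat α e1 e2 χ).
{ intros n N e1 e2 A; apply fsat_agree; auto; intros m Hm.
  apply upd_neq; intros ->; auto. }
induction p as [q|n p IH|n p IH|ξ ψ IH|ξ ψ IH]; simpl; intros Hok Hb e1 e2.
- reflexivity.
- assert (E : forall A, eval α e1 (upd e2 n A) (andfo χ p) <->
     eval α e1 (upd e2 n A) p /\ fsat α e1 e2 χ).
  { intros A; rewrite (IH Hok (fun m Hm => Hb m (or_intror Hm))), U; [tauto|auto]. }
  split.
  + intros H; split; [intros A HA; apply E; auto|].
    apply (E empty), H, subV_empty.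
  + intros [H K] A HA; apply E; auto.
- assert (E : forall A, eval α e1 (upd e2 n A) (andfo χ p) <->
     eval α e1 (upd e2 n A) p /\ fsat α e1 e2 χ).
  { intros A; rewrite (IH Hok (fun m Hm => Hb m (or_intror Hm))), U; [tauto|auto]. }
  split.
  + intros [A [HA H]]; apply E in H; split; [exists A|]; tauto.
  + intros [[A [HA H]] K]; exists A; split; auto; apply E; auto.
- destruct Hok as [L [_ [C Hok]]].
  assert (E : forall η, η ∈ G α ξ -> (eval α e1 e2 (andfo χ (ψ η)) <->
     eval α e1 e2 (ψ η) /\ fsat α e1 e2 χ)).
  { intros η Hη; apply IH; auto; intros n Hn; apply Hb; exists η; split; auto.
    now apply mem_G in Hη. }
  split.
  + intros H; split; [intros η Hη; apply E; auto|].
    assert (Q : empty ∈ G α ξ) by (apply C, empty_mem; apply L).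
    apply (E _ Q); auto.
  + intros [H K] η Hη; apply E; auto.
- destruct Hok as [L [_ [C Hok]]].
  assert (E : forall η, η ∈ G α ξ -> (eval α e1 e2 (andfo χ (ψ η)) <->
     eval α e1 e2 (ψ η) /\ fsat α e1 e2 χ)).
  { intros η Hη; apply IH; auto; intros n Hn; apply Hb; exists η; split; auto.
    now apply mem_G in Hη. }
  split.
  + intros [η [Hη H]]; apply E in H; auto; split; [exists η|]; tauto.
  + intros [[η [Hη H]] K]; exists η; split; auto; apply E; auto.
Qed.

Lemma restr_neg α p : restr b κ α (neg p) = neg (restr b κ α p).
Proof.
induction p as [q|n p IH|n p IH|ξ ψ IH|ξ ψ IH]; simpl; try congruence;
destruct (excluded_middle_informative (ξ ∈ κ)); simpl; f_equal;
apply functional_extensionality; auto.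
Qed.

Lemma restr_defined_neg α p : restr_defined b κ α (neg p) <-> restr_defined b κ α p.
Proof.
induction p as [q|n p IH|n p IH|ξ ψ IH|ξ ψ IH]; simpl; try tauto;
split; intros H K; destruct (H K) as [R L]; (split; [auto|]); intros ζ Hζ;
destruct (L ζ Hζ) as [L1 L2]; rewrite restr_neg in *; split; try (now apply IH);
first [now apply Pi1_neg in L2|now apply Sigma1_neg in L2|now apply Pi1_neg|now apply Sigma1_neg].
Qed.

Lemma restr_all2s α ks p : restr b κ α (all2s ks p) = all2s ks (restr b κ α p).
Proof. induction ks; simpl; congruence. Qed.

Lemma restr_defined_all2s α ks p :
  restr_defined b κ α (all2s ks p) <-> restr_defined b κ α p.
Proof. induction ks; simpl; tauto. Qed.

Section Regular.
Hypotheses (hb : canonical_bijections b) (Rκ : regular κ).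

Lemma limit_κ : limit κ. Proof. apply Rκ. Qed.
Lemma ordinal_κ : ordinal κ. Proof. apply Rκ. Qed.

Lemma cs_ordinal ζ : ζ ∈ cardsucc κ -> ordinal ζ.
Proof. destruct (cardsucc_spec κ (proj1 Rκ)) as [[O _] _]; eauto using ordinal_mem. Qed.

Lemma cs_trans ζ η : ζ ∈ cardsucc κ -> η ∈ ζ -> η ∈ cardsucc κ.
Proof. destruct (cardsucc_spec κ (proj1 Rκ)) as [[O _] _]; eauto using ordinal_trans. Qed.

Lemma cs_bij ζ : ζ ∈ cardsucc κ -> ~ ζ ∈ κ -> bij_on (b κ ζ) κ ζ.
Proof.
intros H N; apply (hb κ Rκ); auto.
destruct (ordinal_sub_or_mem κ ζ ordinal_κ (cs_ordinal _ H)); tauto.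
Qed.

Lemma idx_spec ζ η : ζ ∈ cardsucc κ -> η ∈ ζ -> ~ ζ ∈ κ ->
  idx ζ η ∈ κ /\ b κ ζ (idx ζ η) = η.
Proof.
intros H K N; unfold idx; destruct (excluded_middle_informative (ζ ∈ κ)); [tauto|].
apply (the_spec (fun β => β ∈ κ /\ b κ ζ β = η)).
destruct (cs_bij ζ H N) as [_ [_ S]]; auto.
Qed.

Lemma idx_mem ζ η : ζ ∈ cardsucc κ -> η ∈ ζ -> idx ζ η ∈ κ.
Proof.
intros H K; destruct (classic (ζ ∈ κ)) as [L|L]; [|now apply idx_spec].
unfold idx; destruct (excluded_middle_informative (ζ ∈ κ)); [|tauto].
exact (ordinal_trans _ _ _ ordinal_κ L K).
Qed.

Lemma idx_inj ζ η η' : ζ ∈ cardsucc κ -> η ∈ ζ -> η' ∈ ζ ->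
  idx ζ η = idx ζ η' -> η = η'.
Proof.
intros H K K'; destruct (classic (ζ ∈ κ)) as [L|L].
- unfold idx; destruct (excluded_middle_informative (ζ ∈ κ)); tauto.
- intros E; destruct (idx_spec ζ η H K L) as [_ <-], (idx_spec ζ η' H K' L) as [_ <-].
  congruence.
Qed.

Lemma inV_idx ζ η : ζ ∈ cardsucc κ -> η ∈ ζ -> inV (idx ζ η) κ.
Proof.
intros H K; apply inV_ordinal; eauto using ordinal_κ, idx_mem, ordinal_mem.
Qed.

Lemma G_top ζ : ζ ∈ cardsucc κ -> G κ ζ = ζ.
Proof.
intros H; apply ext_eq; intros z; rewrite mem_G; split; [tauto|].
intros Hz; split; auto using idx_mem.
Qed.

Lemma canF_G α ζ : ζ ∈ cardsucc κ -> α ∈ κ -> (ζ ∈ κ -> ζ ∈ α) ->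
  canF b κ ζ α = G α ζ.
Proof.
intros H Hα C; apply ext_eq; intros z; rewrite mem_G; unfold canF.
assert (Oα := ordinal_mem _ _ ordinal_κ Hα).
destruct (excluded_middle_informative (ζ ∈ κ)) as [L|L].
- unfold idx; destruct (excluded_middle_informative (ζ ∈ κ)); [|tauto].
  split; [|tauto]; intros Hz; split; auto; exact (ordinal_trans _ _ _ Oα (C L) Hz).
- destruct (cs_bij ζ H L) as [B1 [B2 B3]].
  rewrite mem_img; split.
  + intros [β [Hβ ->]].
    assert (Kβ : β ∈ κ) by exact (ordinal_trans _ _ _ ordinal_κ Hα Hβ).
    split; auto; destruct (idx_spec ζ (b κ ζ β) H (B1 _ Kβ) L) as [I1 I2].
    apply B2 in I2; auto; now rewrite I2.
  + intros [Hz I]; exists (idx ζ z); split; auto; symmetry; now apply idx_spec.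
Qed.

(** * Properties forced by closure under a function *)

Definition pt α : Prop := α = κ \/ (α ∈ κ /\ regular α).

Lemma pt_top : pt κ. Proof. left; reflexivity. Qed.

Lemma pt_limit α : pt α -> limit α.
Proof. intros [->|[_ H]]; [apply limit_κ|apply H]. Qed.

Lemma pt_ordinal α : pt α -> ordinal α.
Proof. intros H; apply pt_limit in H; apply H. Qed.

Lemma pt_inV α x : pt α -> inV x α -> inV x κ.
Proof. intros [->|[H _]]; auto; intros K; exact (inV_mono x κ α (proj1 ordinal_κ) H K). Qed.

Lemma pt_mem α x : pt α -> x ∈ α -> x ∈ κ.
Proof. intros [->|[H _]]; auto; intros K; exact (ordinal_trans κ α x ordinal_κ H K). Qed.

Lemma pt_inV_mem α x : pt α -> x ∈ κ -> (inV x α <-> x ∈ α).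
Proof.
intros H Hx; apply inV_ordinal; [now apply pt_ordinal|].
eauto using ordinal_mem, ordinal_κ.
Qed.

(** A filter base generated by closure points. The top point [κ] is included, so a forced property
    holds at [κ] too and equivalences can be transferred between [κ] and the reflecting points. *)
Definition forced (Q : M -> Prop) : Prop :=
  exists g, closed_under g κ /\ forall α, pt α -> closed_under g α -> Q α.

Lemma forced_true (Q : M -> Prop) : (forall α, pt α -> Q α) -> forced Q.
Proof. intros H; exists (fun x => x); split; [intros x Hx|]; auto. Qed.

Lemma forced_imp (Q Q' : M -> Prop) :
  forced Q -> (forall α, pt α -> Q α -> Q' α) -> forced Q'.
Proof. intros [g [C H]] K; exists g; split; auto. Qed.

Lemma forced_top (Q : M -> Prop) : forced Q -> Q κ.
Proof. intros [g [C H]]; apply H; auto using pt_top. Qed.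

Lemma forced_inV a : inV a κ -> forced (inV a).
Proof.
intros H; exists (fun _ => a); split; [intros x _; auto|].
intros α Hα C; apply (C empty); apply inV_empty, pt_limit, Hα.
Qed.

(** Diagonal intersection. The functions [F x] are merged into one function on ordered pairs, and
    V_α contains the pair of any two of its elements since [α] is a limit. *)
Lemma forced_diag (Q : M -> M -> Prop) : (forall x, inV x κ -> forced (Q x)) ->
  forced (fun α => forall x, inV x α -> Q x α).
Proof.
intros H.
destruct (choice_on M (M -> M) (fun x => x) (fun x => inV x κ)
  (fun x g => closed_under g κ /\ forall α, pt α -> closed_under g α -> Q x α) H)
  as [F HF].
(* [P z w] decodes [z] as a pair and applies the function indexed by its first component; off the
   pairs the merged function takes the harmless value [empty]. *)
set (P := fun z w => exists x y, z = op x y /\ inV x κ /\ inV y κ /\ w = F x y).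
exists (fun z => if excluded_middle_informative (exists w, P z w) then the (P z) else empty).
split.
- intros z Hz; destruct (excluded_middle_informative (exists w, P z w)) as [E|E];
    [|apply inV_empty, limit_κ].
  apply the_spec in E; destruct E as [x [y [E1 [Hx [Hy E2]]]]].
  rewrite E2; now apply HF.
- intros α Hα C x Hx; apply HF; eauto using pt_inV.
  intros y Hy; specialize (C (op x y)); cbv beta in C.
  assert (E : exists w, P (op x y) w)
    by (exists (F x y), x, y; repeat split; apply (pt_inV α); auto).
  destruct (excluded_middle_informative (exists w, P (op x y) w)); [|tauto].
  apply the_spec in E; destruct E as [x' [y' [E1 [_ [_ E2]]]]].
  apply op_inj in E1; destruct E1; subst x' y'; rewrite <- E2.
  apply C, inV_op; auto using pt_limit.
Qed.

(** A diagonal intersection in which index 0 carries [Q] and every other index carries [Q']; both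
    kinds of index occur in each V_α, the second one for instance as [num 1]. *)
Lemma forced_and (Q Q' : M -> Prop) :
  forced Q -> forced Q' -> forced (fun α => Q α /\ Q' α).
Proof.
intros H H'.
apply (forced_imp (fun α => forall x, inV x α -> (x = empty -> Q α) /\ (x <> empty -> Q' α))).
- apply forced_diag; intros x _; destruct (classic (x = empty)) as [E|E].
  + apply (forced_imp Q); auto; tauto.
  + apply (forced_imp Q'); auto; tauto.
- intros α Hα K; apply pt_limit in Hα; split.
  + apply (K empty); auto using inV_empty.
  + apply (K (num 1)); [now apply inV_num|apply succ_not_empty].
Qed.

(** Diagonal intersection along codes: [η] belongs to the trace at [α] exactly when its code belongs
    to [α], and codes are injective. *)
Lemma forced_G ζ (Q : M -> M -> Prop) : ζ ∈ cardsucc κ ->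
  (forall η, η ∈ ζ -> forced (Q η)) -> forced (fun α => forall η, η ∈ G α ζ -> Q η α).
Proof.
intros Hζ H.
apply (forced_imp (fun α => forall x, inV x α -> forall η, η ∈ ζ -> idx ζ η = x -> Q η α)).
- apply forced_diag; intros x _.
  destruct (classic (exists η, η ∈ ζ /\ idx ζ η = x)) as [[η [Hη E]]|N].
  + apply (forced_imp (Q η)); auto.
    intros α _ K η' Hη' E'; enough (η' = η) by (subst; auto).
    apply (idx_inj ζ); auto; congruence.
  + apply forced_true; intros α _ η Hη E; destruct N; eauto.
- intros α Hα K η Hη; apply mem_G in Hη; destruct Hη as [Hη I].
  apply (K (idx ζ η)); auto; apply pt_inV_mem; auto using idx_mem.
Qed.

Lemma forced_mem x : x ∈ κ -> forced (fun α => x ∈ α).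
Proof.
intros H; apply (forced_imp (inV x)).
- apply forced_inV; apply inV_ordinal; eauto using ordinal_κ, ordinal_mem.
- intros α Hα; now apply pt_inV_mem.
Qed.

(** For fixed ordinals each clause only asks that certain codes lie in [α], which a constant
    function forces. The quantifiers over the trace are then absorbed by diagonal intersections. *)
Lemma forced_coh ζ : ζ ∈ cardsucc κ -> forced (fun α => coh α ζ).
Proof.
intros Hζ; assert (Oζ := cs_ordinal _ Hζ); unfold coh.
assert (E : forall η, η ∈ ζ -> forced (fun α => η ∈ G α ζ)).
{ intros η Hη; apply (forced_imp (fun α => idx ζ η ∈ α)).
  - apply forced_mem, idx_mem; auto.
  - intros α _ K; now apply mem_G. }
assert (E' : forall x, forced (fun α => x ∈ κ -> x ∈ α)).
{ intros x; destruct (classic (x ∈ κ)) as [H|H].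
  - eapply forced_imp; [apply forced_mem, H|]; auto.
  - apply forced_true; tauto. }
apply forced_and; [apply E'|].
apply forced_and; [|apply forced_and; [|apply forced_and]].
- apply forced_G; auto; intros η Hη.
  assert (Hη' := cs_trans _ _ Hζ Hη).
  apply forced_and; [apply E'|apply forced_and].
  + apply (forced_imp (fun α => (forall μ, μ ∈ G α η -> μ ∈ G α ζ) /\
       (forall μ, μ ∈ G α ζ -> μ ∈ η -> μ ∈ G α η))).
    * apply forced_and; apply forced_G; auto; intros μ Hμ.
      -- apply E; eapply ordinal_trans; eauto.
      -- destruct (classic (μ ∈ η)) as [K|K]; [|apply forced_true; tauto].
         apply (forced_imp (fun α => idx η μ ∈ α)).
         ++ apply forced_mem, idx_mem; auto.
         ++ intros α _ L _; now apply mem_G.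
    * intros α _ [H K] μ; split; [|intros []; auto].
      intros Hμ; split; auto; now apply mem_G in Hμ.
  + destruct (classic (succ η ∈ ζ)) as [K|K]; [|apply forced_true; tauto].
    eapply forced_imp; [apply E, K|]; auto.
- apply (forced_imp (fun α => forall μ, μ ∈ G α ζ -> forall η, μ = succ η -> η ∈ G α ζ)).
  + apply forced_G; auto; intros μ Hμ.
    destruct (classic (exists η, μ = succ η)) as [[η ->]|N].
    * assert (K : η ∈ ζ) by (eapply ordinal_trans; eauto using mem_succ_self).
      eapply forced_imp; [apply E, K|]; intros α _ H η' E0.
      apply succ_inj in E0; now subst.
    * apply forced_true; intros α _ η E0; destruct N; eauto.
  + intros α _ H η Hη; eauto.
- destruct (classic (exists η, ζ = succ η)) as [[η K]|N].
  + eapply forced_imp; [apply (E η); rewrite K; apply mem_succ_self|].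
    intros α _ H η' E0; rewrite K in E0; apply succ_inj in E0; now subst.
  + apply forced_true; intros α _ η E0; destruct N; eauto.
- destruct (classic (empty ∈ ζ)) as [K|K]; [|apply forced_true; tauto].
  eapply forced_imp; [apply E, K|]; auto.
Qed.

Lemma coh_top ζ : ζ ∈ cardsucc κ -> coh κ ζ.
Proof. intros H; apply (forced_top (fun α => coh α ζ)), forced_coh, H. Qed.

Lemma ok_Pi1 α ζ p : Pi1 κ ζ p -> ζ ∈ cardsucc κ -> coh α ζ -> ok α p.
Proof.
intros H; revert ζ p H.
apply (Pi1_levels κ (fun ζ p => ζ ∈ cardsucc κ -> coh α ζ -> ok α p)).
- simpl; auto.
- intros ζ ks p O _ IH Hζ C; apply ok_all2s, ok_neg, IH.
  + apply (cs_trans (succ ζ)); auto using mem_succ_self.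
  + apply (coh_sub α (succ ζ)); auto using ordinal_succ; now apply C.
- intros ζ ψ L _ IH _ Hζ C; simpl; do 3 (split; [assumption|]).
  intros η Hη; assert (Hη' := proj1 (proj1 (mem_G _ _ _) Hη)).
  apply IH; auto; [apply (cs_trans ζ); auto|apply (coh_sub α ζ); auto; apply L].
Qed.

(** At the top point every trace is full, so [eval] visits all conjuncts and the parameters are not
    cut. *)
Lemma sat_eval ζ p : Pi1 κ ζ p -> ζ ∈ cardsucc κ ->
  forall e1 e2, sat κ e1 e2 p <-> eval κ e1 e2 p.
Proof.
intros H; revert ζ p H.
apply (Pi1_levels κ (fun ζ p => ζ ∈ cardsucc κ ->
  forall e1 e2, sat κ e1 e2 p <-> eval κ e1 e2 p)).
- intros q Hq _ e1 e2; simpl; unfold fsat; now rewrite fo_restr_self.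
- intros ζ ks p O Hp IH Hζ.
  assert (E : forall e1 e2, sat κ e1 e2 p <-> eval κ e1 e2 p).
  { intros e1 e2.
    assert (Hζ' : ζ ∈ cardsucc κ) by (apply (cs_trans (succ ζ)); auto using mem_succ_self).
    specialize (IH Hζ' e1 e2); rewrite sat_neg, eval_neg in IH; tauto. }
  induction ks as [|k ks IHks]; simpl; auto; intros e1 e2.
  split; intros H A HA; apply IHks; apply H, HA.
- intros ζ ψ L _ IH _ Hζ e1 e2; simpl; rewrite (G_top _ Hζ).
  split; intros H η Hη; apply IH; eauto using cs_trans.
Qed.

(** * The restriction at a coherent point below the cardinal *)

Section Restriction.
Variable α : M.
Hypothesis Hα : α ∈ κ.

Lemma canf_spec ξ : ξ ∈ cardsucc κ -> coh α ξ -> ~ ξ ∈ κ ->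
  (forall ζ, ζ ∈ canf b κ ξ α -> canpi_inv b κ ξ α ζ ∈ G α ξ /\
     collapse (G α ξ) (canpi_inv b κ ξ α ζ) = ζ) /\
  (forall η, η ∈ G α ξ -> collapse (G α ξ) η ∈ canf b κ ξ α /\
     canpi_inv b κ ξ α (collapse (G α ξ) η) = η).
Proof.
intros H C N; unfold canf, canpi_inv, canpi.
rewrite (canF_G α ξ H Hα) by tauto.
assert (S : forall ζ, ζ ∈ ot (G α ξ) ->
  the (fun η => η ∈ G α ξ /\ collapse (G α ξ) η = ζ) ∈ G α ξ /\
  collapse (G α ξ) (the (fun η => η ∈ G α ξ /\ collapse (G α ξ) η = ζ)) = ζ).
{ intros ζ Hζ; apply (the_spec (fun η => η ∈ G α ξ /\ collapse (G α ξ) η = ζ)).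
  apply mem_ot in Hζ; destruct Hζ as [y [Hy ->]]; eauto. }
split; auto.
intros η Hη; assert (Hot : collapse (G α ξ) η ∈ ot (G α ξ)) by (apply mem_ot; eauto).
split; auto; destruct (S _ Hot) as [S1 S2].
apply (collapse_inj (G α ξ)) in S2; auto.
intros x Hx; apply mem_G in Hx; apply (ordinal_mem ξ); [apply (cs_ordinal _ H)|tauto].
Qed.

Lemma G_below ξ : ξ ∈ κ -> ξ ∈ α -> G α ξ = ξ.
Proof.
intros H K; apply ext_eq; intros z; rewrite mem_G; unfold idx.
destruct (excluded_middle_informative (ξ ∈ κ)); [|tauto].
split; [tauto|]; intros Hz; split; auto.
eapply ordinal_trans; eauto; apply (ordinal_mem κ); auto using ordinal_κ.
Qed.

(** The inverse collapse is a bijection from the new index set onto the trace. It renumbers the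
    conjuncts, and truth does not depend on their numbering. *)
Lemma restr_eval p : ok α p -> forall e1 e2,
  sat α e1 e2 (restr b κ α p) <-> eval α e1 e2 p.
Proof.
induction p as [q|n p IH|n p IH|ξ ψ IH|ξ ψ IH]; simpl; intros Hok e1 e2.
- reflexivity.
- split; intros H A HA; apply IH; auto.
- split; intros [A [HA H]]; exists A; (split; [auto|]); apply IH; auto.
- destruct Hok as [L [Hξ [C Hok]]].
  destruct (excluded_middle_informative (ξ ∈ κ)) as [B|B]; simpl.
  + assert (E := G_below ξ B (proj1 C B)); rewrite E in *.
    split; intros H η Hη; apply IH; auto.
  + destruct (canf_spec ξ Hξ C B) as [S1 S2]; split; intros H η Hη.
    * destruct (S2 η Hη) as [T1 T2]; specialize (H _ T1); rewrite T2 in H.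
      apply IH; auto.
    * apply IH; [apply Hok|apply H]; now apply S1.
- destruct Hok as [L [Hξ [C Hok]]].
  destruct (excluded_middle_informative (ξ ∈ κ)) as [B|B]; simpl.
  + assert (E := G_below ξ B (proj1 C B)); rewrite E in *.
    split; intros [η [Hη H]]; exists η; (split; [auto|]); apply IH; auto.
  + destruct (canf_spec ξ Hξ C B) as [S1 S2]; split; intros [η [Hη H]].
    * exists (canpi_inv b κ ξ α η); split; [now apply S1|].
      apply IH; auto; apply Hok; now apply S1.
    * destruct (S2 η Hη) as [T1 T2]; exists (collapse (G α ξ) η); split; auto.
      rewrite T2; apply IH; auto.
Qed.

Lemma free2_restr n p : ok α p -> free2 n (restr b κ α p) -> free2 n p.
Proof.
assert (F : forall q, fo_free2 n (fo_restr α q) -> fo_free2 n q).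
{ intros q; induction q as [s t|s t|s [m|A]|q IH|q IH r IH'|m q IH];
  simpl; try tauto; congruence. }
induction p as [q|m p IH|m p IH|ξ ψ IH|ξ ψ IH]; simpl; intros Hok; try tauto; auto;
destruct Hok as [L [Hξ [C Hok]]];
(destruct (excluded_middle_informative (ξ ∈ κ)) as [B|B]; simpl; intros [ζ [Hζ K]];
 [assert (Hζ' : ζ ∈ G α ξ) by (rewrite (G_below ξ B (proj1 C B)); auto)
 |destruct (proj1 (canf_spec ξ Hξ C B) ζ Hζ) as [Hζ' _]]);
(apply IH in K; [|auto]); eexists; (split; [|exact K]); now apply mem_G in Hζ'.
Qed.

Lemma par2_restr B p : ok α p -> par2 B (restr b κ α p) ->
  exists A, par2 A p /\ B = sep A (fun x => inV x α).
Proof.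
assert (F : forall q, fo_par2 B (fo_restr α q) -> exists A, fo_par2 A q /\
   B = sep A (fun x => inV x α)).
{ intros q; induction q as [s t|s t|s [m|A]|q IH|q IH r IH'|m q IH];
  simpl; try tauto; try congruence.
  - intros [= <-]; eauto.
  - intros [K|K]; [apply IH in K|apply IH' in K]; destruct K as [A [K1 K2]]; eauto. }
induction p as [q|m p IH|m p IH|ξ ψ IH|ξ ψ IH]; simpl; intros Hok; try tauto; auto;
destruct Hok as [L [Hξ [C Hok]]];
(destruct (excluded_middle_informative (ξ ∈ κ)) as [N|N]; simpl; intros [ζ [Hζ K]];
 [assert (Hζ' : ζ ∈ G α ξ) by (rewrite (G_below ξ N (proj1 C N)); auto)
 |destruct (proj1 (canf_spec ξ Hξ C N) ζ Hζ) as [Hζ' _]]);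
(apply IH in K; [|auto]); destruct K as [A [K1 K2]]; exists A; split; auto;
eexists; (split; [|exact K1]); now apply mem_G in Hζ'.
Qed.

Lemma finitary2_restr p : ok α p -> finitary2 p -> finitary2 (restr b κ α p).
Proof.
intros Hok [[l H] [l' K]]; split.
- exists l; intros n Hn; apply H; eapply free2_restr; eauto.
- exists (map (fun A => sep A (fun x => inV x α)) l'); intros B HB.
  apply par2_restr in HB; auto; destruct HB as [A [HA ->]].
  apply (in_map (fun A => sep A (fun x => inV x α))); auto.
Qed.

Lemma ordinal_in_G ξ x : ξ ∈ cardsucc κ -> x ∈ G α ξ -> ordinal x.
Proof.
intros H Hx; apply mem_G in Hx; apply (ordinal_mem ξ); [now apply cs_ordinal|tauto].
Qed.

Lemma collapse_G ξ η : ξ ∈ cardsucc κ -> coh α ξ -> η ∈ G α ξ ->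
  collapse (G α ξ) η = ot (G α η).
Proof.
intros H C Hη; apply (collapse_ot _ (fun x => ordinal_in_G ξ x H) _ η); auto.
now apply C.
Qed.

(** By coherence [ξ] is the largest element of the trace of its successor, and the elements below it
    form its own trace. *)
Lemma ot_G_succ ξ : succ ξ ∈ cardsucc κ -> coh α (succ ξ) ->
  ot (G α (succ ξ)) = succ (ot (G α ξ)).
Proof.
intros H C; assert (Hξ : ξ ∈ G α (succ ξ)) by now apply C.
apply ext_eq; intros z; rewrite mem_succ, mem_ot.
rewrite <- (collapse_G _ _ H C Hξ).
split.
- intros [y [Hy ->]]; assert (Q := Hy); apply mem_G in Q; destruct Q as [Q _].
  apply mem_succ in Q; destruct Q as [->|Q]; auto.
  right; apply mem_collapse; eauto.
- intros [->|Hz]; eauto; apply mem_collapse in Hz; auto.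
  destruct Hz as [y [H1 [_ H2]]]; eauto.
Qed.

Lemma limit_ot_G ξ : limit ξ -> ξ ∈ cardsucc κ -> coh α ξ -> limit (ot (G α ξ)).
Proof.
intros L H C; split; [|split].
- apply ordinal_ot; intros x; apply ordinal_in_G, H.
- assert (E : empty ∈ G α ξ) by (apply C, empty_mem; apply L).
  exists (collapse (G α ξ) empty); apply mem_ot; eauto.
- intros β Hβ; apply mem_ot in Hβ; destruct Hβ as [η [Hη ->]].
  assert (Hη' := proj1 (proj1 (mem_G _ _ _) Hη)).
  assert (Hs : succ η ∈ G α ξ) by (apply (proj1 (proj2 C) η Hη); now apply L).
  apply mem_ot; exists (succ η); split; auto.
  rewrite !(collapse_G _ _ H C) by auto.
  symmetry; apply ot_G_succ.
  + apply (cs_trans ξ); auto; now apply L.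
  + apply (coh_sub α ξ); auto; apply L.
Qed.

End Restriction.

Lemma forced_par1 q : fo_over κ q -> forced (fun α => forall a, fo_par1 a q -> inV a α).
Proof.
assert (E : forall t, (forall a, t = Par a -> inV a κ) ->
  forced (fun α => forall a, t = Par a -> inV a α)).
{ intros [n|x] H; [apply forced_true; discriminate|].
  eapply forced_imp; [apply (forced_inV x), H; auto|]; intros α _ K a [= <-]; exact K. }
intros [H _]; induction q as [s t|s t|s T|q IH|q IH r IH'|m q IH]; simpl in *; auto.
- eapply forced_imp; [apply forced_and; [apply (E s)|apply (E t)]; auto|].
  intros α _ [K K'] a [Ha|Ha]; auto.
- eapply forced_imp; [apply forced_and; [apply (E s)|apply (E t)]; auto|].
  intros α _ [K K'] a [Ha|Ha]; auto.
- eapply forced_imp; [apply forced_and; [apply IH|apply IH']; auto|].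
  intros α _ [K K'] a [Ha|Ha]; auto.
Qed.

Lemma fo_over_restr α q : (forall a, fo_par1 a q -> inV a α) -> fo_over α (fo_restr α q).
Proof.
intros H; induction q as [s t|s t|s [m|A]|q IH|q IH r IH'|m q IH]; simpl in *;
try (split; simpl; [auto|tauto]; fail).
- split; simpl; [auto|discriminate].
- split; simpl; [auto|]; intros B [= <-] x Hx; apply mem_sep in Hx; tauto.
- destruct (IH H); split; auto.
- destruct IH, IH'; auto; split; simpl; intros a [K|K]; auto.
- destruct (IH H); split; auto.
Qed.

(** The definedness clause of a restriction asks for exact levels. The level obtained is the order
    type of the trace, and the preceding facts show that it is 0, a successor or a limit along with
    [ζ]. *)
Lemma forced_restr ζ p : Pi1 κ ζ p -> ζ ∈ cardsucc κ ->
  forced (fun α => α ∈ κ -> restr_defined b κ α p /\ Pi1 α (ot (G α ζ)) (restr b κ α p)).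
Proof.
intros H; revert ζ p H.
apply (Pi1_levels κ (fun ζ p => ζ ∈ cardsucc κ -> forced (fun α => α ∈ κ ->
  restr_defined b κ α p /\ Pi1 α (ot (G α ζ)) (restr b κ α p)))).
- intros q Hq _; eapply forced_imp; [apply forced_par1, Hq|].
  intros α Hα K _; simpl; split; auto.
  replace (ot (G α empty)) with (@empty M); [constructor; now apply fo_over_restr|].
  apply ext_eq; intros z; rewrite mem_ot; split; intros Hz; [destruct (mem_empty Hz)|].
  destruct Hz as [y [Hy _]]; apply mem_G in Hy; destruct Hy as [Hy _]; destruct (mem_empty Hy).
- intros ζ ks p O _ IH Hζ.
  eapply forced_imp; [apply forced_and; [apply (forced_coh _ Hζ)|apply IH]|].
  + apply (cs_trans (succ ζ)); auto using mem_succ_self.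
  + intros α Hα [C K] L; destruct (K L) as [K1 K2].
    rewrite restr_all2s, restr_defined_all2s, ot_G_succ by auto.
    rewrite restr_neg in K2; split; [now apply restr_defined_neg|].
    constructor; [|now apply Pi1_neg].
    apply ordinal_ot; intros x; apply ordinal_in_G.
    apply (cs_trans (succ ζ)); auto using mem_succ_self.
- intros ζ ψ Lζ Hψ IH F Hζ.
  eapply forced_imp; [apply forced_and; [apply (forced_coh _ Hζ)|]|].
  + apply (forced_G ζ (fun η α => α ∈ κ -> restr_defined b κ α (ψ η) /\
      Pi1 α (ot (G α η)) (restr b κ α (ψ η)))); auto.
    intros η Hη; apply IH; auto; apply (cs_trans ζ); auto.
  + intros α Hα [C K] L.
    assert (Hok : ok α (Conj ζ ψ)) by (eapply ok_Pi1; eauto; now constructor).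
    assert (F' := finitary2_restr α L _ Hok F).
    assert (L' := limit_ot_G α ζ Lζ Hζ C).
    simpl in F' |- *; destruct (excluded_middle_informative (ζ ∈ κ)) as [B|B].
    (* Below [κ] the restriction keeps the index set, in agreement with a trace that is all of
       [ζ]. *)
    * assert (E := G_below α L ζ B (proj1 C B)).
      assert (Oζ := cs_ordinal _ Hζ).
      split; [tauto|]; rewrite E, (ot_ordinal ζ Oζ) in *; constructor; auto.
      intros η Hη; destruct (K η) as [_ Q]; auto.
      rewrite (G_below α L η), ot_ordinal in Q; auto.
      -- eauto using ordinal_mem.
      -- eapply ordinal_trans; eauto using ordinal_κ.
      -- exact (ordinal_trans α ζ η (pt_ordinal α Hα) (proj1 C B) Hη).
    (* From [κ] on the conjuncts are renumbered; the conjunct moved to place [μ] has level [μ]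
       because the collapse of its old index is the order type of that index's trace. *)
    * assert (E : canf b κ ζ α = ot (G α ζ))
        by (unfold canf; now rewrite canF_G by tauto).
      destruct (canf_spec α L ζ Hζ C B) as [S1 S2]; rewrite E in *.
      assert (Q : forall μ, μ ∈ ot (G α ζ) ->
        restr_defined b κ α (ψ (canpi_inv b κ ζ α μ)) /\
        Pi1 α μ (restr b κ α (ψ (canpi_inv b κ ζ α μ)))).
      { intros μ Hμ; destruct (S1 μ Hμ) as [T1 T2].
        destruct (K _ T1) as [K1 K2]; auto; split; auto.
        rewrite <- (collapse_G α ζ _ Hζ C T1), T2 in K2; auto. }
      split; [split; auto|]; constructor; auto; intros μ Hμ; now apply Q.
Qed.

End Regular.
End Evaluation.

(** * Indescribability as reflection *)

Section Reflection.
Context {M : zfc}.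
Implicit Types (α β ζ η ξ a A S : M) (p : @form M) (q r χ : @fo M) (s t T : @term M).
Implicit Types (e : nat -> M) (n : nat).

(** Formulas without content exist at every level. They fill the unwanted places of a limit
    conjunction and, combined with [andfo], bring a first-order sentence to any prescribed level. *)
Fixpoint taut p : Prop :=
  match p with
  | Fo q => q = Top
  | All2 _ p | Ex2 _ p => taut p
  | Conj ξ ψ | Disj ξ ψ => forall η, η ∈ ξ -> taut (ψ η)
  end.

Lemma taut_free1 n p : taut p -> ~ free1 n p.
Proof.
induction p as [q|m p IH|m p IH|ξ ψ IH|ξ ψ IH]; simpl; auto.
- intros ->; simpl; intuition congruence.
- intros H [η [Hη K]]; exact (IH η (H η Hη) K).
- intros H [η [Hη K]]; exact (IH η (H η Hη) K).
Qed.

Lemma taut_free2 n p : taut p -> ~ free2 n p.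
Proof.
induction p as [q|m p IH|m p IH|ξ ψ IH|ξ ψ IH]; simpl; try tauto.
- intros ->; simpl; tauto.
- intros H [η [Hη K]]; exact (IH η (H η Hη) K).
- intros H [η [Hη K]]; exact (IH η (H η Hη) K).
Qed.

Lemma taut_par2 A p : taut p -> ~ par2 A p.
Proof.
induction p as [q|m p IH|m p IH|ξ ψ IH|ξ ψ IH]; simpl; auto.
- intros ->; simpl; tauto.
- intros H [η [Hη K]]; exact (IH η (H η Hη) K).
- intros H [η [Hη K]]; exact (IH η (H η Hη) K).
Qed.

Lemma taut_finitary2 p : taut p -> finitary2 p.
Proof.
intros H; split; exists nil; intros n Hn; [destruct (taut_free2 n p H Hn)|].
destruct (taut_par2 n p H Hn).
Qed.

Lemma taut_exists κ ζ : ordinal ζ ->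
  (exists p, Pi1 κ ζ p /\ taut p) /\ (exists p, Sigma1 κ ζ p /\ taut p).
Proof.
induction ζ as [ζ IH] using mem_ind; intros O.
destruct (ordinal_cases ζ O) as [->|[[η [Oη ->]]|L]].
- assert (H : fo_over κ (@Top M)) by (split; simpl; intuition discriminate).
  split; exists (Fo Top); split; simpl; auto; now constructor.
- destruct (IH η (mem_succ_self η) Oη) as [[p [Hp Tp]] [p' [Hp' Tp']]].
  split; [exists p'|exists p]; split; auto.
  + exact (Pi1_succ nil Oη Hp').
  + exact (Sigma1_succ nil Oη Hp).
- assert (IH' := fun η Hη => IH η Hη (ordinal_mem _ _ O Hη)); split.
  + destruct (choice_on M form (Fo Top) (fun η => η ∈ ζ)
      (fun η p => Pi1 κ η p /\ taut p) (fun η Hη => proj1 (IH' η Hη))) as [ψ Hψ].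
    assert (T : taut (Conj ζ ψ)) by (intros η Hη; now apply Hψ).
    exists (Conj ζ ψ); split; auto; constructor; auto using taut_finitary2.
    intros η Hη; now apply Hψ.
  + destruct (choice_on M form (Fo Top) (fun η => η ∈ ζ)
      (fun η p => Sigma1 κ η p /\ taut p) (fun η Hη => proj2 (IH' η Hη))) as [ψ Hψ].
    assert (T : taut (Disj ζ ψ)) by (intros η Hη; now apply Hψ).
    exists (Disj ζ ψ); split; auto; constructor; auto using taut_finitary2.
    intros η Hη; now apply Hψ.
Qed.

Lemma taut_sat_andfo κ χ : (forall e1 e2, fo_sat κ e1 e2 χ) ->
  (forall ζ p, Pi1 κ ζ p -> taut p -> forall e1 e2, sat κ e1 e2 (andfo χ p)) /\
  (forall ζ p, Sigma1 κ ζ p -> taut p -> forall e1 e2, sat κ e1 e2 (andfo χ p)).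
Proof.
intros H.
apply (Pi1_Sigma1_ind M κ
  (fun ζ p => taut p -> forall e1 e2, sat κ e1 e2 (andfo χ p))
  (fun ζ p => taut p -> forall e1 e2, sat κ e1 e2 (andfo χ p))).
- simpl; intros q _ -> e1 e2; split; auto; intros a _; reflexivity.
- intros ξ ks p _ _ IH; rewrite andfo_all2s.
  induction ks as [|k ks IHks]; simpl; auto.
- simpl; intros ξ ψ _ _ IH _ T e1 e2 η Hη; auto.
- simpl; intros q _ -> e1 e2; split; auto; intros a _; reflexivity.
- intros ξ ks p _ _ IH; rewrite andfo_ex2s.
  induction ks as [|k ks IHks]; simpl; auto.
  intros T e1 e2; exists empty; split; [apply subV_empty|]; auto.
- simpl; intros ξ ψ [_ [[η Hη] _]] _ IH _ T e1 e2; exists η; auto.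
Qed.

Definition closed_fo χ : Prop := (forall n, ~ fo_free1 n χ) /\ (forall n, ~ fo_free2 n χ).

Lemma closed_fo_fsat χ α e1 e2 e1' e2' : closed_fo χ ->
  fsat α e1 e2 χ -> fsat α e1' e2' χ.
Proof.
intros [H K] L; apply (fsat_agree α χ e1 e2); auto; intros n Hn;
[destruct (H n Hn)|destruct (K n Hn)].
Qed.

Lemma closed_fo_total_graph g κ : closed_fo (total (Par (graph g κ))).
Proof.
split; intros n Hn; [destruct (free1_total _ _ Hn)|].
apply free2_total in Hn; discriminate.
Qed.

(** * First-order reflection, regularity, and the reformulation of indescribability *)

Section Cardinal.
Variables (b : M -> M -> M -> M) (κ : M).
Hypotheses (hb : canonical_bijections b) (hκ : cardinal κ).

(** Coherence cannot be used here, since [χ] is what will force it. Any single branch of the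
    restricted formula ends in a leaf that contains [χ], so following one branch suffices.
    Definedness supplies the regularity of [κ] where a collapsed index set is met. *)
Lemma restr_andfo_fsat α χ : α ∈ κ -> empty ∈ α -> closed_fo χ ->
  (forall ζ p, Pi1 κ ζ p -> ζ ∈ cardsucc κ ->
     ζ ∈ κ \/ restr_defined b κ α (andfo χ p) -> forall e1 e2,
     sat α e1 e2 (restr b κ α (andfo χ p)) -> fsat α e1 e2 χ) /\
  (forall ζ p, Sigma1 κ ζ p -> ζ ∈ cardsucc κ ->
     ζ ∈ κ \/ restr_defined b κ α (andfo χ p) -> forall e1 e2,
     sat α e1 e2 (restr b κ α (andfo χ p)) -> fsat α e1 e2 χ).
Proof.
intros Hα Eα Hχ; assert (Oκ := proj1 hκ).
destruct (cardsucc_spec κ hκ) as [[Oκ' _] _].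
assert (D : forall ξ, succ ξ ∈ κ -> ξ ∈ κ)
  by (intros ξ H; exact (ordinal_trans _ _ _ Oκ H (mem_succ_self ξ))).
assert (D' : forall ξ, succ ξ ∈ cardsucc κ -> ξ ∈ cardsucc κ)
  by (intros ξ H; exact (ordinal_trans _ _ _ Oκ' H (mem_succ_self ξ))).
(* Only the range of the bijection is used: an inverse collapse lands in F^κ_ξ(α), hence below
   [ξ]. *)
assert (P : forall ξ ζ, limit ξ -> ξ ∈ cardsucc κ -> regular κ -> ~ ξ ∈ κ ->
  ζ ∈ canf b κ ξ α -> canpi_inv b κ ξ α ζ ∈ ξ).
{ intros ξ ζ L Hξ R N Hζ; destruct (cs_bij b κ hb R ξ Hξ N) as [B _].
  assert (E : exists η, η ∈ canF b κ ξ α /\ canpi b κ ξ α η = ζ)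
    by (unfold canf in Hζ; apply mem_ot in Hζ; destruct Hζ as [y [Hy ->]]; eauto).
  apply the_spec in E; destruct E as [E _].
  change (canpi_inv b κ ξ α ζ ∈ canF b κ ξ α) in E; revert E.
  unfold canF; destruct (excluded_middle_informative (ξ ∈ κ)); [tauto|].
  rewrite mem_img; intros [y [Hy ->]]; apply B; exact (ordinal_trans _ _ _ Oκ Hα Hy). }
apply (Pi1_Sigma1_ind M κ
  (fun ζ p => ζ ∈ cardsucc κ ->
     ζ ∈ κ \/ restr_defined b κ α (andfo χ p) -> forall e1 e2,
     sat α e1 e2 (restr b κ α (andfo χ p)) -> fsat α e1 e2 χ)
  (fun ζ p => ζ ∈ cardsucc κ ->
     ζ ∈ κ \/ restr_defined b κ α (andfo χ p) -> forall e1 e2,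
     sat α e1 e2 (restr b κ α (andfo χ p)) -> fsat α e1 e2 χ)).
- intros q _ _ _ e1 e2 H; apply H.
- intros ξ ks p _ _ IH Hξ; rewrite andfo_all2s, restr_all2s, restr_defined_all2s.
  intros K e1 e2 H.
  (* Instantiating the block with empty sets changes the assignment, which does not matter for the
     closed formula [χ]. *)
  assert (E : exists e2', sat α e1 e2' (restr b κ α (andfo χ p))).
  { revert e2 H; induction ks as [|k ks IHks]; simpl; eauto.
    intros e2 H; apply (IHks _ (H empty (subV_empty α))). }
  destruct E as [e2' E]; apply (closed_fo_fsat χ α e1 e2' e1 e2 Hχ).
  apply IH; auto; destruct K; auto.
- intros ξ ψ L Hψ IH _ Hξ K e1 e2; simpl.
  destruct (excluded_middle_informative (ξ ∈ κ)) as [B|B]; intros H.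
  + apply (IH empty); try (apply empty_mem; apply L).
    * apply (ordinal_trans _ _ _ Oκ' Hξ), empty_mem; apply L.
    * left; apply (ordinal_trans _ _ _ Oκ B), empty_mem; apply L.
    * apply H, empty_mem; apply L.
  + destruct K as [K|K]; [tauto|]; destruct (K B) as [R K'].
    (* The collapsed conjunction has a member: 0 lies in [α], so the image of 0 under the bijection
       lies in F^κ_ξ(α). *)
    assert (E : exists ζ, ζ ∈ canf b κ ξ α).
    { exists (canpi b κ ξ α (b κ ξ empty)); apply mem_ot.
      exists (b κ ξ empty); split; auto.
      unfold canF; destruct (excluded_middle_informative (ξ ∈ κ)); [tauto|].
      apply mem_img; eauto. }
    destruct E as [ζ Hζ]; destruct (K' ζ Hζ) as [K1 _].
    assert (Q := P ξ ζ L Hξ R B Hζ).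
    apply (IH (canpi_inv b κ ξ α ζ)); auto.
    exact (ordinal_trans _ _ _ Oκ' Hξ Q).
- intros q _ _ _ e1 e2 H; apply H.
- intros ξ ks p _ _ IH Hξ K e1 e2 H.
  assert (K' : ξ ∈ κ \/ restr_defined b κ α (andfo χ p)).
  { destruct K as [K|K]; auto; right; revert K; clear; rewrite andfo_ex2s.
    induction ks; simpl; auto. }
  assert (E : exists e2', sat α e1 e2' (restr b κ α (andfo χ p))).
  { clear K; revert e2 H; rewrite andfo_ex2s; induction ks as [|k ks IHks]; simpl; eauto.
    intros e2 [A [_ H]]; exact (IHks _ H). }
  destruct E as [e2' E]; apply (closed_fo_fsat χ α e1 e2' e1 e2 Hχ).
  apply IH; auto.
- intros ξ ψ L Hψ IH _ Hξ K e1 e2; simpl.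
  destruct (excluded_middle_informative (ξ ∈ κ)) as [B|B]; intros [ζ [Hζ H]].
  + apply (IH ζ); auto.
    * exact (ordinal_trans _ _ _ Oκ' Hξ Hζ).
    * left; exact (ordinal_trans _ _ _ Oκ B Hζ).
  + destruct K as [K|K]; [tauto|]; destruct (K B) as [R K'].
    destruct (K' ζ Hζ) as [K1 _].
    assert (Q := P ξ ζ L Hξ R B Hζ).
    apply (IH (canpi_inv b κ ξ α ζ)); auto.
    exact (ordinal_trans _ _ _ Oκ' Hξ Q).
Qed.

(** A tautology of level [ξ] carries [χ] at its leaves, so the first-order content reflects whatever
    [ξ] is, with no assumption of regularity on [κ]. *)
Lemma reflect_fo ξ S χ : ξ ∈ cardsucc κ -> S ⊆ κ -> indescribable_in b κ ξ S ->
  closed_fo χ -> fo_over κ χ -> (forall e1 e2, fo_sat κ e1 e2 χ) ->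
  exists α, α ∈ S /\ regular α /\ forall e1 e2, fsat α e1 e2 χ.
Proof.
intros Hξ HS H Cχ Oχ Tχ.
destruct (cardsucc_spec κ hκ) as [[Oκ' _] _].
destruct (taut_exists κ ξ (ordinal_mem _ _ Oκ' Hξ)) as [[p [Hp Tp]] _].
destruct (H (andfo χ p)) as [α [Hα [R [D [_ K]]]]].
- now apply Pi1_Sigma1_andfo.
- split; intros n Hn; [apply free1_andfo in Hn|apply free2_andfo in Hn];
  destruct Hn as [Hn|Hn]; revert Hn; try apply Cχ;
  [now apply taut_free1|now apply taut_free2].
- intros e1 e2; exact (proj1 (taut_sat_andfo κ χ Tχ) ξ p Hp Tp e1 e2).
- exists α; split; auto; split; auto; intros e1 e2.
  assert (Lα : limit α) by apply R.
  assert (Eα : empty ∈ α) by (apply empty_mem; apply Lα).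
  exact (proj1 (restr_andfo_fsat α χ (HS α Hα) Eα Cχ) ξ p Hp Hξ (or_intror D) e1 e2 (K e1 e2)).
Qed.

(** Adding one point to an infinite ordinal does not change its size, so an infinite cardinal is not
    a successor ordinal. *)
Lemma infinite_cardinal_limit α : α ∈ κ -> limit α -> limit κ.
Proof.
intros Hα L; destruct hκ as [O C].
destruct (ordinal_cases κ O) as [->|[[δ [Oδ E]]|K]]; auto;
  [destruct (mem_empty Hα)|exfalso].
assert (N : forall n, num n ∈ δ).
{ intros n; rewrite E in Hα; apply mem_succ in Hα; destruct Hα as [->|Hα].
  - now apply num_limit.
  - apply (ordinal_trans _ _ _ Oδ Hα); now apply num_limit. }
(* Hilbert's hotel: 0 goes to the extra point [δ], each positive natural number to its predecessor,
   and everything else stays. This maps [δ] bijectively onto its successor [κ]. *)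
set (f := fun x => if excluded_middle_informative (x = empty) then δ
  else if excluded_middle_informative (exists n, x = num (Datatypes.S n))
       then bigcup x else x).
assert (F : forall x, (x = empty /\ f x = δ) \/
  (exists n, x = num (Datatypes.S n) /\ f x = num n) \/
  ((forall n, x <> num n) /\ f x = x)).
{ intros x; unfold f; destruct (excluded_middle_informative (x = empty)); auto.
  destruct (excluded_middle_informative (exists n, x = num (Datatypes.S n))) as [[m ->]|K].
  - right; left; exists m; split; auto; apply bigcup_succ, ordinal_num.
  - right; right; split; auto; intros [|m]; [auto|]; intros ->; apply K; eauto. }
apply (C δ); [rewrite E; apply mem_succ_self|]; exists f; rewrite E.
assert (I := @mem_irrefl M δ); split; [|split].
- intros x Hx; apply mem_succ.
  destruct (F x) as [[_ ->]|[[n [_ ->]]|[_ ->]]]; auto.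
- intros x y Hx Hy Exy.
  destruct (F x) as [[Ex Fx]|[[n [Ex Fx]]|[Ex Fx]]],
    (F y) as [[Ey Fy]|[[m [Ey Fy]]|[Ey Fy]]]; rewrite Fx, Fy in Exy;
  try congruence.
  + exfalso; apply I; rewrite Exy at 1; auto.
  + exfalso; apply I; rewrite <- Exy at 1; auto.
  + apply num_inj in Exy; congruence.
- intros w Hw; apply mem_succ in Hw; destruct Hw as [->|Hw].
  + exists empty; split; [apply (N 0)|].
    destruct (F empty) as [[_ ->]|[[n [Ex _]]|[Ex _]]]; auto;
    [destruct (succ_not_empty _ (eq_sym Ex))|destruct (Ex 0 eq_refl)].
  + destruct (classic (exists n, w = num n)) as [[n ->]|K].
    * exists (num (Datatypes.S n)); split; auto.
      destruct (F (num (Datatypes.S n))) as [[Ex _]|[[m [Ex ->]]|[Ex _]]]; auto.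
      -- destruct (succ_not_empty _ Ex).
      -- apply num_inj in Ex; congruence.
      -- destruct (Ex _ eq_refl).
    * exists w; split; auto.
      destruct (F w) as [[Ex _]|[[m [Ex _]]|[_ ->]]]; auto;
      destruct K; [exists 0; auto|eauto].
Qed.

(** A point [α] at which V_α contains [β] and is closed under [f] bounds the values of [f] on [β].
    Closure under both is first-order, hence reflects. *)
Lemma indescribable_regular ξ : ξ ∈ cardsucc κ -> indescribable b κ ξ -> regular κ.
Proof.
intros Hξ H; assert (Oκ := proj1 hκ).
assert (L : limit κ).
(* Reflecting a triviality already produces a regular [α] below [κ], so [κ] is infinite. *)
{ destruct (reflect_fo ξ κ Top Hξ (fun _ h => h) H) as [α [Hα [R _]]].
  - split; intros n; simpl; intuition congruence.
  - split; simpl; intuition discriminate.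
  - intros e1 e2 a _; reflexivity.
  - apply (infinite_cardinal_limit α Hα), R. }
split; [auto|split; [auto|]]; intros β f Hβ Hf.
set (g := fun x => if excluded_middle_informative (x ∈ β) then f x else empty).
assert (Cg : closed_under g κ).
{ intros x _; unfold g; destruct (excluded_middle_informative (x ∈ β)) as [K|_].
  - apply inV_ordinal; eauto using ordinal_mem.
  - now apply inV_empty. }
assert (Cc : closed_under (fun _ => β) κ).
{ intros x _; apply inV_ordinal; eauto using ordinal_mem. }
set (χ := And (total (Par (graph g κ))) (total (Par (graph (fun _ => β) κ)))).
destruct (reflect_fo ξ κ χ Hξ (fun _ h => h) H) as [α [Hα [R K]]].
- destruct (closed_fo_total_graph g κ) as [A1 A2],
    (closed_fo_total_graph (fun _ => β) κ) as [B1 B2].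
  split; intros n [Hn|Hn]; [apply (A1 n)|apply (B1 n)|apply (A2 n)|apply (B2 n)]; exact Hn.
- destruct (fo_over_total_graph g κ), (fo_over_total_graph (fun _ => β) κ).
  split; intros n [Hn|Hn]; auto.
- intros e1 e2.
  assert (Q : fsat κ e1 e2 χ).
  { split; apply fsat_total_graph; auto. }
  unfold fsat in Q; rewrite fo_restr_self in Q; auto.
  destruct (fo_over_total_graph g κ), (fo_over_total_graph (fun _ => β) κ).
  split; intros n [Hn|Hn]; auto.
- assert (Lα : limit α) by apply R.
  assert (I : forall x, inV x α -> inV x κ)
    by (intros x; exact (inV_mono x κ α (proj1 Oκ) Hα)).
  set (e0 := fun _ : nat => @empty M).
  destruct (proj1 (fsat_And α e0 e0 _ _) (K e0 e0)) as [K1 K2].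
  apply (fsat_total_graph α κ e0 e0 g Lα L Cg I) in K1.
  apply (fsat_total_graph α κ e0 e0 _ Lα L Cc I) in K2.
  assert (Bα : β ∈ α).
  { apply inV_ordinal; [apply Lα|eauto using ordinal_mem|].
    exact (K2 empty (inV_empty _ Lα)). }
  exists α; split; auto; intros γ Hγ.
  apply inV_ordinal; [apply Lα|eauto using ordinal_mem|].
  specialize (K1 γ); unfold g in K1.
  destruct (excluded_middle_informative (γ ∈ β)); [apply K1|tauto].
  apply inV_ordinal; [apply Lα| |]; eauto using ordinal_mem, ordinal_trans.
Qed.

Hypothesis Rκ : regular κ.

Definition true_at α p : Prop := forall e1 e2, eval b κ α e1 e2 p.

Definition reflects ξ S : Prop :=
  forall p Q, Pi1 κ ξ p -> sentence p -> true_at κ p -> forced κ Q ->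
    exists α, α ∈ S /\ regular α /\ Q α /\ true_at α p.

(** The two directions differ in what makes the restriction legible. From indescribability,
    coherence has to be forced by a conjunct of the sentence; from reflection, coherence and
    definedness are requested as a forced property. *)
Lemma indescribable_reflects ξ S : ξ ∈ cardsucc κ -> S ⊆ κ ->
  (indescribable_in b κ ξ S <-> reflects ξ S).
Proof.
intros Hξ HS; split.
- intros H p Q Hp Sp Tp FQ.
  destruct (forced_and κ Rκ _ _ FQ (forced_coh b κ hb Rκ ξ Hξ)) as [g [Cg Hg]].
  set (χ := total (Par (graph g κ))).
  assert (Oχ : fo_over κ χ) by apply fo_over_total_graph.
  destruct (closed_fo_total_graph g κ) as [C1 C2].
  assert (Hp' : Pi1 κ ξ (andfo χ p)) by now apply Pi1_Sigma1_andfo.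
  assert (E : forall α, coh b κ α ξ -> forall e1 e2, eval b κ α e1 e2 (andfo χ p) <->
     eval b κ α e1 e2 p /\ fsat α e1 e2 χ).
  { intros α Cα; apply eval_andfo; [eapply ok_Pi1; eauto|].
    intros n _; apply C2. }
  destruct (H (andfo χ p)) as [α [Hα [R [D [_ K]]]]]; auto.
  + destruct Sp as [S1 S2]; split; intros n Hn;
    [apply free1_andfo in Hn|apply free2_andfo in Hn]; destruct Hn as [Hn|Hn];
    [apply (S1 n)|apply (C1 n)|apply (S2 n)|apply (C2 n)]; auto.
  + intros e1 e2; apply (sat_eval b κ hb Rκ ξ); auto; apply E; [now apply coh_top|].
    split; [apply Tp|]; apply fsat_total_graph; auto; apply limit_κ, Rκ.
  + assert (Lα : limit α) by apply R.
    assert (Pα : pt κ α) by (right; auto).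
    assert (Eα : empty ∈ α) by (apply empty_mem; apply Lα).
    (* Closure under [g] is extracted from the restricted sentence first. Coherence follows from it,
       and only then can the restriction be evaluated. *)
    assert (X := proj1 (restr_andfo_fsat α χ (HS α Hα) Eα (conj C1 C2)) ξ p Hp Hξ
      (or_intror D) (fun _ => empty) (fun _ => empty) (K _ _)).
    apply (fsat_total_graph α κ _ _ g Lα (limit_κ κ Rκ) Cg (fun x => pt_inV κ Rκ α x Pα)) in X.
    destruct (Hg α Pα X) as [Qα Cα].
    exists α; split; [|split; [|split]]; auto; intros e1 e2.
    apply (proj1 (E α Cα e1 e2)).
    apply restr_eval; auto; eapply ok_Pi1; eauto.
- intros H p Hp Sp Tp.
  destruct (H p (fun α => coh b κ α ξ /\ (α ∈ κ -> restr_defined b κ α p /\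
    Pi1 α (ot (G b κ α ξ)) (restr b κ α p)))) as [α [Hα [R [[C D] T]]]]; auto.
  + intros e1 e2; apply (sat_eval b κ hb Rκ ξ); auto; apply Tp.
  + apply forced_and; auto; [now apply forced_coh|now apply forced_restr].
  + destruct (D (HS α Hα)) as [D1 D2].
    exists α; do 3 (split; auto); split; [eauto|].
    intros e1 e2; apply restr_eval; auto; eapply ok_Pi1; eauto.
Qed.

End Cardinal.
End Reflection.

(** * Raising the level of a formula *)

Section Raising.
Context {M : zfc}.
Implicit Types (α β ζ η ξ μ a A S : M) (p : @form M) (q r χ : @fo M) (s t T : @term M).
Implicit Types (e : nat -> M) (n m : nat).
Variables (b : M -> M -> M -> M) (κ : M).
Hypotheses (hb : canonical_bijections b) (Rκ : regular κ).

Lemma Pi1_finitary2 ζ p : Pi1 κ ζ p -> finitary2 p.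
Proof.
revert ζ p; apply (Pi1_levels κ (fun _ p => finitary2 p)); auto.
- intros q _; split; [apply fo_free2_finite|apply fo_par2_finite].
- intros _ ks p _ _ IH; apply (proj1 (finitary2_neg p)) in IH.
  destruct IH as [[l H] [l' K]]; split; [exists l|exists l']; intros n Hn.
  + apply free2_all2s in Hn; apply H; tauto.
  + apply par2_all2s in Hn; auto.
Qed.

Lemma taut_eval α p : taut p -> ok b κ α p -> forall e1 e2, eval b κ α e1 e2 p.
Proof.
induction p as [q|n p IH|n p IH|ξ ψ IH|ξ ψ IH]; simpl; auto.
- intros -> _ e1 e2; apply fsat_Top.
- intros T Hok e1 e2; exists empty; split; [apply subV_empty|auto].
- intros T [L [_ [C Hok]]] e1 e2 η Hη; apply IH; auto.
  apply T; now apply mem_G in Hη.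
- intros T [L [_ [C Hok]]] e1 e2.
  assert (E : empty ∈ G b κ α ξ) by (apply C, empty_mem; apply L).
  exists empty; split; auto; apply IH; auto; apply T; now apply mem_G in E.
Qed.

(** [X] is a counterexample to [∀ X, ⋁ ...] when it is the singleton of the
    code of some [ν < ζ] for which [ψ ν] fails. *)
Definition raise_limit ζ (ψ : M -> form) η : form :=
  if excluded_middle_informative (η = empty) then
    Fo (All 0 (Imp (Ap (Var 0) (Var 0)) (Neg (Ap (Var 0) (Par (img (idx b κ ζ) ζ))))))
  else if excluded_middle_informative (exists μ, ordinal μ /\ η = succ μ) then
    andfo (Ap (Par (idx b κ ζ (bigcup η))) (Var 0)) (shift (ψ (bigcup η)))
  else andfo (Neg Top) (neg (shift (ψ η))).

Lemma raise_limit_cases ζ ψ η : ordinal η ->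
  (η = empty /\ raise_limit ζ ψ η =
    Fo (All 0 (Imp (Ap (Var 0) (Var 0)) (Neg (Ap (Var 0) (Par (img (idx b κ ζ) ζ))))))) \/
  (exists μ, ordinal μ /\ η = succ μ /\
    raise_limit ζ ψ η = andfo (Ap (Par (idx b κ ζ μ)) (Var 0)) (shift (ψ μ))) \/
  (η <> empty /\ (forall μ, η <> succ μ) /\
    raise_limit ζ ψ η = andfo (Neg Top) (neg (shift (ψ η)))).
Proof.
intros O; unfold raise_limit.
destruct (excluded_middle_informative (η = empty)) as [E|E]; [tauto|right].
destruct (excluded_middle_informative (exists μ, ordinal μ /\ η = succ μ)) as [[μ [Oμ ->]]|N].
- left; exists μ; rewrite bigcup_succ; auto.
- right; split; [auto|split; [|auto]]; intros μ ->; apply N; exists μ; split; auto.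
  apply (ordinal_mem _ _ O), mem_succ_self.
Qed.

Lemma sub_codes ζ : ζ ∈ cardsucc κ -> subV (img (idx b κ ζ) ζ) κ.
Proof.
intros Hζ x Hx; apply mem_img in Hx; destruct Hx as [η [Hη ->]]; now apply inV_idx.
Qed.

(** Each disjunct must have exactly its own Σ level. The case that no code is in X is first-order
    and sits at 0. The case of the code of [μ] sits at the successor of [μ], where [ψ μ] is Σ with
    an empty block. Limit places are filled with a false formula, built on the dual of [ψ η] to have
    the right level. *)
Lemma Sigma1_raise_limit ζ ψ η : ζ ∈ cardsucc κ -> limit ζ ->
  (forall η, η ∈ ζ -> Pi1 κ η (ψ η)) -> η ∈ ζ -> Sigma1 κ η (raise_limit ζ ψ η).
Proof.
intros Hζ L Hψ Hη; assert (O := ordinal_mem _ _ (proj1 L) Hη).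
destruct (raise_limit_cases ζ ψ η O) as [[-> ->]|[[μ [Oμ [-> ->]]]|[N [N' ->]]]].
- constructor; split; simpl; [intuition discriminate|].
  intros A [K|K]; [discriminate|injection K as <-]; now apply sub_codes.
- assert (Hμ : μ ∈ ζ)
    by exact (ordinal_trans _ _ _ (proj1 L) Hη (mem_succ_self μ)).
  apply (Sigma1_succ nil Oμ), Pi1_Sigma1_andfo; [|apply Pi1_Sigma1_shift; auto].
  split; simpl; [|discriminate].
  intros a [= <-]; now apply inV_idx.
- apply Pi1_Sigma1_andfo; [split; simpl; intuition discriminate|].
  apply Sigma1_neg, Pi1_Sigma1_shift; auto.
Qed.

(** Coherence keeps the useful places in the trace: 0 belongs to it, and [ν] belongs to it together
    with its successor, which carries the disjunct for [ν]. *)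
Lemma eval_raise_limit α ζ ψ e1 e2 : pt κ α -> ζ ∈ cardsucc κ -> limit ζ ->
  coh b κ α ζ -> (forall η, η ∈ ζ -> Pi1 κ η (ψ η)) ->
  (eval b κ α e1 e2 (All2 0 (Disj ζ (raise_limit ζ ψ))) <->
   eval b κ α e1 (fun n => e2 (S n)) (Conj ζ ψ)).
Proof.
intros Hα Hζ L C Hψ; simpl; assert (Oζ := proj1 L).
assert (Lα : limit α) by now apply (pt_limit κ).
assert (E : forall A μ, μ ∈ G b κ α ζ ->
  (eval b κ α e1 (upd e2 0 A) (andfo (Ap (Par (idx b κ ζ μ)) (Var 0)) (shift (ψ μ))) <->
   idx b κ ζ μ ∈ A /\ eval b κ α e1 (fun n => e2 (S n)) (ψ μ))).
{ intros A μ Hμ; assert (Hμ' := Hμ); apply mem_G in Hμ'; destruct Hμ' as [Hμ1 Hμ2].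
  rewrite eval_andfo.
  - rewrite eval_shift, fsat_Ap; simpl; [|apply inV_ordinal; auto; [apply Lα|]].
    + unfold upd at 2; simpl; tauto.
    + eapply ordinal_mem; [|exact Hμ2]; apply Lα.
  - apply (ok_Pi1 b κ Rκ α μ).
    + apply Pi1_Sigma1_shift; auto.
    + apply (cs_trans κ Rκ ζ); auto.
    + apply (coh_sub b κ α ζ); auto.
  - intros n Hn; apply bound2_shift in Hn; destruct Hn as [m ->]; simpl; congruence. }
split.
- intros H ν Hν; assert (Hν' := Hν); apply mem_G in Hν'; destruct Hν' as [Hν1 Hν2].
  (* For the singleton of the code of [ν], the disjunct at 0 fails and the limit places are false.
     Injectivity of codes leaves only the disjunct about [ψ ν]. *)
  set (A := pair (idx b κ ζ ν) (idx b κ ζ ν)).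
  assert (IA : forall x, x ∈ A <-> x = idx b κ ζ ν) by (intros x; unfold A; rewrite mem_pair; tauto).
  assert (Iν : inV (idx b κ ζ ν) α).
  { apply inV_ordinal; auto; [apply Lα|]; eapply ordinal_mem; [|exact Hν2]; apply Lα. }
  destruct (H A) as [η [Hη K]].
  { intros x Hx; apply IA in Hx; now subst. }
  assert (Hη' := Hη); apply mem_G in Hη'; destruct Hη' as [Hη1 Hη2].
  destruct (raise_limit_cases ζ ψ η (ordinal_mem _ _ Oζ Hη1))
    as [[-> R]|[[μ [Oμ [-> R]]]|[N [N' R]]]]; rewrite R in K.
  + exfalso; simpl in K; rewrite fsat_All in K; specialize (K _ Iν).
    rewrite fsat_Imp, fsat_Neg, !fsat_Ap in K by (simpl; rewrite upd_eq; auto).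
    simpl in K; rewrite !upd_eq in K; apply K; [now apply IA|].
    apply mem_img; eauto.
  + assert (Hμ : μ ∈ G b κ α ζ) by exact (proj1 (proj2 (proj2 C)) μ Hη).
    apply E in K; auto; destruct K as [K1 K2]; apply IA in K1.
    apply (idx_inj b κ hb Rκ) in K1; auto; [now subst|now apply mem_G in Hμ].
  + exfalso; rewrite eval_andfo in K.
    * destruct K as [_ K]; apply fsat_Neg in K; apply K, fsat_Top.
    * apply ok_neg, (ok_Pi1 b κ Rκ α η).
      -- apply Pi1_Sigma1_shift; auto.
      -- apply (cs_trans κ Rκ ζ); auto.
      -- apply (coh_sub b κ α ζ); auto.
    * simpl; tauto.
- intros H A HA.
  (* If the set contains the code of some [ν] in the trace, the place after [ν] is a true disjunct;
     otherwise the place 0 is. *)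
  destruct (classic (exists ν, ν ∈ G b κ α ζ /\ idx b κ ζ ν ∈ A)) as [[ν [Hν K]]|N].
  + assert (Hν' := Hν); apply mem_G in Hν'; destruct Hν' as [Hν1 Hν2].
    assert (Hs : succ ν ∈ ζ) by now apply L.
    exists (succ ν); split; [now apply (proj1 (proj2 C) ν Hν)|].
    destruct (raise_limit_cases ζ ψ (succ ν) (ordinal_mem _ _ Oζ Hs))
      as [[E0 _]|[[μ [Oμ [E0 R]]]|[_ [N' _]]]].
    * destruct (succ_not_empty _ E0).
    * apply succ_inj in E0; subst μ; rewrite R; apply E; auto.
    * destruct (N' ν eq_refl).
  + exists empty; split; [apply (proj2 (proj2 (proj2 (proj2 C)))), empty_mem; apply L|].
    destruct (raise_limit_cases ζ ψ empty ordinal_empty)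
      as [[_ R]|[[μ [_ [E0 _]]]|[N' _]]]; [rewrite R|destruct (succ_not_empty _ (eq_sym E0))|tauto].
    simpl; rewrite fsat_All; intros x Hx.
    rewrite fsat_Imp, fsat_Neg, !fsat_Ap by (simpl; rewrite upd_eq; auto).
    simpl; rewrite !upd_eq; intros K1 K2; apply mem_img in K2.
    destruct K2 as [ν [Hν ->]]; apply N; exists ν; split; auto; apply mem_G; split; auto.
    apply (pt_inV_mem κ Rκ α); auto; now apply idx_mem.
Qed.

(** The set quantifier needed at a limit is added in front of the limit conjunction, deep inside the
    formula, and the outer blocks are copied with alternating negations. All second-order variables
    shift to keep number 0 free for it. *)
Lemma raise_succ ζ p : Pi1 κ ζ p -> succ ζ ∈ cardsucc κ ->
  exists q : form, Pi1 κ (succ ζ) q /\ (forall n, free1 n q -> free1 n p) /\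
    (forall n, free2 n q -> exists m, n = S m /\ free2 m p) /\
    forced κ (fun α => forall e1 e2,
      eval b κ α e1 e2 q <-> eval b κ α e1 (fun n => e2 (S n)) p).
Proof.
intros H; revert ζ p H.
apply (Pi1_levels κ (fun ζ p => succ ζ ∈ cardsucc κ ->
  exists q : form, Pi1 κ (succ ζ) q /\ (forall n, free1 n q -> free1 n p) /\
    (forall n, free2 n q -> exists m, n = S m /\ free2 m p) /\
    forced κ (fun α => forall e1 e2,
      eval b κ α e1 e2 q <-> eval b κ α e1 (fun n => e2 (S n)) p))).
- intros q Hq _; exists (Fo (fo_shift q)); split; [|split; [|split]].
  + apply (Pi1_succ nil ordinal_empty).
    exact (proj2 (Pi1_Sigma1_shift κ) _ _ (Sigma1_0 Hq)).
  + intros n Hn; exact (proj1 (fo_free1_shift n q) Hn).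
  + intros n Hn; exact (fo_free2_shift n q Hn).
  + apply forced_true; intros α _ e1 e2; apply fsat_shift.
- intros ζ ks p O Hp IH Hζ.
  destruct IH as [q [Hq [F1 [F2 E]]]]; [apply (cs_trans κ Rκ (succ (succ ζ))); auto using mem_succ_self|].
  exists (all2s (map S ks) (neg q)); split; [|split; [|split]].
  + constructor; auto using ordinal_succ; now apply Sigma1_neg.
  + intros n; rewrite !free1_all2s, free1_neg; intros Hn; apply F1 in Hn.
    exact (proj1 (free1_neg n p) Hn).
  + intros n; rewrite free2_all2s, free2_neg; intros [N Hn]; apply F2 in Hn.
    destruct Hn as [m [-> Hm]]; exists m; split; auto.
    rewrite free2_all2s; apply (proj1 (free2_neg m p)) in Hm; split; auto.
    intros K; apply N, in_map, K.
  + eapply forced_imp; [exact E|]; intros α _ K.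
    assert (K' : forall e1 e2, eval b κ α e1 e2 (neg q) <->
       eval b κ α e1 (fun n => e2 (S n)) p).
    { intros e1 e2; specialize (K e1 e2); rewrite eval_neg in *.
      destruct (classic (eval b κ α e1 (fun n => e2 (S n)) p)); tauto. }
    induction ks as [|k ks IHks]; auto; intros e1 e2; simpl.
    split; intros L A HA.
    * rewrite <- upd_shift; apply IHks, L, HA.
    * apply IHks; rewrite upd_shift; apply L, HA.
- intros ζ ψ L Hψ _ F Hζ.
  assert (Hζ' : ζ ∈ cardsucc κ) by (apply (cs_trans κ Rκ (succ ζ)); auto using mem_succ_self).
  assert (F1 : forall n η, η ∈ ζ -> free1 n (raise_limit ζ ψ η) ->
     exists ζ', ζ' ∈ ζ /\ free1 n (ψ ζ')).
  { intros n η Hη; destruct (raise_limit_cases ζ ψ η (ordinal_mem _ _ (proj1 L) Hη))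
      as [[-> ->]|[[μ [Oμ [-> ->]]]|[N [N' ->]]]].
    - simpl; intuition congruence.
    - intros K; apply free1_andfo in K; destruct K as [K|K]; [|simpl in K; congruence].
      exists μ; split; [|now apply free1_shift].
      exact (ordinal_trans _ _ _ (proj1 L) Hη (mem_succ_self μ)).
    - intros K; apply free1_andfo in K; destruct K as [K|K]; [|simpl in K; intuition congruence].
      exists η; split; auto; apply (proj1 (free1_neg n _)) in K; now apply free1_shift. }
  assert (F2 : forall n η, η ∈ ζ -> free2 n (raise_limit ζ ψ η) ->
     n = 0 \/ exists m, n = S m /\ exists ζ', ζ' ∈ ζ /\ free2 m (ψ ζ')).
  { intros n η Hη; destruct (raise_limit_cases ζ ψ η (ordinal_mem _ _ (proj1 L) Hη))
      as [[-> ->]|[[μ [Oμ [-> ->]]]|[N [N' ->]]]].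
    - simpl; intuition congruence.
    - intros K; apply free2_andfo in K; destruct K as [K|K]; [|simpl in K; left; congruence].
      apply free2_shift in K; destruct K as [m [-> K]].
      right; exists m; split; auto; exists μ; split; auto.
      exact (ordinal_trans _ _ _ (proj1 L) Hη (mem_succ_self μ)).
    - intros K; apply free2_andfo in K; destruct K as [K|K]; [|simpl in K; tauto].
      apply (proj1 (free2_neg n _)), free2_shift in K; destruct K as [m [-> K]].
      right; exists m; split; eauto. }
  assert (F3 : forall A η, η ∈ ζ -> par2 A (raise_limit ζ ψ η) ->
     A = img (idx b κ ζ) ζ \/ exists ζ', ζ' ∈ ζ /\ par2 A (ψ ζ')).
  { intros A η Hη; destruct (raise_limit_cases ζ ψ η (ordinal_mem _ _ (proj1 L) Hη))
      as [[-> ->]|[[μ [Oμ [-> ->]]]|[N [N' ->]]]].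
    - simpl; intuition congruence.
    - intros K; apply par2_andfo in K; destruct K as [K|K]; [|discriminate].
      apply par2_shift in K; right; exists μ; split; auto.
      exact (ordinal_trans _ _ _ (proj1 L) Hη (mem_succ_self μ)).
    - intros K; apply par2_andfo in K; destruct K as [K|K]; [|simpl in K; tauto].
      apply (proj1 (par2_neg A _)), par2_shift in K; eauto. }
  exists (All2 0 (Disj ζ (raise_limit ζ ψ))); split; [|split; [|split]].
  + apply (Pi1_succ [0] (proj1 L)); constructor; auto.
    * intros η Hη; apply Sigma1_raise_limit; auto.
    * destruct F as [[l Hl] [l' Hl']]; split.
      -- exists (0 :: map S l); intros n [η [Hη K]]; apply F2 in K; auto.
         destruct K as [->|[m [-> K]]]; [left; auto|right; apply in_map; auto].
      -- exists (img (idx b κ ζ) ζ :: l'); intros A [η [Hη K]]; apply F3 in K; auto.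
         destruct K as [->|K]; [left; auto|right; auto].
  + intros n [η [Hη K]]; exact (F1 n η Hη K).
  + intros n [N [η [Hη K]]]; apply F2 in K; auto.
    destruct K as [->|K]; [destruct (N eq_refl)|exact K].
  + eapply forced_imp; [apply (forced_coh b κ hb Rκ ζ Hζ')|].
    intros α Hα C e1 e2; apply eval_raise_limit; auto.
Qed.

(** Successor levels repeat the one-step raising. At a limit [ξ] the formula is placed as the
    conjunct at its own level among tautologies. *)
Lemma raise ξ : ξ ∈ cardsucc κ -> forall ζ p, ζ ∈ ξ -> Pi1 κ ζ p -> sentence p ->
  exists q : form, Pi1 κ ξ q /\ sentence q /\
    forced κ (fun α => true_at b κ α q <-> true_at b κ α p).
Proof.
induction ξ as [ξ IH] using mem_ind; intros Hξ ζ p Hζ Hp Sp.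
destruct (ordinal_cases ξ (cs_ordinal κ Rκ ξ Hξ)) as [->|[[η [Oη ->]]|L]].
- destruct (mem_empty Hζ).
- assert (E : exists r : form, Pi1 κ η r /\ sentence r /\
     forced κ (fun α => true_at b κ α r <-> true_at b κ α p)).
  { apply mem_succ in Hζ; destruct Hζ as [->|Hζ].
    - exists p; split; [auto|split; [auto|]]; apply forced_true; tauto.
    - apply (IH η) with (ζ := ζ); auto using mem_succ_self.
      apply (cs_trans κ Rκ (succ η)); auto using mem_succ_self. }
  destruct E as [r [Hr [[S1 S2] Er]]].
  destruct (raise_succ η r Hr Hξ) as [q [Hq [F1 [F2 E]]]].
  exists q; split; [auto|split].
  + split; intros n Hn; [apply (S1 n); auto|].
    destruct (F2 n Hn) as [m [_ Hm]]; exact (S2 m Hm).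
  + eapply forced_imp; [exact (forced_and κ Rκ _ _ E Er)|].
    intros α _ [K K']; rewrite <- K'; split; intros H e1 e2.
    * apply (eval_sentence b κ α r e1 (fun n => e2 n) e1 (fun n => e2 n)); [split; auto|].
      (* The dummy value at 0 cancels the shift of the variables. *)
      specialize (H e1 (fun n => match n with 0 => empty | S n => e2 n end)).
      apply K in H; exact H.
    * apply K, H.
- destruct (choice_on M form (Fo Top) (fun η => η ∈ ξ)
    (fun η p => Pi1 κ η p /\ taut p)) as [T HT].
  { intros η Hη; apply taut_exists, (ordinal_mem ξ); auto; apply L. }
  set (ψ := fun η => if excluded_middle_informative (η = ζ) then p else T η).
  assert (Eψ : forall η, (η = ζ /\ ψ η = p) \/ ψ η = T η)
    by (intros η; unfold ψ; destruct (excluded_middle_informative (η = ζ)); auto).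
  assert (F : sentence (Conj ξ ψ)).
  { destruct Sp as [S1 S2]; split; intros n [η [Hη K]];
    destruct (Eψ η) as [[_ E]|E]; rewrite E in K;
    [exact (S1 n K)|exact (taut_free1 n _ (proj2 (HT η Hη)) K)
    |exact (S2 n K)|exact (taut_free2 n _ (proj2 (HT η Hη)) K)]. }
  assert (Hψ : forall η, η ∈ ξ -> Pi1 κ η (ψ η)).
  { intros η Hη; destruct (Eψ η) as [[-> E]|E]; rewrite E; auto; now apply HT. }
  exists (Conj ξ ψ); split; [constructor; auto|split; [auto|]].
  + destruct (Pi1_finitary2 ζ p Hp) as [_ [l Hl]]; split.
    * exists nil; intros n Hn; destruct (proj2 F n Hn).
    * exists l; intros A [η [Hη K]]; destruct (Eψ η) as [[_ E]|E]; rewrite E in K; auto.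
      destruct (taut_par2 A _ (proj2 (HT η Hη)) K).
  + eapply forced_imp; [apply (forced_and κ Rκ); [apply (forced_coh b κ hb Rκ ξ Hξ)|]|].
    (* With the code of [ζ] in [α], the one conjunct that matters survives in the trace. *)
    * exact (forced_mem κ Rκ _ (idx_mem b κ hb Rκ ξ ζ Hξ Hζ)).
    * intros α Hα [C K].
      assert (Gζ : ζ ∈ G b κ α ξ) by now apply mem_G.
      split; intros H e1 e2.
      -- specialize (H e1 e2 ζ Gζ); unfold ψ in H.
         destruct (excluded_middle_informative (ζ = ζ)); tauto.
      -- intros η Hη; assert (Hη' := proj1 (proj1 (mem_G b κ α ξ η) Hη)).
         destruct (Eψ η) as [[_ E]|E]; rewrite E; [apply H|].
         apply taut_eval; [now apply HT|].
         apply (ok_Pi1 b κ Rκ α η); [now apply HT| |].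
         ++ apply (cs_trans κ Rκ ξ); auto.
         ++ apply (coh_sub b κ α ξ); auto; apply L.
Qed.

Lemma reflects_mono ζ ξ S : ξ ∈ cardsucc κ -> ζ ∈ ξ ->
  reflects b κ ξ S -> reflects b κ ζ S.
Proof.
intros Hξ Hζ H p Q Hp Sp Tp FQ.
destruct (raise ξ Hξ ζ p Hζ Hp Sp) as [q [Hq [Sq E]]].
assert (Tq : true_at b κ κ q) by (apply (forced_top κ _ E), Tp).
destruct (H q (fun α => Q α /\ (true_at b κ α q <-> true_at b κ α p))) as [α [Hα [R [[K1 K2] K3]]]]; auto.
- now apply forced_and.
- exists α; tauto.
Qed.

End Raising.

(** * First-order truth *)

Section Truth.
Context {M : zfc}.
Implicit Types (α a A x y z tag : M) (q r : @fo M) (s t T : @term M).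
Implicit Types (e Y : nat -> M) (n m j d : nat) (l : list (nat * M)).

(** * Codes of formulas and assignments, and truth predicates for them *)

Definition cterm t : M :=
  match t with Var n => op (num 0) (num n) | Par a => op (num 1) a end.

Fixpoint cfo q : M :=
  match q with
  | Eq s t => op (num 0) (op (cterm s) (cterm t))
  | In s t => op (num 1) (op (cterm s) (cterm t))
  | Ap s t => op (num 2) (op (cterm s) (cterm t))
  | Neg q => op (num 3) (cfo q)
  | And q r => op (num 4) (op (cfo q) (cfo r))
  | All n q => op (num 5) (op (num n) (cfo q))
  end.

Lemma cterm_inj s t : cterm s = cterm t -> s = t.
Proof.
destruct s, t; unfold cterm; intros E; apply op_inj in E; destruct E as [E1 E2];
apply num_inj in E1; try discriminate.
- apply num_inj in E2; congruence.
- congruence.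
Qed.

Lemma cfo_inj q r : cfo q = cfo r -> q = r.
Proof.
revert r; induction q as [s t|s t|s t|q IH|q IH q' IH'|n q IH];
intros [s2 t2|s2 t2|s2 t2|r|r r'|m r]; unfold cfo; fold cfo; intros E;
apply op_inj in E; destruct E as [E1 E2]; apply num_inj in E1; try discriminate;
try (f_equal; auto; fail); apply op_inj in E2; destruct E2 as [E2 E3];
f_equal; first [now apply cterm_inj|now apply (num_inj (M:=M))|now apply IH|now apply IH'].
Qed.

Fixpoint cl l : M :=
  match l with
  | nil => empty
  | (n, a) :: l => op (op (num n) a) (cl l)
  end.

Lemma cl_inj l l' : cl l = cl l' -> l = l'.
Proof.
revert l'; induction l as [|[n a] l IH]; intros [|[n' a'] l'] E; auto; simpl in E.
- destruct (op_not_empty _ _ (eq_sym E)).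
- destruct (op_not_empty _ _ E).
- apply op_inj in E; destruct E as [E E']; apply op_inj in E; destruct E as [E1 E2].
  apply num_inj in E1; subst; f_equal; auto.
Qed.

Fixpoint lookup l : nat -> M :=
  match l with nil => fun _ => empty | (n, a) :: l => upd (lookup l) n a end.

Definition node q l : M := op (cfo q) (cl l).

Lemma node_inj q l r l' : node q l = node r l' -> q = r /\ l = l'.
Proof.
intros E; apply op_inj in E; destruct E; split; auto using cfo_inj, cl_inj.
Qed.

(** The second-order atoms of the formulas that are coded have the form
    [Ap t (Par (op (num j) tag))], for [op tag t ∈ Y j]. *)
Fixpoint isat α Y e q : Prop :=
  match q with
  | Eq s t => val e s = val e t
  | In s t => val e s ∈ val e t
  | Ap t T => exists j tag, T = Par (op (num j) tag) /\ op tag (val e t) ∈ Y j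
  | Neg q => ~ isat α Y e q
  | And q r => isat α Y e q /\ isat α Y e r
  | All n q => forall a, inV a α -> isat α Y (upd e n a) q
  end.

(** The edges of the evaluation tree. A universally quantified formula has one child for each value,
    recorded by extending the assignment; conjunctions and universal quantifiers can thus share one
    clause, that all children are true. *)
Definition sub_node x y : Prop :=
  (exists q l, x = node (Neg q) l /\ y = node q l) \/
  (exists q r l, x = node (And q r) l /\ (y = node q l \/ y = node r l)) \/
  (exists n q l a, x = node (All n q) l /\ y = node q ((n, a) :: l)).
Definition conj_node x : Prop :=
  (exists q r l, x = node (And q r) l) \/ (exists n q l, x = node (All n q) l).
Definition neg_node x : Prop := exists q l, x = node (Neg q) l.
Definition true_node x : Prop := exists s t l,
  (x = node (Eq s t) l /\ val (lookup l) s = val (lookup l) t) \/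
  (x = node (In s t) l /\ val (lookup l) s ∈ val (lookup l) t).
Definition false_node x : Prop := exists s t l,
  (x = node (Eq s t) l /\ val (lookup l) s <> val (lookup l) t) \/
  (x = node (In s t) l /\ ~ val (lookup l) s ∈ val (lookup l) t).
Definition ap_node x y : Prop := exists t j tag l,
  x = node (Ap t (Par (op (num j) tag))) l /\
  y = op (num j) (op tag (val (lookup l) t)).

(** Tarski's clauses as local conditions on [S]. Only the variables below [d] are interpreted, since
    [S] itself will be the value of variable [d]. *)
Definition tarski α (S : M) Y d : Prop := forall x, inV x α ->
  (true_node x -> x ∈ S) /\ (false_node x -> ~ x ∈ S) /\
  (conj_node x -> (x ∈ S <-> forall y, inV y α -> sub_node x y -> y ∈ S)) /\
  (neg_node x -> (x ∈ S <-> forall y, inV y α -> sub_node x y -> ~ y ∈ S)) /\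
  (forall j z, j < d -> inV z α -> ap_node x (op (num j) z) -> (x ∈ S <-> z ∈ Y j)).

Definition term_in α t : Prop := forall a, t = Par a -> inV a α.

Fixpoint coded α d q : Prop :=
  match q with
  | Eq s t | In s t => term_in α s /\ term_in α t
  | Ap t T => term_in α t /\
      exists j tag, T = Par (op (num j) tag) /\ j < d /\ inV tag α
  | Neg q | All _ q => coded α d q
  | And q r => coded α d q /\ coded α d r
  end.

Definition list_in α l : Prop := forall n a, List.In (n, a) l -> inV a α.

Lemma inV_cterm α t : limit α -> term_in α t -> inV (cterm t) α.
Proof. intros L H; destruct t; unfold cterm; auto using inV_op, inV_num. Qed.

Lemma inV_cfo α d q : limit α -> coded α d q -> inV (cfo q) α.
Proof.
intros L; induction q as [s t|s t|s T|q IH|q IH q' IH'|n q IH]; cbn [cfo coded]; intros H;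
repeat (apply inV_op; auto using inV_num); try (apply inV_cterm; tauto); try tauto.
- destruct H as [_ [j [tag [-> [_ H]]]]]; apply inV_cterm; auto.
  intros a [= <-]; auto using inV_op, inV_num.
Qed.

Lemma inV_cl α l : limit α -> list_in α l -> inV (cl l) α.
Proof.
intros L; induction l as [|[n a] l IH]; simpl; intros H; [now apply inV_empty|].
apply inV_op; auto; [apply inV_op; auto using inV_num|apply IH].
- apply (H n); simpl; auto.
- intros m c Hc; apply (H m); simpl; auto.
Qed.

Lemma inV_lookup α l n : limit α -> list_in α l -> inV (lookup l n) α.
Proof.
intros L; induction l as [|[m a] l IH]; simpl; intros H; [now apply inV_empty|].
unfold upd; destruct (Nat.eq_dec n m); [apply (H m); simpl; auto|apply IH].
intros k c Hc; apply (H k); simpl; auto.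
Qed.

Lemma inV_val α e t : term_in α t -> (forall n, inV (e n) α) -> inV (val e t) α.
Proof. destruct t; simpl; auto. Qed.

Lemma inV_node α d q l : limit α -> coded α d q -> list_in α l -> inV (node q l) α.
Proof. intros; apply inV_op; eauto using inV_cfo, inV_cl. Qed.

(** The clauses determine [S] by induction on the formula. All children needed have codes in V_α,
    because codes are finite trees of pairs over V_α and [α] is a limit. *)
Lemma tarski_isat α S Y d : limit α -> tarski α S Y d -> forall q l,
  coded α d q -> list_in α l -> (node q l ∈ S <-> isat α Y (lookup l) q).
Proof.
intros L H q; induction q as [s t|s t|t T|q IH|q IH r IH'|n q IH]; simpl;
intros l Hq Hl;
match goal with |- node ?q l ∈ S <-> _ =>
  assert (Hn : inV (node q l) α) by exact (inV_node α d q l L Hq Hl) end;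
destruct (H _ Hn) as [H1 [H2 [H3 [H4 H5]]]].
- destruct (classic (val (lookup l) s = val (lookup l) t)) as [E|E];
    (split; [intros K|intros K]); try tauto.
  + apply H1; exists s, t, l; auto.
  + exfalso; apply H2; [exists s, t, l; auto|exact K].
- destruct (classic (val (lookup l) s ∈ val (lookup l) t)) as [E|E];
    (split; [intros K|intros K]); try tauto.
  + apply H1; exists s, t, l; auto.
  + exfalso; apply H2; [exists s, t, l; auto|exact K].
- destruct Hq as [Ht [j [tag [-> [Hj Htag]]]]].
  assert (V : inV (val (lookup l) t) α)
    by (apply inV_val; auto; intros; apply inV_lookup; auto).
  rewrite (H5 j (op tag (val (lookup l) t)) Hj).
  + split; [eauto|].
    intros [j' [tag' [E K]]]; injection E as E; apply op_inj in E; destruct E as [E ->].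
    apply num_inj in E; now subst.
  + now apply inV_op.
  + exists t, j, tag, l; auto.
- rewrite H4 by (exists q, l; auto); rewrite <- (IH l Hq Hl); split.
  + intros K; apply K; [exact (inV_node α d q l L Hq Hl)|left; eauto].
  + intros K y Hy [[q' [l' [E ->]]]|[[q' [r' [l' [E _]]]]|[n' [q' [l' [a [E _]]]]]]];
    apply node_inj in E; destruct E as [E ->]; try discriminate.
    injection E as ->; auto.
- destruct Hq as [Hq Hr].
  rewrite H3 by (left; eauto); rewrite <- (IH l Hq Hl), <- (IH' l Hr Hl); split.
  + intros K; split; apply K; try (eapply inV_node; eauto; fail); right; left; eauto 7.
  + intros [K K'] y Hy [[q' [l' [E ->]]]|[[q' [r' [l' [E E']]]]|[n' [q' [l' [a [E _]]]]]]];
    apply node_inj in E; destruct E as [E ->]; try discriminate.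
    injection E as -> ->; destruct E' as [->| ->]; auto.
- rewrite H3 by (right; eauto).
  assert (Hl' : forall a, inV a α -> list_in α ((n, a) :: l)).
  { intros a Ha m c [E|E]; [congruence|eapply Hl; eauto]. }
  split.
  + intros K a Ha; apply (IH ((n, a) :: l)); auto; apply K.
    * eapply inV_node; eauto.
    * right; right; exists n, q, l, a; auto.
  + intros K y Hy [[q' [l' [E ->]]]|[[q' [r' [l' [E E']]]]|[n' [q' [l' [a [E E']]]]]]];
    apply node_inj in E; destruct E as [E ->]; try discriminate.
    injection E as -> ->; subst y.
    assert (Ha : inV a α).
    { assert (O := proj1 (proj1 L)); apply (inV_op_inv _ _ _ O) in Hy; destruct Hy as [_ Hy].
      simpl in Hy; apply (inV_op_inv _ _ _ O) in Hy; destruct Hy as [Hy _].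
      now apply (inV_op_inv _ _ _ O) in Hy. }
    apply (IH ((n', a) :: l')); auto; now apply K.
Qed.

(** True nodes are collected by the external truth definition. For nodes that do not come from
    [coded] formulas, a child is placed in V_α by taking the code of its parent apart. *)
Lemma tarski_exists α Y d : limit α -> exists S, subV S α /\ tarski α S Y d.
Proof.
intros L; set (S := sep (Vset α) (fun x => exists q l, x = node q l /\
  isat α Y (lookup l) q)).
assert (O := proj1 (proj1 L)).
assert (HS : forall q l, inV (node q l) α -> (node q l ∈ S <-> isat α Y (lookup l) q)).
{ intros q l H; unfold S; rewrite mem_sep, mem_Vset; split; [|eauto].
  intros [_ [r [l' [E K]]]]; apply node_inj in E; destruct E; now subst. }
exists S; split; [apply subV_sep; intros x; apply mem_Vset|].
intros x Hx; split; [|split; [|split; [|split]]].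
- intros [s [t [l [[-> E]|[-> E]]]]]; now apply HS.
- intros [s [t [l [[-> E]|[-> E]]]]] K; apply HS in K; auto.
- intros [[q [r [l ->]]]|[n [q [l ->]]]]; rewrite HS by auto; simpl.
  + assert (I : inV (node q l) α /\ inV (node r l) α).
    { destruct (inV_op_inv _ _ _ O Hx) as [I1 I2]; simpl in I1.
      destruct (inV_op_inv _ _ _ O I1) as [_ I3].
      destruct (inV_op_inv _ _ _ O I3); split; now apply inV_op. }
    destruct I as [I1 I2]; rewrite <- !HS by auto; split.
    * intros [K K'] y Hy [[q' [l' [E ->]]]|[[q' [r' [l' [E E']]]]|[n' [q' [l' [a [E _]]]]]]];
      apply node_inj in E; destruct E as [E ->]; try discriminate.
      injection E as -> ->; destruct E' as [->| ->]; auto.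
    * intros K; split; apply K; auto; right; left; eauto 7.
  + assert (I : forall a, inV (node q ((n, a) :: l)) α <-> inV a α).
    { intros a; destruct (inV_op_inv _ _ _ O Hx) as [I1 I2]; simpl in I1.
      destruct (inV_op_inv _ _ _ O I1) as [_ I3].
      destruct (inV_op_inv _ _ _ O I3) as [I4 I5]; split; intros Q.
      - destruct (inV_op_inv _ _ _ O Q) as [_ Q1]; simpl in Q1.
        destruct (inV_op_inv _ _ _ O Q1) as [Q2 _].
        now apply (inV_op_inv _ _ _ O) in Q2.
      - apply inV_op; auto; simpl; auto using inV_op. }
    split.
    * intros K y Hy [[q' [l' [E ->]]]|[[q' [r' [l' [E E']]]]|[n' [q' [l' [a [E E']]]]]]];
      apply node_inj in E; destruct E as [E ->]; try discriminate.
      injection E as -> ->; subst y; apply HS; auto; apply K, I, Hy.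
    * intros K a Ha; apply (HS q ((n, a) :: l)); [now apply I|].
      apply K; [now apply I|]; right; right; exists n, q, l, a; auto.
- intros [q [l ->]]; rewrite HS by auto; simpl.
  assert (I : inV (node q l) α).
  { destruct (inV_op_inv _ _ _ O Hx) as [I1 I2]; simpl in I1.
    destruct (inV_op_inv _ _ _ O I1) as [_ I3]; now apply inV_op. }
  rewrite <- HS by auto; split.
  + intros K y Hy [[q' [l' [E ->]]]|[[q' [r' [l' [E _]]]]|[n' [q' [l' [a [E _]]]]]]];
    apply node_inj in E; destruct E as [E ->]; try discriminate.
    injection E as ->; auto.
  + intros K; apply K; auto; left; eauto.
- intros j z Hj Hz [t [j' [tag [l [-> E]]]]]; rewrite HS by auto; simpl.
  apply op_inj in E; destruct E as [E ->]; apply num_inj in E; subst j'.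
  split; [|eauto].
  intros [j' [tag' [E K]]]; injection E as E; apply op_inj in E; destruct E as [E ->].
  apply num_inj in E; now subst.
Qed.

(** Each second-order term is replaced by its address: a variable number together with the tag of a
    section of that variable. The result is small enough to have a code in V_α, whereas its
    second-order parameters were not. *)
Fixpoint compile (τ : @term M -> M) q : @fo M :=
  match q with
  | Ap t T => Ap t (Par (τ T))
  | Neg q => Neg (compile τ q)
  | And q r => And (compile τ q) (compile τ r)
  | All n q => All n (compile τ q)
  | q => q
  end.

Lemma isat_compile α Y e2 τ q :
  (forall a, fo_par1 a q -> inV a α) ->
  (forall T v, (exists n, T = Var n /\ fo_free2 n q) \/ (exists A, T = Par A /\ fo_par2 A q) ->
     inV v α ->
     (v ∈ val e2 T <-> exists j tag, τ T = op (num j) tag /\ op tag v ∈ Y j)) ->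
  forall e1, (forall n, inV (e1 n) α) ->
  (isat α Y e1 (compile τ q) <-> fsat α e1 e2 q).
Proof.
induction q as [s t|s t|t T|q IH|q IH r IH'|n q IH]; intros H K e1 He.
- reflexivity.
- reflexivity.
- assert (V : inV (val e1 t) α) by (apply inV_val; auto; intros a ->; apply H; reflexivity).
  rewrite fsat_Ap, (K T) by (auto; destruct T; simpl; eauto); simpl.
  split; intros [j [tag [E Q]]]; exists j, tag; split; auto; congruence.
- simpl; rewrite fsat_Neg, IH; auto; tauto.
- simpl; rewrite fsat_And, IH, IH'; auto; try tauto; intros;
  try (apply H; simpl; auto; fail); apply K; auto; firstorder.
- simpl; rewrite fsat_All; split; intros Q a Ha; specialize (Q a Ha).
  + apply IH; auto; intros m; unfold upd; destruct (Nat.eq_dec m n); auto.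
  + apply (IH H K (upd e1 n a)) in Q; auto.
    intros m; unfold upd; destruct (Nat.eq_dec m n); auto.
Qed.

Lemma coded_compile α d τ q :
  (forall a, fo_par1 a q -> inV a α) ->
  (forall T, (exists n, T = Var n /\ fo_free2 n q) \/ (exists A, T = Par A /\ fo_par2 A q) ->
     exists j tag, τ T = op (num j) tag /\ j < d /\ inV tag α) ->
  coded α d (compile τ q).
Proof.
induction q as [s t|s t|t T|q IH|q IH r IH'|n q IH]; simpl; intros H K; auto.
- split; intros a ->; auto.
- split; intros a ->; auto.
- split; [intros a ->; auto|].
  destruct (K T) as [j [tag [E Q]]].
  + destruct T; [left|right]; eauto.
  + rewrite E; eauto.
- split; [apply IH|apply IH']; auto; intros T [[n [-> Q]]|[A [-> Q]]]; apply K; eauto 6.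
Qed.

(** * The first-order formula about a truth predicate *)

Section Leaf.
Variable κ : M.

(** The syntactic relations on codes are handed to formulas as second-order parameters. Their
    restrictions to V_α are the same relations there, so no coding of syntax by first-order formulas
    is required. *)
Definition unary (P : M -> Prop) : M := sep (Vset κ) P.
Definition binary (P : M -> M -> Prop) : M :=
  sep (Vset κ) (fun z => exists x y, z = op x y /\ P x y).

Lemma mem_unary P x : inV x κ -> (x ∈ unary P <-> P x).
Proof. intros H; unfold unary; rewrite mem_sep, mem_Vset; tauto. Qed.

Lemma mem_binary P x y : limit κ -> inV x κ -> inV y κ -> (op x y ∈ binary P <-> P x y).
Proof.
intros L Hx Hy; unfold binary; rewrite mem_sep, mem_Vset; split.
- intros [_ [x' [y' [E H]]]]; apply op_inj in E; destruct E; now subst.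
- intros H; split; [now apply inV_op|eauto].
Qed.

Definition literal (c : bool) q : @fo M := if c then q else Neg q.
Definition atom_fo (P : M -> Prop) c d : @fo M :=
  All 0 (Imp (Ap (Var 0) (Par (unary P))) (literal c (Ap (Var 0) (Var d)))).
Definition sub_fo (P : M -> Prop) c d : @fo M :=
  All 0 (Imp (Ap (Var 0) (Par (unary P))) (Iff (Ap (Var 0) (Var d))
    (All 1 (Imp (rel (Par (binary sub_node)) (Var 0) (Var 1))
      (literal c (Ap (Var 1) (Var d))))))).
Definition ap_fo d j : @fo M :=
  All 0 (All 1 (All 2 (Imp (rel (Par (binary ap_node)) (Var 0) (Var 1))
    (Imp (is_op (Var 1) (Par (num j)) (Var 2))
       (Iff (Ap (Var 0) (Var d)) (Ap (Var 2) (Var j))))))).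
(** At a path [s], tag 0 holds the root node of the coded formula. Positive tags are left for its
    second-order parameters. *)
Definition root_fo (s : M) d : @fo M :=
  All 0 (All 1 (Imp (is_op (Var 1) (Par (op s (num 0))) (Var 0))
    (Imp (Ap (Var 1) (Var 0)) (Ap (Var 0) (Var d))))).

Definition conj_list (l : list (@fo M)) : @fo M := fold_right And Top l.

Lemma fsat_conj_list α e1 e2 (l : list (@fo M)) :
  fsat α e1 e2 (conj_list l) <-> forall q, List.In q l -> fsat α e1 e2 q.
Proof.
induction l as [|q l IH]; simpl; [split; [tauto|intros _; apply fsat_Top]|].
rewrite fsat_And; fold (conj_list l); rewrite IH; split.
- intros [H K] r [<-|Hr]; auto.
- auto.
Qed.

(** The first-order formula at path [s] of the data in the second-order
    variable 0 is true according to the truth predicate in variable [d], which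
    interprets the second-order variables below [d]. *)
Definition leaf (s : M) d : @fo M :=
  conj_list (atom_fo true_node true d :: atom_fo false_node false d ::
    sub_fo conj_node true d :: sub_fo neg_node false d :: root_fo s d ::
    map (ap_fo d) (seq 0 d)).

Section LeafSemantics.
Variables (α : M) (e1 e2 : nat -> M) (d : nat).
Hypotheses (Lκ : limit κ) (Lα : limit α) (Iα : forall x, inV x α -> inV x κ).

Lemma fsat_atom_fo P c : fsat α e1 e2 (atom_fo P c d) <->
  forall x, inV x α -> P x -> if c then x ∈ e2 d else ~ x ∈ e2 d.
Proof.
unfold atom_fo; rewrite fsat_All; destruct c; unfold literal;
split; intros H x Hx; specialize (H x Hx); rewrite fsat_Imp, ?fsat_Neg, !fsat_Ap in *;
simpl in *; rewrite ?upd_eq in *; auto; rewrite mem_unary in *; auto.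
Qed.

Lemma fsat_sub_fo P c : fsat α e1 e2 (sub_fo P c d) <->
  forall x, inV x α -> P x -> (x ∈ e2 d <->
    forall y, inV y α -> sub_node x y -> if c then y ∈ e2 d else ~ y ∈ e2 d).
Proof.
unfold sub_fo; set (q := Imp (rel (Par (binary sub_node)) (Var 0) (Var 1))
  (literal c (Ap (Var 1) (Var d)))).
assert (E : forall x y, inV x α -> inV y α -> (fsat α (upd (upd e1 0 x) 1 y) e2 q <->
   (sub_node x y -> if c then y ∈ e2 d else ~ y ∈ e2 d))).
{ intros x y Hx Hy; unfold q; destruct c; unfold literal;
  rewrite fsat_Imp, ?fsat_Neg, fsat_rel, fsat_Ap; simpl; try lia; auto;
  rewrite (upd_eq (upd e1 0 x)), upd_neq, upd_eq by lia;
  rewrite mem_binary by auto; tauto. }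
assert (E' : forall x, inV x α -> (fsat α (upd e1 0 x) e2
  (Imp (Ap (Var 0) (Par (unary P))) (Iff (Ap (Var 0) (Var d)) (All 1 q))) <->
  (P x -> (x ∈ e2 d <-> forall y, inV y α -> sub_node x y ->
     if c then y ∈ e2 d else ~ y ∈ e2 d)))).
{ intros x Hx; rewrite fsat_Imp, fsat_Iff, !fsat_Ap, fsat_All; simpl;
  rewrite ?upd_eq, ?mem_unary; auto.
  assert (Q : (forall a, inV a α -> fsat α (upd (upd e1 0 x) 1 a) e2 q) <->
   forall y, inV y α -> sub_node x y -> if c then y ∈ e2 d else ~ y ∈ e2 d)
   by (split; intros K y Hy; apply (E x y Hx Hy), K, Hy).
  rewrite Q; tauto. }
rewrite fsat_All; split; intros H x Hx; apply (E' x Hx), H, Hx.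
Qed.

Lemma fsat_ap_fo j : fsat α e1 e2 (ap_fo d j) <->
  forall x z, inV x α -> inV z α -> ap_node x (op (num j) z) -> (x ∈ e2 d <-> z ∈ e2 j).
Proof.
assert (E : forall x y z, inV x α -> inV y α -> inV z α ->
  (fsat α (upd (upd (upd e1 0 x) 1 y) 2 z) e2
   (Imp (rel (Par (binary ap_node)) (Var 0) (Var 1))
    (Imp (is_op (Var 1) (Par (num j)) (Var 2))
       (Iff (Ap (Var 0) (Var d)) (Ap (Var 2) (Var j))))) <->
   (ap_node x y -> y = op (num j) z -> (x ∈ e2 d <-> z ∈ e2 j)))).
{ intros x y z Hx Hy Hz; rewrite !fsat_Imp, fsat_Iff, fsat_rel, fsat_is_op, !fsat_Ap;
  simpl; try lia; auto; try discriminate; try (apply (inV_num j); auto).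
  unfold upd; simpl; rewrite mem_binary by auto; tauto. }
unfold ap_fo; rewrite fsat_All; split.
- intros H x z Hx Hz K.
  assert (Hy : inV (op (num j) z) α) by auto using inV_op, inV_num.
  apply (E x (op (num j) z) z); auto; exact (H x Hx _ Hy z Hz).
- intros H x Hx; rewrite fsat_All; intros y Hy; rewrite fsat_All; intros z Hz.
  apply E; auto; intros K ->; auto.
Qed.

Lemma fsat_root_fo (s : M) : inV s α -> (fsat α e1 e2 (root_fo s d) <->
  forall x, inV x α -> op (op s (num 0)) x ∈ e2 0 -> x ∈ e2 d).
Proof.
intros Hs.
assert (Hs' : inV (op s (num 0)) α) by (apply inV_op; auto; apply (inV_num 0); auto).
assert (E : forall x y, inV x α -> inV y α -> (fsat α (upd (upd e1 0 x) 1 y) e2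
   (Imp (is_op (Var 1) (Par (op s (num 0))) (Var 0))
    (Imp (Ap (Var 1) (Var 0)) (Ap (Var 0) (Var d)))) <->
   (y = op (op s (num 0)) x -> y ∈ e2 0 -> x ∈ e2 d))).
{ intros x y Hx Hy; rewrite !fsat_Imp, fsat_is_op, !fsat_Ap; simpl; auto; try discriminate.
  unfold upd; simpl; tauto. }
unfold root_fo; rewrite fsat_All; split.
- intros H x Hx K.
  assert (Hy : inV (op (op s (num 0)) x) α) by auto using inV_op.
  apply (E x _ Hx Hy); auto; exact (H x Hx _ Hy).
- intros H x Hx; rewrite fsat_All; intros y Hy.
  apply E; auto; intros ->; auto.
Qed.

Lemma fsat_leaf (s : M) : inV s α -> (fsat α e1 e2 (leaf s d) <->
  tarski α (e2 d) e2 d /\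
  forall x, inV x α -> op (op s (num 0)) x ∈ e2 0 -> x ∈ e2 d).
Proof.
intros Hs; unfold leaf; rewrite fsat_conj_list.
rewrite <- (fsat_root_fo s Hs); split.
- intros H; split; [|apply H; simpl; auto 6].
  intros x Hx; split; [|split; [|split; [|split]]].
  + apply (fsat_atom_fo true_node true); auto; apply H; simpl; auto.
  + apply (fsat_atom_fo false_node false); auto; apply H; simpl; auto.
  + apply (fsat_sub_fo conj_node true); auto; apply H; simpl; auto.
  + apply (fsat_sub_fo neg_node false); auto; apply H; simpl; auto.
  + intros j z Hj Hz; apply (fsat_ap_fo j); auto; apply H.
    do 5 right; apply in_map, in_seq; lia.
- intros [T R] q [<-|[<-|[<-|[<-|[<-|Hq]]]]]; auto.
  + apply fsat_atom_fo; intros x Hx; apply T, Hx.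
  + apply fsat_atom_fo; intros x Hx; apply T, Hx.
  + apply fsat_sub_fo; intros x Hx; apply T, Hx.
  + apply fsat_sub_fo; intros x Hx; apply T, Hx.
  + apply in_map_iff in Hq; destruct Hq as [j [<- Hj]]; apply in_seq in Hj.
    apply fsat_ap_fo; intros x z Hx; apply T; auto; lia.
Qed.

End LeafSemantics.

(** Occurrence of a variable or parameter is inherited from a conjunction by one of its members, so
    each occurrence check reduces to the six kinds of conjuncts. *)
Lemma leaf_cases (P : @fo M -> Prop) (s : M) d : P (leaf s d) ->
  ~ P Top -> (forall q r, P (And q r) -> P q \/ P r) ->
  P (atom_fo true_node true d) \/ P (atom_fo false_node false d) \/
  P (sub_fo conj_node true d) \/ P (sub_fo neg_node false d) \/ P (root_fo s d) \/
  exists j, j < d /\ P (ap_fo d j).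
Proof.
intros H HT HA.
assert (E : forall l : list (@fo M), P (conj_list l) -> exists q, List.In q l /\ P q).
{ intros l; induction l as [|q l IH]; simpl; [tauto|]; intros K.
  apply HA in K; destruct K as [K|K]; [eauto|].
  apply IH in K; destruct K as [r [K K']]; eauto. }
apply E in H; destruct H as [q [[<-|[<-|[<-|[<-|[<-|Hq]]]]] H]]; auto 7.
apply in_map_iff in Hq; destruct Hq as [j [<- Hj]]; apply in_seq in Hj.
do 5 right; exists j; split; [lia|exact H].
Qed.

Lemma free1_leaf n (s : M) d : ~ fo_free1 n (leaf s d).
Proof.
intros H; apply (leaf_cases (fo_free1 n)) in H; [|simpl; intuition congruence|auto]; revert H.
unfold atom_fo, sub_fo, literal, root_fo, ap_fo, Iff, Imp;
cbn [fo_free1]; intros; repeat match goal with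
 | H : exists _, _ |- _ => destruct H
 | H : _ /\ _ |- _ => destruct H
 | H : _ \/ _ |- _ => destruct H
 | H : fo_free1 _ (rel _ _ _) |- _ => apply free1_rel in H
 | H : fo_free1 _ (is_op _ _ _) |- _ => apply free1_is_op in H
 end; congruence.
Qed.

Lemma free2_leaf n (s : M) d : 0 < d -> fo_free2 n (leaf s d) -> n <= d.
Proof.
intros Hd H; apply (leaf_cases (fo_free2 n)) in H; [|simpl; tauto|auto]; revert H.
unfold atom_fo, sub_fo, literal, root_fo, ap_fo, Iff, Imp;
cbn [fo_free2]; intros; repeat match goal with
 | H : exists _, _ |- _ => destruct H
 | H : _ /\ _ |- _ => destruct H
 | H : _ \/ _ |- _ => destruct H
 | H : fo_free2 _ (rel _ _ _) |- _ => apply free2_rel in H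
 | H : fo_free2 _ (is_op _ _ _) |- _ => apply free2_is_op in H
 | H : Var _ = Var _ |- _ => injection H as H
 end; try discriminate; try lia; try tauto.
Qed.

Definition leaf_params : list M :=
  [unary true_node; unary false_node; unary conj_node; unary neg_node;
   binary sub_node; binary ap_node].

Lemma par2_leaf A (s : M) d : fo_par2 A (leaf s d) -> List.In A leaf_params.
Proof.
intros H; apply (leaf_cases (fo_par2 A)) in H; [|simpl; tauto|auto]; revert H.
unfold atom_fo, sub_fo, literal, root_fo, ap_fo, Iff, Imp;
cbn [fo_par2]; intros; repeat match goal with
 | H : exists _, _ |- _ => destruct H
 | H : _ /\ _ |- _ => destruct H
 | H : _ \/ _ |- _ => destruct H
 | H : fo_par2 _ (rel _ _ _) |- _ => apply par2_rel in H
 | H : fo_par2 _ (is_op _ _ _) |- _ => apply par2_is_op in H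
 | H : Par _ = Par _ |- _ => injection H as <-
 end; try discriminate; try tauto; unfold leaf_params; simpl; auto 10.
Qed.

Lemma par1_leaf a (s : M) d : fo_par1 a (leaf s d) -> a = op s (num 0) \/ exists j, a = num j.
Proof.
intros H; apply (leaf_cases (fo_par1 a)) in H; [|simpl; intuition discriminate|auto]; revert H.
unfold atom_fo, sub_fo, literal, root_fo, ap_fo, Iff, Imp;
cbn [fo_par1]; intros; repeat match goal with
 | H : exists _, _ |- _ => destruct H
 | H : _ /\ _ |- _ => destruct H
 | H : _ \/ _ |- _ => destruct H
 | H : fo_par1 _ (rel _ _ _) |- _ => apply par1_rel in H
 | H : fo_par1 _ (is_op _ _ _) |- _ => apply par1_is_op in H
 | H : Par _ = Par _ |- _ => injection H as <-
 end; try discriminate; eauto.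
Qed.

Lemma fo_over_leaf (s : M) d : limit κ -> inV s κ -> fo_over κ (leaf s d).
Proof.
intros L Hs; split; intros a Ha.
- apply par1_leaf in Ha; destruct Ha as [->|[j ->]]; [|now apply inV_num].
  apply inV_op; auto; now apply (inV_num 0).
- apply par2_leaf in Ha; assert (V : subV (Vset κ) κ) by (intros x; apply mem_Vset).
  simpl in Ha; repeat destruct Ha as [<-|Ha]; try tauto; now apply subV_sep.
Qed.

End Leaf.
End Truth.

(** * Universal formulas *)

Section Paths.
Context {M : zfc}.
Implicit Types s t x y : M.

(** Paths lead to the conjuncts chosen at limit levels. Data for different conjuncts are stored
    under different extensions of the path, inside one set. *)
Inductive ext_path s : M -> Prop :=
| ext_refl : ext_path s s
| ext_step t x : ext_path s t -> ext_path s (op t x).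

Lemma ext_path_weaken s x t : ext_path (op s x) t -> ext_path s t.
Proof. intros H; induction H; constructor; auto; constructor. Qed.

Lemma ext_path_irrefl t x : ~ ext_path (op t x) t.
Proof.
(* The last component of a pair path sits two membership steps down. The induction hypothesis is
   therefore strengthened to the elements of [t] as well. *)
enough (H : (forall x, ~ ext_path (op t x) t) /\
  forall v, v ∈ t -> forall x, ~ ext_path (op v x) v) by exact (proj1 H x).
clear x; induction t as [t IH] using mem_ind; split; [|intros v Hv; now apply IH].
intros x H; inversion H as [E|t' y H' E].
- apply (@mem_asym M t (pair t t)); [apply mem_pair; auto|].
  rewrite <- E at 3; apply mem_pair; auto.
- assert (Hp : pair t' t' ∈ t) by (rewrite <- E; apply mem_pair; auto).
  assert (Ht' : t' ∈ pair t' t') by (apply mem_pair; auto).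
  apply (proj2 (IH _ Hp) t' Ht' y); exact (ext_path_weaken _ _ _ H').
Qed.

(** Branches of the tree of paths are disjoint; this is what lets the data of the conjuncts be
    united and recovered. *)
Lemma ext_path_inj s x y t : ext_path (op s x) t -> ext_path (op s y) t -> x = y.
Proof.
intros H; induction H as [|t z H IH]; intros K.
- inversion K as [E|t' z H' E].
  + now apply op_inj in E.
  + apply op_inj in E; destruct E as [-> ->]; destruct (ext_path_irrefl _ _ H').
- inversion K as [E|t' z' H' E].
  + apply op_inj in E; destruct E as [-> ->]; destruct (ext_path_irrefl _ _ H).
  + apply op_inj in E; destruct E as [-> ->]; auto.
Qed.

End Paths.

Section Universal.
Context {M : zfc}.
Implicit Types (α β ζ η ξ μ a A D : M) (p W : @form M) (q r χ : @fo M).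
Implicit Types (e Y : nat -> M) (n m d k : nat) (ρ : nat -> nat).
Variables (b : M -> M -> M -> M) (κ : M).
Hypotheses (hb : canonical_bijections b) (Rκ : regular κ).

(** [universal ζ s d W]: the variable 0 carries the data, at the path [s], of a
    Π^1_ζ formula; the variables below [d] interpret its free variables, and
    [d] is a truth predicate if [ζ = 0] and unused otherwise. *)
Inductive universal : M -> M -> nat -> form -> Prop :=
| universal_0 s d : universal empty s d (Fo (leaf κ s d))
| universal_succ ζ s d W : ordinal ζ -> universal ζ s (S (S d)) W ->
    universal (succ ζ) s d (all2s [S d; S (S d)] (neg W))
| universal_limit ζ s d ψ : limit ζ -> ψ empty = Fo Top ->
    (forall η, η ∈ ζ -> η <> empty -> universal η (op s (idx b κ ζ η)) d (ψ η)) ->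
    universal ζ s d (Conj ζ ψ).

Lemma universal_exists ζ : ordinal ζ -> forall (s : M) d, exists W, universal ζ s d W.
Proof.
induction ζ as [ζ IH] using mem_ind; intros O s d.
destruct (ordinal_cases ζ O) as [->|[[η [Oη ->]]|L]].
- eexists; constructor.
- destruct (IH η (mem_succ_self η) Oη s (S (S d))) as [W HW].
  eexists; constructor; eauto.
- destruct (choice_on M form (Fo Top) (fun η => η ∈ ζ)
    (fun η W => (η = empty -> W = Fo Top) /\
       (η <> empty -> universal η (op s (idx b κ ζ η)) d W))) as [ψ Hψ].
  { intros η Hη; destruct (classic (η = empty)) as [E|E].
    - exists (Fo Top); tauto.
    - destruct (IH η Hη (ordinal_mem _ _ O Hη) (op s (idx b κ ζ η)) d) as [W HW].
      exists W; tauto. }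
  exists (Conj ζ ψ); constructor; auto.
  + apply Hψ; auto; apply empty_mem; apply L.
  + intros η Hη; now apply Hψ.
Qed.

Lemma universal_0_inv (s : M) d W : universal empty s d W -> W = Fo (leaf κ s d).
Proof.
intros H; inversion H as [|ζ ? ? ? ? ? E|? ? ? ? L]; subst; auto.
- destruct (succ_not_empty _ E).
- destruct (limit_not_empty L).
Qed.

Lemma universal_succ_inv ζ (s : M) d W : universal (succ ζ) s d W ->
  exists W', W = all2s [S d; S (S d)] (neg W') /\ universal ζ s (S (S d)) W'.
Proof.
intros H; inversion H as [? ? E|ζ' ? ? W' ? H' E|? ? ? ? L]; subst; auto.
- destruct (succ_not_empty _ (eq_sym E)).
- apply succ_inj in E; subst; eauto.
- destruct (limit_not_succ _ L).
Qed.

Lemma universal_limit_inv ζ (s : M) d W : limit ζ -> universal ζ s d W ->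
  exists ψ, W = Conj ζ ψ /\ ψ empty = Fo Top /\
  forall η, η ∈ ζ -> η <> empty -> universal η (op s (idx b κ ζ η)) d (ψ η).
Proof.
intros L H; inversion H as [? ? E|ζ' ? ? W' ? H' E|? ? ? ψ]; subst; eauto.
- destruct (limit_not_empty L).
- destruct (limit_not_succ _ L).
Qed.

Lemma universal_free1 n ζ (s : M) d W : universal ζ s d W -> ~ free1 n W.
Proof.
intros H; induction H as [s d|ζ s d W _ _ IH|ζ s d ψ L E H IH].
- apply free1_leaf.
- rewrite free1_all2s, free1_neg; auto.
- intros [η [Hη K]]; destruct (classic (η = empty)) as [->|N].
  + rewrite E in K; simpl in K; intuition congruence.
  + exact (IH η Hη N K).
Qed.

Lemma universal_free2 n ζ (s : M) d W : universal ζ s d W -> 0 < d -> free2 n W -> n <= d.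
Proof.
intros H; induction H as [s d|ζ s d W _ _ IH|ζ s d ψ L E H IH]; intros Hd K.
- exact (free2_leaf κ n s d Hd K).
- apply free2_all2s in K; destruct K as [N K]; apply (proj1 (free2_neg n W)), IH in K; [|lia].
  simpl in N; lia.
- destruct K as [η [Hη K]]; destruct (classic (η = empty)) as [->|N].
  + rewrite E in K; simpl in K; tauto.
  + exact (IH η Hη N Hd K).
Qed.

Lemma universal_bound2 n ζ (s : M) d W : universal ζ s d W -> bound2 n W -> d < n.
Proof.
intros H; induction H as [s d|ζ s d W _ _ IH|ζ s d ψ L E H IH]; intros K.
- destruct K.
- apply bound2_all2s in K; destruct K as [K|K].
  + simpl in K; lia.
  + apply (proj1 (bound2_neg n W)), IH in K; lia.
- destruct K as [η [Hη K]]; destruct (classic (η = empty)) as [->|N].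
  + rewrite E in K; destruct K.
  + exact (IH η Hη N K).
Qed.

(** The parameters are the same six relations at every leaf. Together with the bound on the free
    variables, this keeps infinite conjunctions within the finitary restriction. *)
Lemma universal_par2 A ζ (s : M) d W : universal ζ s d W -> par2 A W ->
  List.In A (leaf_params κ).
Proof.
intros H; induction H as [s d|ζ s d W _ _ IH|ζ s d ψ L E H IH]; intros K.
- exact (par2_leaf κ A s d K).
- rewrite par2_all2s, par2_neg in K; auto.
- destruct K as [η [Hη K]]; destruct (classic (η = empty)) as [->|N].
  + rewrite E in K; simpl in K; tauto.
  + exact (IH η Hη N K).
Qed.

Lemma universal_finitary2 ζ (s : M) d W : universal ζ s d W -> 0 < d -> finitary2 W.
Proof.
intros H Hd; split.
- exists (seq 0 (S d)); intros n K; apply in_seq.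
  apply (universal_free2 n ζ s d W H Hd) in K; lia.
- exists (leaf_params κ); intros A; exact (universal_par2 A ζ s d W H).
Qed.

Lemma Pi1_universal ζ (s : M) d W : universal ζ s d W -> ζ ∈ cardsucc κ ->
  inV s κ -> 0 < d -> Pi1 κ ζ W.
Proof.
intros H; induction H as [s d|ζ s d W O H IH|ζ s d ψ L E H IH]; intros Hζ Hs Hd.
- constructor; apply fo_over_leaf; auto; now apply limit_κ.
- apply Pi1_succ; auto; apply Sigma1_neg, IH; auto.
  apply (cs_trans κ Rκ (succ ζ)); auto using mem_succ_self.
- constructor; auto.
  + intros η Hη; destruct (classic (η = empty)) as [->|N].
    * rewrite E; constructor; split; simpl; intuition discriminate.
    * apply IH; auto; [apply (cs_trans κ Rκ ζ); auto|].
      apply inV_op; auto using limit_κ, inV_idx.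
  + apply (universal_finitary2 ζ s d); auto; now constructor.
Qed.

(** A block of quantified sets is coded by one set, with the value of the
    variable [k] in its section at [k]. *)
Definition block α e ks (Y : M) k : M :=
  if in_dec Nat.eq_dec k ks then sep (Vset α) (fun v => op (num k) v ∈ Y) else e k.

(** A block of arbitrary length becomes a single quantifier, so the universal formula can use blocks
    of one fixed form. *)
Lemma eval_block α p : limit α -> forall ks e1 e2,
  eval b κ α e1 e2 (all2s ks p) <->
  forall Y : M, subV Y α -> eval b κ α e1 (block α e2 ks Y) p.
Proof.
intros L ks e1; induction ks as [|k ks IH]; intros e2; simpl.
- split; [intros H Y _; exact H|intros H; exact (H empty (subV_empty α))].
- assert (V : forall P, subV (sep (Vset α) P) α)
    by (intros P x Hx; apply mem_sep in Hx; apply mem_Vset; tauto).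
  split.
  + intros H Y HY.
    assert (K := proj1 (IH _) (H (sep (Vset α) (fun v => op (num k) v ∈ Y)) (V _)) Y HY).
    replace (block α e2 (k :: ks) Y) with
      (block α (upd e2 k (sep (Vset α) (fun v => op (num k) v ∈ Y))) ks Y); auto.
    apply functional_extensionality; intros m; unfold block, upd.
    destruct (in_dec Nat.eq_dec m ks) as [I|I], (in_dec Nat.eq_dec m (k :: ks)) as [J|J];
    simpl in J; try tauto; destruct (Nat.eq_dec m k) as [->|N]; auto; intuition congruence.
  + intros H A HA; apply IH; intros Y HY.
    (* [Z] keeps the sections for the inner variables and adds [A] at [k], except when [k] is
       quantified again further in, where the inner value must win. *)
    set (Z := sep (Vset α) (fun z => exists m v, z = op (num m) v /\
      ((List.In m ks /\ z ∈ Y) \/ (m = k /\ ~ List.In k ks /\ v ∈ A)))).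
    assert (K := H Z (V _)).
    assert (IZ : forall m v, inV v α -> (op (num m) v ∈ Z <->
      (List.In m ks /\ op (num m) v ∈ Y) \/ (m = k /\ ~ List.In k ks /\ v ∈ A))).
    { intros m v Hv; unfold Z; rewrite mem_sep, mem_Vset; split.
      - intros [_ [m' [v' [E Q]]]]; apply op_inj in E; destruct E as [E <-].
        apply num_inj in E; now subst m'.
      - intros Q; split; [auto using inV_op, inV_num|eauto]. }
    replace (block α (upd e2 k A) ks Y) with (block α e2 (k :: ks) Z); auto.
    apply functional_extensionality; intros m; unfold block, upd.
    destruct (in_dec Nat.eq_dec m ks) as [I|I], (in_dec Nat.eq_dec m (k :: ks)) as [J|J];
    simpl in J; try tauto.
    * apply ext_eq; intros v; rewrite !mem_sep, !mem_Vset.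
      split; intros [Hv Q]; split; auto; apply IZ in Q || apply IZ; auto.
      destruct Q as [Q|[-> Q]]; tauto.
    * destruct (Nat.eq_dec m k) as [->|N]; [|intuition congruence].
      apply ext_eq; intros v; rewrite mem_sep, mem_Vset; split.
      -- intros [Hv Q]; apply IZ in Q; auto; tauto.
      -- intros Q; split; auto; apply IZ; auto.
    * destruct (Nat.eq_dec m k); auto; intuition congruence.
Qed.

Definition e0 : nat -> M := fun _ => empty.

(** Only the part of the data at extensions of [s] and inside V_α is compared, so that [Y] may hold
    the data of other conjuncts too. *)
Definition agrees α (s D Y : M) : Prop := forall (s' v : M) i, ext_path s s' ->
  inV (op (op s' (num i)) v) α ->
  (op (op s' (num i)) v ∈ Y <-> op (op s' (num i)) v ∈ D).

(** [D] is the data of [p] at [s], as far as [V_α] is concerned; the free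
    variable [k] of [p] is the section at [k] of the variable [ρ k]. *)
Definition covers ζ p (s : M) d ρ D α : Prop :=
  forall W Y e2, universal ζ s d W -> agrees α s D (Y 0) ->
  (forall k, free2 k p -> forall v : M, inV v α -> (v ∈ e2 k <-> op (num k) v ∈ Y (ρ k))) ->
  (ζ = empty -> ((exists T, subV T α /\ eval b κ α e0 (upd Y d T) W) <->
                 eval b κ α e0 e2 p)) /\
  (ζ <> empty -> (eval b κ α e0 Y W <-> eval b κ α e0 e2 p)).

(** Data stay under their own path; otherwise the union at a limit could pollute a neighbouring
    conjunct. *)
Definition supported (s D : M) : Prop := forall z, z ∈ D ->
  exists (s' v : M) i, ext_path s s' /\ z = op (op s' (num i)) v.

Lemma tarski_agree α (T : M) Y Y' d : (forall j, j < d -> Y j = Y' j) ->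
  tarski α T Y d -> tarski α T Y' d.
Proof.
intros E H x Hx; destruct (H x Hx) as [H1 [H2 [H3 [H4 H5]]]].
do 4 (split; auto); intros j z Hj; rewrite <- E; auto.
Qed.

(** The data are the root node of the compiled formula at tag 0 and the finitely many second-order
    parameters at positive tags. Tarski's clauses fix the value of the truth predicate at the
    root. *)
Lemma cover_0 q (s : M) d ρ : fo_over κ q -> (forall n, ~ fo_free1 n q) ->
  inV s κ -> 0 < d -> (forall k, fo_free2 k q -> ρ k < d) ->
  exists D, subV D κ /\ supported s D /\
    forced κ (covers empty (Fo q) s d ρ D).
Proof.
intros Hq F1 Hs Hd Hρ; assert (Lκ := limit_κ κ Rκ).
destruct (fo_par2_finite q) as [l Hl].
destruct (choice_on M nat 0 (fun A => fo_par2 A q)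
  (fun A i => nth_error l i = Some A)) as [ix Hix].
{ intros A HA; apply In_nth_error; auto. }
(* A variable is addressed as its section of the variable [ρ k]; a parameter as a section of the
   data variable 0, its position increased by one because tag 0 is the root. *)
set (τ := fun T : @term M => match T with
  | Var k => op (num (ρ k)) (num k)
  | Par A => op (num 0) (op s (num (S (ix A)))) end).
set (root := node (compile τ q) nil).
set (D := sep (Vset κ) (fun z => z = op (op s (num 0)) root \/
  exists A v i, nth_error l i = Some A /\ v ∈ A /\ z = op (op s (num (S i))) v)).
exists D; split; [|split].
- intros x Hx; apply mem_sep in Hx; apply mem_Vset; tauto.
- intros z Hz; apply mem_sep in Hz; destruct Hz as [_ [->|[A [v [i [_ [_ ->]]]]]]].
  + exists s, root, 0; split; [constructor|auto].
  + exists s, v, (S i); split; [constructor|auto].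
- eapply forced_imp; [exact (forced_and κ Rκ _ _ (forced_par1 κ Rκ q Hq) (forced_inV κ Rκ s Hs))|].
  intros α Hα [Ha Hsα] W Y e2 HW HD He; split; [intros _|tauto].
  assert (Lα := pt_limit κ Rκ α Hα).
  assert (Iα := fun x => pt_inV κ Rκ α x Hα).
  apply universal_0_inv in HW; subst W; simpl.
  assert (Hτ : forall T, (exists n, T = Var n /\ fo_free2 n q) \/
      (exists A, T = Par A /\ fo_par2 A q) ->
      exists j tag, τ T = op (num j) tag /\ j < d /\ inV tag α).
  { intros T [[n [-> Hn]]|[A [-> HA]]].
    - exists (ρ n), (num n); split; auto; split; auto; now apply inV_num.
    - exists 0, (op s (num (S (ix A)))); split; auto; split; auto.
      apply inV_op; auto; now apply inV_num. }
  assert (Hc := coded_compile α d τ q Ha Hτ).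
  assert (Hr : inV root α) by (apply (inV_node α d); auto; intros n a []).
  assert (Hroot : forall x, inV x α -> (op (op s (num 0)) x ∈ Y 0 <-> x = root)).
  { intros x Hx.
    assert (V : inV (op (op s (num 0)) x) α)
      by (apply inV_op; auto; apply inV_op; auto; now apply (inV_num 0)).
    rewrite (HD s x 0 (ext_refl s) V); unfold D; rewrite mem_sep, mem_Vset; split.
    - intros [_ [E|[A [v [i [_ [_ E]]]]]]]; apply op_inj in E; [tauto|].
      destruct E as [E _]; apply op_inj in E; destruct E as [_ E].
      apply num_inj in E; discriminate.
    - intros ->; auto. }
  assert (Hpar : forall A v, fo_par2 A q -> inV v α ->
    (op (op s (num (S (ix A)))) v ∈ Y 0 <-> v ∈ A)).
  { intros A v HA Hv.
    assert (V : inV (op (op s (num (S (ix A)))) v) α)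
      by (apply inV_op; auto; apply inV_op; auto; now apply inV_num).
    rewrite (HD s v (S (ix A)) (ext_refl s) V); unfold D; rewrite mem_sep, mem_Vset; split.
    - intros [_ [E|[A' [v' [i [E' [Hv' E]]]]]]]; apply op_inj in E; destruct E as [E E''];
      apply op_inj in E; destruct E as [_ E]; apply num_inj in E; [discriminate|].
      injection E as <-; rewrite (Hix A HA) in E'; injection E' as <-; now subst.
    - intros K; split; auto; right; exists A, v, (ix A); auto. }
  assert (HY : forall T j, j < d -> upd Y d T j = Y j) by (intros T j Hj; apply upd_neq; lia).
  assert (Hsat : forall T, tarski α T (upd Y d T) d -> (root ∈ T <-> fsat α e0 e2 q)).
  { intros T HT; unfold root.
    rewrite (tarski_isat α T (upd Y d T) d Lα HT (compile τ q) nil Hc) by (intros n a []).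
    apply isat_compile; auto.
    - intros T' v HT' Hv; destruct HT' as [[n [-> Hn]]|[A [-> HA]]]; simpl.
      + rewrite (He n Hn v Hv); rewrite <- (HY T (ρ n)) by auto; split.
        * intros K; exists (ρ n), (num n); auto.
        * intros [j [tag [E K]]]; apply op_inj in E; destruct E as [E <-].
          apply num_inj in E; now subst.
      + rewrite <- (Hpar A v HA Hv), <- (HY T 0) by auto; split.
        * intros K; exists 0, (op s (num (S (ix A)))); auto.
        * intros [j [tag [E K]]]; apply op_inj in E; destruct E as [E <-].
          apply (num_inj 0) in E; now subst.
    - intros n; now apply inV_empty. }
  split.
  + intros [T [HT K]].
    apply (fsat_leaf κ α e0 (upd Y d T) d Lκ Lα Iα s Hsα) in K; destruct K as [K1 K2].
    rewrite upd_eq in *; apply (Hsat T K1), K2; auto.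
    rewrite HY by auto; now apply Hroot.
  + intros K; destruct (tarski_exists α Y d Lα) as [T [HT HT']].
    exists T; split; auto; apply (fsat_leaf κ α e0 (upd Y d T) d Lκ Lα Iα s Hsα).
    assert (HT'' : tarski α T (upd Y d T) d)
      by (apply (tarski_agree α T Y); auto; intros; now rewrite HY).
    rewrite upd_eq; split; auto; intros x Hx; rewrite HY by auto.
    intros Q; apply Hroot in Q; auto; subst x; now apply Hsat.
Qed.

(** Variable [S d] holds the coded block of quantified sets, and [S (S d)] is reserved for a truth
    predicate in case the matrix is first-order. Both are quantified universally, so no extra
    alternation appears. *)
Lemma cover_succ ζ ks p (s : M) d ρ D α : limit α -> 0 < d ->
  (forall k, free2 k (all2s ks p) -> ρ k < d) ->
  covers ζ (neg p) s (S (S d)) (fun k => if in_dec Nat.eq_dec k ks then S d else ρ k) D α ->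
  covers (succ ζ) (all2s ks p) s d ρ D α.
Proof.
intros Lα Hd Hρ H W Y e2 HW HD He.
split; [intros E; destruct (succ_not_empty _ E)|intros _].
apply universal_succ_inv in HW; destruct HW as [W' [-> HW']].
rewrite (eval_block α p Lα ks e0 e2); simpl.
assert (Hb : forall Z T, subV Z α ->
  let Y' := upd (upd Y (S d) Z) (S (S d)) T in
  agrees α s D (Y' 0) /\
  forall k, free2 k (neg p) -> forall v : M, inV v α ->
    (v ∈ block α e2 ks Z k <->
     op (num k) v ∈ Y' (if in_dec Nat.eq_dec k ks then S d else ρ k))).
{ intros Z T HZ Y'; split.
  - unfold Y'; rewrite !upd_neq by lia; auto.
  - intros k Hk v Hv; apply (proj1 (free2_neg k p)) in Hk; unfold block.
    destruct (in_dec Nat.eq_dec k ks) as [I|I].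
    + unfold Y'; rewrite upd_neq, upd_eq by lia; rewrite mem_sep, mem_Vset; tauto.
    + assert (Hk' : free2 k (all2s ks p)) by (apply free2_all2s; auto).
      specialize (Hρ k Hk'); unfold Y'; rewrite !upd_neq by lia; auto. }
assert (Hp : forall Z, subV Z α ->
  ((forall T, subV T α -> eval b κ α e0 (upd (upd Y (S d) Z) (S (S d)) T) (neg W')) <->
   eval b κ α e0 (block α e2 ks Z) p)).
(* At level 0, that every candidate refutes the leaf is the negation of the existential statement in
   [covers]. At other levels the value of [T] is irrelevant and the empty set serves as an
   instance. *)
{ intros Z HZ; destruct (classic (ζ = empty)) as [E|E].
  - destruct (Hb Z empty HZ) as [B1 B2].
    destruct (H W' (upd Y (S d) Z) (block α e2 ks Z) HW') as [C _].
    + rewrite upd_neq in B1 by lia; exact B1.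
    + intros k Hk v Hv; rewrite (B2 k Hk v Hv).
      assert (N : (if in_dec Nat.eq_dec k ks then S d else ρ k) <> S (S d)).
      { destruct (in_dec Nat.eq_dec k ks) as [I|I]; [lia|].
        apply (proj1 (free2_neg k p)) in Hk.
        assert (Hk' : free2 k (all2s ks p)) by (apply free2_all2s; auto).
        specialize (Hρ k Hk'); lia. }
      rewrite (upd_neq (upd Y (S d) Z)) by exact N; tauto.
    + specialize (C E); rewrite eval_neg in C; split.
      * intros K; apply NNPP; intros N; apply C in N; destruct N as [T [HT N]].
        specialize (K T HT); apply eval_neg in K; auto.
      * intros K T HT; apply eval_neg; intros N; apply C; eauto.
  - assert (C : forall T, eval b κ α e0 (upd (upd Y (S d) Z) (S (S d)) T) W' <->
      ~ eval b κ α e0 (block α e2 ks Z) p).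
    { intros T; rewrite <- eval_neg; destruct (Hb Z T HZ) as [B1 B2].
      exact (proj2 (H W' _ _ HW' B1 B2) E). }
    split.
    + intros K; specialize (K empty (subV_empty α)); apply eval_neg in K.
      apply NNPP; intros N; apply K, C, N.
    + intros K T HT; apply eval_neg; rewrite C; tauto. }
split; intros K Z HZ; [apply Hp|apply Hp]; auto.
Qed.

(** The position at which the universal formula of a limit level treats the
    finite level [n] is [n + 1], because a first-order formula is covered by a
    Π^1_1 formula only. *)
Definition shift_level η : M :=
  if excluded_middle_informative (exists n, η = num n) then bigcup η else η.

Lemma shift_level_cases η :
  (exists n, η = num (S n) /\ shift_level η = num n) \/ η = empty \/
  ((forall n, η <> num n) /\ shift_level η = η).
Proof.
unfold shift_level; destruct (excluded_middle_informative (exists n, η = num n)) as [[[|n] ->]|N].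
- auto.
- left; exists n; split; auto; simpl; apply bigcup_succ, ordinal_num.
- right; right; split; auto; intros n ->; eauto.
Qed.

(** At a limit the data of the conjuncts are united, each under the path extended by the code of its
    place. Diagonal intersection makes the covering hold at [α] for all places in the trace at
    once. *)
Lemma cover ζ : forall p, Pi1 κ ζ p -> ζ ∈ cardsucc κ -> (forall n, ~ free1 n p) ->
  forall (s : M) d ρ, inV s κ -> 0 < d -> (forall k, free2 k p -> ρ k < d) ->
  exists D, subV D κ /\ supported s D /\ forced κ (covers ζ p s d ρ D).
Proof.
induction ζ as [ζ IH] using mem_ind; intros p Hp Hζ F1 s d ρ Hs Hd Hρ.
destruct Hp as [q Hq|ζ ks p O Hp|ζ ψ L Hψ F].
- now apply cover_0.
- apply Pi1_neg in Hp.
  assert (Hζ' : ζ ∈ cardsucc κ) by (apply (cs_trans κ Rκ (succ ζ)); auto using mem_succ_self).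
  destruct (IH ζ (mem_succ_self ζ) (neg p) Hp Hζ') with (s := s) (d := S (S d))
    (ρ := fun k => if in_dec Nat.eq_dec k ks then S d else ρ k) as [D [D1 [D2 D3]]]; auto.
  + intros n; rewrite free1_neg; intros K; apply (F1 n); now rewrite free1_all2s.
  + intros k Hk; apply (proj1 (free2_neg k p)) in Hk.
    destruct (in_dec Nat.eq_dec k ks); [lia|].
    assert (Hk' : free2 k (all2s ks p)) by (apply free2_all2s; auto).
    specialize (Hρ k Hk'); lia.
  + exists D; split; [auto|split; [auto|]]; apply (forced_imp _ _ _ D3).
    intros α Hα; apply cover_succ; auto; now apply (pt_limit κ).
- assert (Lκ := limit_κ κ Rκ).
  assert (Oζ := proj1 L).
  assert (Hsl : forall η, η ∈ ζ -> η <> empty ->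
    shift_level η ∈ ζ /\ Pi1 κ η (ψ (shift_level η))).
  { intros η Hη N; destruct (shift_level_cases η) as [[n [-> ->]]|[->|[_ ->]]]; auto.
    - assert (Hn : num n ∈ ζ) by exact (ordinal_trans _ _ _ Oζ Hη (mem_succ_self (num n))).
      split; auto; apply Pi1_Sigma1_num; auto.
    - tauto. }
  destruct (choice_on M M empty (fun η => η ∈ ζ /\ η <> empty)
    (fun η D => subV D κ /\ supported (op s (idx b κ ζ η)) D /\
       forced κ (covers η (ψ (shift_level η)) (op s (idx b κ ζ η)) d ρ D)))
    as [D HD].
  { intros η [Hη N]; destruct (Hsl η Hη N) as [K1 K2]; apply IH; auto.
    - apply (cs_trans κ Rκ ζ); auto.
    - intros n K; apply (F1 n); simpl; eauto.
    - apply inV_op; auto; now apply inV_idx.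
    - intros k K; apply Hρ; simpl; eauto. }
  exists (sep (Vset κ) (fun z => exists η, η ∈ ζ /\ η <> empty /\ z ∈ D η)).
  split; [|split].
  + intros x Hx; apply mem_sep in Hx; apply mem_Vset; tauto.
  + intros z Hz; apply mem_sep in Hz; destruct Hz as [_ [η [Hη [N Hz]]]].
    destruct (HD η (conj Hη N)) as [_ [Sη _]].
    destruct (Sη z Hz) as [s' [v [i [E ->]]]].
    exists s', v, i; split; auto; now apply ext_path_weaken in E.
  + eapply forced_imp; [apply (forced_and κ Rκ); [exact (forced_coh b κ hb Rκ ζ Hζ)|]|].
    { apply (forced_G b κ hb Rκ ζ (fun η α => η <> empty ->
        covers η (ψ (shift_level η)) (op s (idx b κ ζ η)) d ρ (D η) α)); auto.
      intros η Hη; destruct (classic (η = empty)) as [E|N].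
      - apply forced_true; tauto.
      - eapply forced_imp; [apply (HD η (conj Hη N))|]; auto. }
    intros α Hα [C K] W Y e2 HW HA He.
    split; [intros E; rewrite E in L; destruct (limit_not_empty L)|intros _].
    apply universal_limit_inv in HW; auto; destruct HW as [φ [-> [φ0 Hφ]]]; simpl.
    assert (GG : forall η, η ∈ G b κ α ζ -> η ∈ ζ) by (intros η Hη; now apply mem_G in Hη).
    assert (Q : forall η, η ∈ G b κ α ζ -> η <> empty ->
      (eval b κ α e0 Y (φ η) <-> eval b κ α e0 e2 (ψ (shift_level η)))).
    { intros η Hη N; assert (Hη' := GG η Hη).
      apply (K η Hη N); auto.
      (* An entry of the union under the path of [η] comes from the data of [η] itself, by support
         and disjointness of branches. *)
      - intros s' v i Es' Hv.
        rewrite (HA s' v i (ext_path_weaken _ _ _ Es') Hv), mem_sep, mem_Vset; split.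
        + intros [_ [η' [Hη2 [N' H]]]].
          destruct (proj1 (proj2 (HD η' (conj Hη2 N'))) _ H) as [s2 [v2 [i2 [Es2 E]]]].
          apply op_inj in E; destruct E as [E _]; apply op_inj in E; destruct E as [E _].
          subst s2; assert (E := ext_path_inj _ _ _ _ Es' Es2).
          apply (idx_inj b κ hb Rκ ζ) in E; auto; now subst.
        + intros H; split; [exact (proj1 (HD η (conj Hη' N)) _ H)|eauto].
      - intros k Hk; apply He; simpl; exists (shift_level η); split; auto.
        now apply Hsl. }
    split.
    (* A finite level [μ] is treated at the next place, which coherence keeps in the trace; an
       infinite level is treated at its own place. *)
    * intros H μ Hμ; destruct (classic (exists n, μ = num n)) as [[n ->]|N].
      -- assert (Hs' : succ (num n) ∈ G b κ α ζ).
         { apply (proj1 (proj2 C) (num n) Hμ), L, GG, Hμ. }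
         assert (R := proj1 (Q _ Hs' (succ_not_empty _)) (H _ Hs')).
         destruct (shift_level_cases (succ (num n))) as [[m [E1 E2]]|[E1|[E1 _]]].
         ++ apply succ_inj, num_inj in E1; subst m; now rewrite E2 in R.
         ++ destruct (succ_not_empty _ E1).
         ++ destruct (E1 (S n) eq_refl).
      -- assert (N' : μ <> empty) by (intros ->; apply N; exists 0; auto).
         assert (R := proj1 (Q _ Hμ N') (H _ Hμ)).
         destruct (shift_level_cases μ) as [[m [E1 E2]]|[E1|[_ E1]]]; [|tauto|].
         ++ destruct N; eauto.
         ++ now rewrite E1 in R.
    * intros H η Hη; destruct (classic (η = empty)) as [->|N].
      -- rewrite φ0; apply fsat_Top.
      -- apply (Q η Hη N), H.
         destruct (shift_level_cases η) as [[m [-> ->]]|[E1|[_ ->]]]; [|tauto|auto].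
         exact (proj1 (proj2 (proj2 C)) _ Hη).
Qed.

End Universal.

(** * The non-reflecting points *)

Section NonReflecting.
Context {M : zfc}.
Implicit Types (α β ζ η ξ μ a c A B S : M) (p W : @form M) (q r χ : @fo M).
Implicit Types (e : nat -> M) (n m : nat).
Variables (b : M -> M -> M -> M) (κ : M).
Hypotheses (hb : canonical_bijections b) (Rκ : regular κ).
Variables (ζ : M) (W : @form M).
Hypotheses (Hζ : ζ ∈ cardsucc κ) (HW : universal b κ ζ empty 2 W).

Definition trace α A : M := sep A (fun x => inV x α).

(** The three variables of [W] built with [d = 2]: data, certifying function, truth predicate.
    Starting at 2 instead of 1 leaves number 1 for the function. *)
Definition env A B S n : M :=
  match n with 0 => A | 1 => B | 2 => S | _ => empty end.

(** When [A] is the data of a formula, the choice of [S] matters only for [ζ = empty], where [S] is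
    the truth predicate. *)
Definition U α A B : Prop := exists S, subV S α /\ eval b κ α e0 (env A B S) W.

Definition total_at α B : Prop :=
  forall x, inV x α -> exists y, inV y α /\ op x y ∈ B.

(** If [B] is (the graph of) a function on [V_α], the instance at [A] of the
    universal Π^1_ζ formula reflects to a point closed under [B]. *)
Definition reflecting α : Prop := forall A B, subV A α -> subV B α ->
  total_at α B -> U α A B -> exists α', α' ∈ α /\ regular α' /\
    total_at α' (trace α' B) /\ U α' (trace α' A) (trace α' B).

Definition nonreflecting : M := sep κ (fun α => regular α /\ ~ reflecting α).

Lemma trace_trace α α' A : (forall x, inV x α' -> inV x α) ->
  trace α' (trace α A) = trace α' A.
Proof.
intros H; apply ext_eq; intros x; unfold trace; rewrite !mem_sep; split; [tauto|].
intros [K L]; auto.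
Qed.

Lemma mem_trace α A x : x ∈ trace α A <-> x ∈ A /\ inV x α.
Proof. apply (mem_sep A (fun x => inV x α)). Qed.

Lemma subV_trace α A : subV (trace α A) α.
Proof. intros x Hx; now apply mem_trace in Hx. Qed.

Lemma total_at_graph α g : pt κ α -> closed_under g κ ->
  (total_at α (trace α (graph g κ)) <-> closed_under g α).
Proof.
intros Hα Cg; assert (Lα := pt_limit κ Rκ α Hα); assert (Lκ := limit_κ κ Rκ).
split; intros H x Hx; assert (Hx' := pt_inV κ Rκ α x Hα Hx).
- destruct (H x Hx) as [y [Hy K]]; apply mem_trace in K; destruct K as [K _].
  apply mem_graph in K; auto; now subst.
- exists (g x); split; auto; apply mem_trace; split; [now apply mem_graph|].
  apply inV_op; auto.
Qed.

(** The covering data turn truth of [p] into an instance of [U] at every regular closure point of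
    [g]. Reflection of that instance from the least such point where [p] holds would contradict
    minimality. *)
Lemma reflects_nonreflecting : reflects b κ ζ κ -> reflects b κ ζ nonreflecting.
Proof.
intros H p Q Hp Sp Tp FQ; assert (Lκ := limit_κ κ Rκ).
destruct (cover b κ hb Rκ ζ p Hp Hζ (proj1 Sp) empty 2 (fun _ => 0)) as [D [_ [_ FD]]];
  [now apply inV_empty|lia|lia|].
destruct (forced_and κ Rκ _ _ FQ FD) as [g [Cg Hg]].
destruct (mem_minimal (fun α => α ∈ κ /\ regular α /\ closed_under g α /\
  true_at b κ α p)) as [α [[Hα [R [C T]]] Min]].
{ destruct (H p (closed_under g) Hp Sp Tp) as [α Hα]; [exists g; auto|eauto]. }
assert (HU : forall α B, α ∈ κ -> regular α -> closed_under g α ->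
  (U α (trace α D) B <-> true_at b κ α p)).
{ clear α Hα R C T Min; intros α B Hα R C.
  destruct (Hg α (or_intror (conj Hα R)) C) as [_ Cov].
  assert (A : forall S, agrees α empty D (env (trace α D) B S 0)).
  { intros S s' v i _ Hv; simpl; rewrite mem_trace; tauto. }
  assert (E : true_at b κ α p <-> eval b κ α e0 e0 p).
  { split; [intros K; apply K|intros K e1 e2].
    apply (eval_sentence b κ α p e0 e0); auto. }
  assert (F : forall k, free2 k p -> forall v : M, inV v α ->
     (v ∈ e0 k <-> op (num k) v ∈ env (trace α D) B empty 0))
    by (intros k Hk; destruct (proj2 Sp k Hk)).
  destruct (classic (ζ = empty)) as [Z|Z].
  - rewrite E, <- (proj1 (Cov W (env (trace α D) B empty) e0 HW (A empty) F) Z).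
    unfold U; assert (G : forall S, upd (env (trace α D) B empty) 2 S = env (trace α D) B S).
    { intros S; apply functional_extensionality; intros [|[|[|n]]]; reflexivity. }
    split; intros [S [HS K]]; exists S; split; auto; rewrite G in *; auto.
  - assert (G : forall S, eval b κ α e0 (env (trace α D) B S) W <-> eval b κ α e0 e0 p)
      by (intros S; exact (proj2 (Cov W _ e0 HW (A S) F) Z)).
    rewrite E; split; [intros [S [HS K]]; now apply (G S)|].
    intros K; exists empty; split; [apply subV_empty|now apply G]. }
assert (Pα : pt κ α) by (right; auto).
exists α; split; [|split; [auto|split; [now apply Hg|auto]]].
apply mem_sep; split; [auto|split; [auto|]]; intros G.
(* The graph of [g] is the certificate: the reflecting point [α'] is then closed under [g] as well,
   so the data still describe [p] there. *)
destruct (G (trace α D) (trace α (graph g κ))) as [α' [Hα' [R' [K1 K2]]]];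
  try apply subV_trace.
- now apply total_at_graph.
- now apply HU.
- assert (Hα2 : α' ∈ κ) by exact (ordinal_trans κ α α' (ordinal_κ κ Rκ) Hα Hα').
  assert (I : forall x, inV x α' -> inV x α)
    by (intros x; exact (inV_mono x α α' (proj1 (pt_ordinal κ Rκ α Pα)) Hα')).
  rewrite !trace_trace in * by exact I.
  apply total_at_graph in K1; auto; [|right; auto].
  apply HU in K2; auto.
  apply (Min α' Hα'); auto.
Qed.

(** Satisfaction in V_α for [α] below [κ], taken from outside as a relation between elements of V_κ.
    Subsets of V_α' are elements of V_α when [α'] is below [α], so first-order quantifiers can range
    over them. *)
Definition reflection_set : M := binary κ (fun α w => exists a c, w = op a c /\
  α ∈ κ /\ regular α /\ total_at α c /\ U α a c).

Definition is_trace (m n : nat) : @fo M :=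
  All 4 (Iff (In (Var 4) (Var m))
    (And (Ap (Var 4) (Var n)) (rel (Par (binary κ (@inV M))) (Var 4) (Var 0)))).

Definition reflection_fo : @fo M :=
  Exi 0 (Exi 1 (Exi 2 (Exi 3 (And (rel (Par reflection_set) (Var 0) (Var 1))
    (And (is_op (Var 1) (Var 2) (Var 3)) (And (is_trace 2 0) (is_trace 3 1))))))).

Lemma fsat_is_trace α α' m n e1 e2 : limit α -> (forall x, inV x α -> inV x κ) ->
  m < 4 -> inV α' α -> e1 0 = α' -> inV (e1 m) α -> α' ∈ α ->
  (fsat α e1 e2 (is_trace m n) <-> e1 m = trace α' (e2 n)).
Proof.
intros L I Hm Hα' E0 Hem Hα2; unfold is_trace; rewrite fsat_All.
assert (Lκ := limit_κ κ Rκ).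
assert (E : forall x, inV x α -> (fsat α (upd e1 4 x) e2 (Iff (In (Var 4) (Var m))
    (And (Ap (Var 4) (Var n)) (rel (Par (binary κ (@inV M))) (Var 4) (Var 0)))) <->
    (x ∈ e1 m <-> x ∈ trace α' (e2 n)))).
{ intros x Hx; rewrite fsat_Iff, fsat_In, fsat_And, fsat_Ap, fsat_rel; simpl; try lia; auto.
  - rewrite upd_eq, !upd_neq, mem_trace, E0 by lia.
    rewrite mem_binary by auto; tauto.
  - rewrite upd_neq by lia; now rewrite E0. }
split.
- intros H; apply ext_eq; intros x; split; intros Hx.
  + assert (Q : inV x α) by exact (inV_trans _ _ _ (proj1 (proj1 L)) Hx Hem).
    now apply (proj1 (E x Q) (H x Q)).
  + assert (Q : inV x α).
    { apply mem_trace in Hx; exact (inV_mono x α α' (proj1 (proj1 L)) Hα2 (proj2 Hx)). }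
    now apply (proj1 (E x Q) (H x Q)).
- intros H x Hx; apply E; auto; rewrite H; tauto.
Qed.

Lemma fsat_reflection α e1 e2 : pt κ α -> (fsat α e1 e2 reflection_fo <->
  exists α', α' ∈ α /\ regular α' /\ total_at α' (trace α' (e2 1)) /\
    U α' (trace α' (e2 0)) (trace α' (e2 1))).
Proof.
intros Hα; assert (Lα := pt_limit κ Rκ α Hα); assert (Lκ := limit_κ κ Rκ).
assert (I := fun x => pt_inV κ Rκ α x Hα).
set (body := And (rel (Par reflection_set) (Var 0) (Var 1))
    (And (is_op (Var 1) (Var 2) (Var 3)) (And (is_trace 2 0) (is_trace 3 1)))).
assert (E : forall α' w a c, inV α' α -> inV w α -> inV a α -> inV c α -> 
  (fsat α (upd (upd (upd (upd e1 0 α') 1 w) 2 a) 3 c) e2 body <->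
   w = op a c /\ α' ∈ α /\ regular α' /\ total_at α' c /\ U α' a c /\
   a = trace α' (e2 0) /\ c = trace α' (e2 1))).
{ intros α' w a c H1 H2 H3 H4; unfold body; rewrite !fsat_And.
  rewrite fsat_rel, fsat_is_op by (auto; try discriminate; simpl; auto; lia).
  set (e := upd (upd (upd (upd e1 0 α') 1 w) 2 a) 3 c).
  change (val e (Var 0)) with α'; change (val e (Var 1)) with w.
  change (val e (Var 2)) with a; change (val e (Var 3)) with c.
  simpl; unfold reflection_set; rewrite mem_binary by auto.
  split.
  - intros [[a' [c' [Ew [K1 [K2 [K3 K4]]]]]] [Ew' [T1 T2]]].
    rewrite Ew in Ew'; apply op_inj in Ew'; destruct Ew' as [-> ->].
    assert (K5 : α' ∈ α) by now apply (pt_inV_mem κ Rκ α α').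
    rewrite (fsat_is_trace α α') in T1, T2; auto.
    change (e 2) with a in T1; change (e 3) with c in T2; tauto.
  - intros [Ew [K1 [K2 [K3 [K4 [Ea Ec]]]]]].
    assert (K5 : α' ∈ κ) by exact (pt_mem κ Rκ α α' Hα K1).
    rewrite !(fsat_is_trace α α'); auto.
    split; [exists a, c; auto|auto]. }
unfold reflection_fo; fold body; split.
- rewrite fsat_Exi; intros [α' [H1 H]].
  rewrite fsat_Exi in H; destruct H as [w [H2 H]].
  rewrite fsat_Exi in H; destruct H as [a [H3 H]].
  rewrite fsat_Exi in H; destruct H as [c [H4 H]].
  apply E in H; auto; destruct H as [_ [K1 [K2 [K3 [K4 [-> ->]]]]]]; eauto.
- intros [α' [K1 [K2 [K3 K4]]]].
  assert (H1 : inV α' α) by (apply (pt_inV_mem κ Rκ α α' Hα); auto; exact (pt_mem κ Rκ α α' Hα K1)).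
  assert (V : forall A, inV (trace α' A) α)
    by (intros A; exact (subV_inV _ α α' (proj1 Lα) K1 (subV_trace α' A))).
  apply fsat_Exi; exists α'; split; auto.
  apply fsat_Exi; exists (op (trace α' (e2 0)) (trace α' (e2 1))); split; [now apply inV_op|].
  apply fsat_Exi; exists (trace α' (e2 0)); split; auto.
  apply fsat_Exi; exists (trace α' (e2 1)); split; auto.
  apply E; auto; [now apply inV_op|].
  do 5 (split; auto).
Qed.

Definition counterexample_fo : @fo M := And (total (Var 1)) (Neg reflection_fo).

Lemma free1_counterexample n : ~ fo_free1 n counterexample_fo.
Proof.
unfold counterexample_fo, reflection_fo, is_trace, Exi, Iff, Imp; cbn [fo_free1].
intros [H|H]; [exact (free1_total _ _ H)|].
destruct H as [N0 [N1 [N2 [N3 H]]]].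
repeat match goal with
 | H : _ /\ _ |- _ => destruct H
 | H : _ \/ _ |- _ => destruct H
 | H : fo_free1 _ (rel _ _ _) |- _ => apply free1_rel in H
 | H : fo_free1 _ (is_op _ _ _) |- _ => apply free1_is_op in H
 end; congruence.
Qed.

Lemma free2_counterexample n : fo_free2 n counterexample_fo -> n < 2.
Proof.
unfold counterexample_fo, reflection_fo, is_trace, Exi, Iff, Imp; cbn [fo_free2].
intros H; repeat match goal with
 | H : _ \/ _ |- _ => destruct H
 | H : fo_free2 _ (total _) |- _ => apply free2_total in H
 | H : fo_free2 _ (rel _ _ _) |- _ => apply free2_rel in H
 | H : fo_free2 _ (is_op _ _ _) |- _ => apply free2_is_op in H
 | H : Var _ = Var _ |- _ => injection H as H
 end; try discriminate; try tauto; lia.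
Qed.

Lemma fo_over_counterexample : fo_over κ counterexample_fo.
Proof.
assert (V : subV (Vset κ) κ) by (intros x; apply mem_Vset).
split; intros a; unfold counterexample_fo, reflection_fo, is_trace, Exi, Iff, Imp;
cbn [fo_par1 fo_par2]; intros H; repeat match goal with
 | H : _ \/ _ |- _ => destruct H
 | H : fo_par1 _ (total _) |- _ => destruct (par1_total _ _ H)
 | H : fo_par1 _ (rel _ _ _) |- _ => apply par1_rel in H
 | H : fo_par1 _ (is_op _ _ _) |- _ => apply par1_is_op in H
 | H : fo_par2 _ (total _) |- _ => apply par2_total in H
 | H : fo_par2 _ (rel _ _ _) |- _ => apply par2_rel in H
 | H : fo_par2 _ (is_op _ _ _) |- _ => apply par2_is_op in H
 | H : Par _ = Par _ |- _ => injection H as <-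
 end; try discriminate; try tauto; now apply subV_sep.
Qed.

(** No triple has the instance of [W] true and yet fails to reflect. The first-order failure is
    pushed into the leaves of [W], so the matrix is the dual of a Π^1_ζ formula and three universal
    quantifiers give Π^1_(ζ+1). *)
Definition reflection_sentence : form :=
  all2s [0; 1; 2] (neg (andfo counterexample_fo W)).

Lemma Pi1_reflection_sentence : Pi1 κ (succ ζ) reflection_sentence.
Proof.
apply Pi1_succ; [apply (cs_ordinal κ Rκ ζ Hζ)|].
apply Sigma1_neg, Pi1_Sigma1_andfo; [apply fo_over_counterexample|].
apply (Pi1_universal b κ hb Rκ ζ empty 2); auto; apply inV_empty, limit_κ, Rκ.
Qed.

Lemma sentence_reflection_sentence : sentence reflection_sentence.
Proof.
unfold reflection_sentence; split; intros n.
- rewrite free1_all2s, free1_neg; intros H; apply free1_andfo in H; destruct H as [H|H].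
  + exact (universal_free1 b κ n _ _ _ _ HW H).
  + exact (free1_counterexample n H).
- rewrite free2_all2s, free2_neg; intros [N H]; simpl in N.
  assert (n <= 2); [|lia].
  apply free2_andfo in H; destruct H as [H|H].
  + apply (universal_free2 b κ n _ _ _ _ HW); auto.
  + apply free2_counterexample in H; lia.
Qed.

Lemma eval_reflection_sentence α : pt κ α -> coh b κ α ζ ->
  (true_at b κ α reflection_sentence <->
   forall A B S, subV A α -> subV B α -> subV S α -> total_at α B ->
     eval b κ α e0 (env A B S) W ->
     exists α', α' ∈ α /\ regular α' /\ total_at α' (trace α' B) /\
       U α' (trace α' A) (trace α' B)).
Proof.
intros Hα C; assert (Lα := pt_limit κ Rκ α Hα); assert (Lκ := limit_κ κ Rκ).
assert (Hok : ok b κ α W).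
{ apply (ok_Pi1 b κ Rκ α ζ); auto.
  apply (Pi1_universal b κ hb Rκ ζ empty 2); auto; now apply inV_empty. }
assert (E : forall A B S e1 e2,
  eval b κ α e1 (upd (upd (upd e2 0 A) 1 B) 2 S) (andfo counterexample_fo W) <->
  eval b κ α e0 (env A B S) W /\ total_at α B /\
  ~ exists α', α' ∈ α /\ regular α' /\ total_at α' (trace α' B) /\
       U α' (trace α' A) (trace α' B)).
{ intros A B S e1 e2; rewrite eval_andfo; auto.
  - unfold counterexample_fo; rewrite fsat_And, fsat_Neg, fsat_total, fsat_reflection by auto.
    rewrite (eval_agree b κ α W e1 _ e0 (env A B S)).
    + reflexivity.
    + intros n Hn; destruct (universal_free1 b κ n _ _ _ _ HW Hn).
    + intros n Hn; apply (universal_free2 b κ n _ _ _ _ HW) in Hn; auto.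
      destruct n as [|[|[|n]]]; try reflexivity; lia.
  - intros n Hn K; apply (universal_bound2 b κ n _ _ _ _ HW) in Hn.
    apply free2_counterexample in K; lia. }
unfold reflection_sentence; simpl; split.
- intros H A B S HA HB HS TB K; specialize (H e0 e0 A HA B HB S HS).
  apply eval_neg in H; apply NNPP; intros N; apply H, E; auto.
- intros H e1 e2 A HA B HB S HS; apply eval_neg; intros K; apply E in K.
  destruct K as [K1 [K2 K3]]; apply K3; eauto.
Qed.

(** For given [A], [B], [S] the instance of [W] becomes a Π^1_ζ sentence with these as parameters.
    It reflects to a point closed under a choice function for [B], which is the required witness. *)
Lemma true_reflection_sentence : reflects b κ ζ κ ->
  true_at b κ κ reflection_sentence.
Proof.
intros H; assert (Lκ := limit_κ κ Rκ).
apply eval_reflection_sentence; [apply pt_top|now apply coh_top|].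
intros A B S HA HB HS TB K.
destruct (choice_on M M empty (fun x => inV x κ)
  (fun x y => inV y κ /\ op x y ∈ B) TB) as [g Hg].
set (σ := fun n => match n with 0 => Some A | 1 => Some B | 2 => Some S | _ => None end).
assert (Hσ : finite_range σ /\ forall n C, σ n = Some C -> subV C κ).
{ split; [exists [A; B; S]|]; intros [|[|[|n]]] C E; simpl in E; try discriminate;
  injection E as <-; simpl; auto. }
assert (E : forall α, with_params α σ e0 = env (trace α A) (trace α B) (trace α S)).
{ intros α; apply functional_extensionality; intros [|[|[|n]]]; reflexivity. }
assert (Sσ : sentence (sub σ W)).
{ split; intros n Hn.
  - apply free1_sub in Hn; exact (universal_free1 b κ n _ _ _ _ HW Hn).
  - apply free2_sub in Hn; destruct Hn as [Hn Hn'].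
    apply (universal_free2 b κ n _ _ _ _ HW) in Hn; auto.
    destruct n as [|[|[|n]]]; try discriminate; lia. }
assert (T : forall C, subV C κ -> trace κ C = C).
{ intros C HC; apply ext_eq; intros x; rewrite mem_trace; split; [tauto|auto]. }
destruct (H (sub σ W) (closed_under g)) as [α [Hα [R [C Tα]]]]; auto.
- apply (proj1 (Pi1_Sigma1_sub κ) ζ W); auto.
  apply (Pi1_universal b κ hb Rκ ζ empty 2); auto; now apply inV_empty.
- intros e1 e2; apply (eval_sentence b κ κ _ e0 e0); auto.
  apply eval_sub; rewrite E, !T; auto.
- exists g; split; auto; intros x Hx; now apply Hg.
- assert (Pα : pt κ α) by (right; auto).
  exists α; split; [auto|split; [auto|split]].
  + intros x Hx; exists (g x); split; [now apply C|].
    apply mem_trace; split; [apply Hg; exact (pt_inV κ Rκ α x Pα Hx)|].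
    apply inV_op; [exact (pt_limit κ Rκ α Pα)|exact Hx|now apply C].
  + exists (trace α S); split; [apply subV_trace|].
    rewrite <- E; apply eval_sub, Tα.
Qed.

(** The sentence would hold at some coherent point of the set, and there it says precisely that the
    point is reflecting; the set [S] hidden in [U] serves as the third quantified set. *)
Lemma not_reflects_nonreflecting : reflects b κ ζ κ ->
  ~ reflects b κ (succ ζ) nonreflecting.
Proof.
intros H K.
destruct (K reflection_sentence (fun α => coh b κ α ζ)) as [α [Hα [R [C T]]]].
- apply Pi1_reflection_sentence.
- apply sentence_reflection_sentence.
- now apply true_reflection_sentence.
- now apply forced_coh.
- apply mem_sep in Hα; destruct Hα as [Hα [_ N]]; apply N.
  intros A B HA HB TB [S [HS HU]].
  exact (proj1 (eval_reflection_sentence α (or_intror (conj Hα R)) C) T A B S HA HB HS TB HU).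
Qed.

End NonReflecting.

Theorem corollary5p15
  (M : zfc) (b : M -> M -> M -> M) (hb : canonical_bijections b)
  (κ ξ : M) (hκ : cardinal κ) (hξ : ξ ∈ cardsucc κ)
  (hind : indescribable b κ ξ) :
  forall ζ : M, ζ ∈ ξ ->
    Pi1_ideal b κ ζ ⊆ Pi1_ideal b κ ξ /\ Pi1_ideal b κ ζ <> Pi1_ideal b κ ξ.
Proof.
intros ζ Hζ.
assert (Rκ : regular κ) by exact (indescribable_regular b κ hb hκ ξ hξ hind).
assert (Hζ' : ζ ∈ cardsucc κ) by exact (cs_trans κ Rκ ξ ζ hξ Hζ).
assert (Oξ := cs_ordinal κ Rκ ξ hξ).
assert (D : forall η X, η ∈ cardsucc κ -> X ⊆ κ ->
  (indescribable_in b κ η X <-> reflects b κ η X))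
  by (intros η X; exact (indescribable_reflects b κ hb hκ Rκ η X)).
assert (Hκ : reflects b κ ζ κ)
  by (apply (reflects_mono b κ hb Rκ ζ ξ); auto; apply D; auto).
assert (I : forall z, z ∈ Pi1_ideal b κ ζ -> z ∈ Pi1_ideal b κ ξ).
{ intros X HX; apply mem_sep in HX; destruct HX as [HX N]; apply mem_sep; split; auto.
  assert (SX := proj1 (mem_power κ X) HX).
  rewrite D in * by auto; intros K; apply N.
  exact (reflects_mono b κ hb Rκ ζ ξ X hξ Hζ K). }
split; [exact I|]; intros E.
destruct (universal_exists b κ ζ (cs_ordinal κ Rκ ζ Hζ') empty 2) as [W HW].
set (T := nonreflecting b κ W).
assert (ST : T ⊆ κ) by (intros x Hx; now apply mem_sep in Hx).
assert (NT : ~ T ∈ Pi1_ideal b κ ζ).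
{ intros K; apply mem_sep in K; apply (proj2 K), D; auto.
  now apply (reflects_nonreflecting b κ hb Rκ ζ W). }
apply NT; rewrite E; apply mem_sep; split; [now apply mem_power|].
rewrite D by auto; intros K.
apply (not_reflects_nonreflecting b κ hb Rκ ζ W Hζ' HW Hκ).
(* The separating set fails at the successor of [ζ], which is at most [ξ]; monotonicity carries the
   failure up to [ξ]. *)
destruct (ordinal_succ_mem ξ ζ Oξ Hζ) as [<-|L]; auto.
exact (reflects_mono b κ hb Rκ (succ ζ) ξ _ hξ L K).
Qed.
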